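(* Fix $p$ and $r$, and hence $k=2pr$, and let $n\to\infty$. Let $\boldsymbol\mu=(\mu_1,\dots,\mu_p)^{\rm T}$ and let $\boldsymbol\Sigma=\boldsymbol\Phi\boldsymbol\rho\boldsymbol\Phi$ be a full rank covariance matrix, where $\boldsymbol\Phi=\mathrm{diag}(\sigma_1,\dots,\sigma_p)$ is a diagonal matrix of standard deviations and $\boldsymbol\rho$ is a correlation matrix. Assume that $\mathbf{z}_1,\dots,\mathbf{z}_n$ are i.i.d. with a distribution specified below. Let $\hat{\boldsymbol\beta}^{\mathrm D}$ be the least squares estimator of $(\beta_0,\beta_1,\dots,\beta_p)^{\rm T}$ computed from the subdata of size $k$ selected by the D-optimality motivated algorithm (described in the context). (i) If $\mathbf{z}_i\sim N(\boldsymbol\mu,\boldsymbol\Sigma)$ (multivariate normal), then $$\mathrm{V}(\mathbf{A}_n\hat{\boldsymbol\beta}^{\mathrm D}|\mathbf{Z})=\frac{\sigma^2}{2k}\begin{bmatrix}2&\mathbf{0}\\ \mathbf{0}&p(\boldsymbol\Phi\boldsymbol\rho^2\boldsymbol\Phi)^{-1}\end{bmatrix}+O_P\left(\frac{1}{\sqrt{\log n}}\right),$$ where $\mathbf{A}_n=\mathrm{diag}(1,\sqrt{\log n},\dots,\sqrt{\log n})$. (ii) If $\mathbf{z}_i\sim\mathrm{LN}(\boldsymbol\mu,\boldsymbol\Sigma)$ (multivariate lognormal), then $$\mathrm{V}(\mathbf{A}_n\hat{\boldsymbol\beta}^{\mathrm D}|\mathbf{Z})=\frac{2\sigma^2}{k}\begin{bmatrix}1&-\mathbf{u}^{\rm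 T}\\-\mathbf{u}&p\boldsymbol\Lambda+\mathbf{u}\mathbf{u}^{\rm T}\end{bmatrix}+o_P(1),$$ where $\mathbf{A}_n=\mathrm{diag}\{1,\exp(\sigma_1\sqrt{2\log n}),\dots,\exp(\sigma_p\sqrt{2\log n})\}$, $\mathbf{u}=(e^{-\mu_1},\dots,e^{-\mu_p})^{\rm T}$ and $\boldsymbol\Lambda=\mathrm{diag}(e^{-2\mu_1},\dots,e^{-2\mu_p})$.
   Context: Model: $y_i=\beta_0+\sum_{j=1}^pz_{ij}\beta_j+\varepsilon_i$, $i=1,\dots,n$, with $\mathbf{z}_i=(z_{i1},\dots,z_{ip})^{\rm T}$ and $\mathbf{Z}=(\mathbf{z}_1,\dots,\mathbf{z}_n)^{\rm T}$. Given $\mathbf{Z}$, the errors have mean $0$, variance $\sigma^2>0$ and are uncorrelated. $\mathbf{z}\sim\mathrm{LN}(\boldsymbol\mu,\boldsymbol\Sigma)$ means $z_j=e^{U_j}$, $j=1,\dots,p$, with $(U_1,\dots,U_p)^{\rm T}\sim N(\boldsymbol\mu,\boldsymbol\Sigma)$. D-optimality motivated algorithm: let $r\ge1$ be an integer and $k=2pr\le n$. (1) For the first covariate, select the $r$ data points with the $r$ smallest values of $z_{i1}$ and the $r$ data points with the $r$ largest values of $z_{i1}$. (2) For $j=2,\dots,p$ successively, exclude the data points previously selected, and from the remaining data points select the $r$ data points with the smallest values of $z_{ij}$ and the $r$ data points with the largest values of $z_{ij}$. (3) With $\mathbf{Z}^*_{\mathrm D}$ ($k\times p$) and $\mathbf{y}^*_{\mathrm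 D}$ the covariate matrix and response vector of the $k$ selected data points and $\mathbf{X}^*_{\mathrm D}=(\mathbf{1},\mathbf{Z}^*_{\mathrm D})$, the estimator is $\hat{\boldsymbol\beta}^{\mathrm D}=\{(\mathbf{X}^*_{\mathrm D})^{\rm T}\mathbf{X}^*_{\mathrm D}\}^{-1}(\mathbf{X}^*_{\mathrm D})^{\rm T}\mathbf{y}^*_{\mathrm D}$, so that its covariance matrix given $\mathbf{Z}$ is $\sigma^2\{(\mathbf{X}^*_{\mathrm D})^{\rm T}\mathbf{X}^*_{\mathrm D}\}^{-1}$. $\mathrm{V}(\cdot|\mathbf{Z})$ is the covariance matrix given $\mathbf{Z}$ (a random matrix, through $\mathbf{Z}$). $O_P$ and $o_P$ statements for matrices are entrywise: $O_P(a_n)$ denotes a term whose entries divided by $a_n$ are bounded in probability, and $o_P(1)$ a term converging to zero in probability, as $n\to\infty$. $\boldsymbol\rho^2$ is the matrix product $\boldsymbol\rho\boldsymbol\rho$. *)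

(* Defs.v *)
From HB Require Import structures.
From mathcomp Require Import all_boot all_order all_algebra.
From mathcomp Require Import all_classical all_reals all_analysis.

Set Implicit Arguments.
Unset Strict Implicit.
Unset Printing Implicit Defensive.

Import Order.TTheory GRing.Theory Num.Theory.
Import numFieldNormedType.Exports.

Local Open Scope classical_set_scope.
Local Open Scope ring_scope.

Section Independence.
Context {d d' : measure_display} {T : measurableType d} {T' : measurableType d'}.
Context {R : realType} (P : probability T R).

Definition mutually_independent (I : choiceType) (X : I -> {RV P >-> T'}) :=
  forall (s : seq I) (B : I -> set T'), uniq s ->
    (forall i, i \in s -> measurable (B i)) ->
    (P (\big[setI/setT]_(i <- s) (X i @^-1` B i)) =
     \prod_(i <- s) P (X i @^-1` B i))%E.

Definition identically_distributed (I : Type) (X : I -> {RV P >-> T'}) :=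
  forall (i j : I) (B : set T'), measurable B ->
    distribution P (X i) B = distribution P (X j) B.

End Independence.

Section RandomVectors.
Context {d : measure_display} {T : measurableType d}.
Context {R : realType} (P : probability T R) (p : nat).

Definition vec (x : p.-tuple R) : 'cV[R]_p := \col_j tnth x j.

(* [X = mu + A g] with [g] standard normal and [A A^T = Sigma].  As [A] is
   square, [g = A^-1 (X - mu)] for nonsingular [Sigma], so that asking for [g]
   on the probability space of [X] is then no restriction on the law of [X]. *)
Definition mvnormal (mu : 'cV[R]_p) (Sigma : 'M[R]_p)
    (X : {RV P >-> p.-tuple R}) :=
  exists (A : 'M[R]_p) (g : 'I_p -> {RV P >-> R}),
    [/\ A *m A^T = Sigma,
        mutually_independent g,
        forall j (B : set R), measurable B ->
          distribution P (g j) B = normal_prob 0 1 B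
      & forall w, vec (X w) = mu + A *m \col_j g j w].

Definition mvlognormal (mu : 'cV[R]_p) (Sigma : 'M[R]_p)
    (X : {RV P >-> p.-tuple R}) :=
  exists U : {RV P >-> p.-tuple R}, mvnormal mu Sigma U /\
    {ae P, forall w, forall j, tnth (X w) j = expR (tnth (U w) j)}.

Definition correlation_matrix (rho : 'M[R]_p) :=
  [/\ rho^T = rho,
      forall v : 'cV[R]_p, 0 <= (v^T *m rho *m v) ord0 ord0
    & forall j, rho j j = 1].

End RandomVectors.

Section ConditionalMoments.
Context {d : measure_display} {T : measurableType d}.
Context {R : realType} (P : probability T R) (G : set (set T)).

(* [Y] is a version of E[X | G].  A least squares estimator based on a random
   design is in general not integrable, [(X^T X)^-1] being unbounded, so [X] is
   only required to be integrable on each set of a countable cover of [T] by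
   sets of [G]; for integrable [X] this is the usual notion. *)
Definition is_condexp (X Y : T -> R) :=
  (forall B : set R, measurable B -> G (Y @^-1` B)) /\
  exists F : nat -> set T,
    [/\ forall k, G (F k),
        \bigcup_k F k = setT,
        forall k, P.-integrable (F k) (EFin \o X)
      & forall k B, G B -> B `<=` F k ->
          (\int[P]_(w in B) (X w)%:E = \int[P]_(w in B) (Y w)%:E)%E].

(* Defaults to 0 if there is no version. *)
Definition condexp (X : T -> R) : T -> R :=
  xget (cst 0) [set Y | is_condexp X Y].

Definition condcov (X Y : T -> R) : T -> R :=
  condexp (fun w => (X w - condexp X w) * (Y w - condexp Y w)).

Definition condcov_mx (m : nat) (X : T -> 'cV[R]_m) (w : T) : 'M[R]_m :=
  \matrix_(a, b) condcov (fun v => X v a ord0) (fun v => X v b ord0) w.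

End ConditionalMoments.

Section StochasticOrder.
Context {d : measure_display} {T : measurableType d}.
Context {R : realType} (P : probability T R) (m l : nat).
Implicit Type W : nat -> T -> 'M[R]_(m, l).

Definition OP_mx W (a : nat -> R) :=
  forall i j (e : R), 0 < e -> exists M : R,
    \forall n \near \oo, (P [set w | (M < `|W n w i j / a n|)%R] <= e%:E)%E.

Definition oP1_mx W :=
  forall i j (e : R), 0 < e ->
    (fun n => P [set w | e < `|W n w i j|]) @ \oo --> 0%E.

End StochasticOrder.

Section DOptimalSubdata.
Context {R : realType} {n p : nat} (r : nat) (Z : 'M[R]_(n, p)).

(* The state is (selected points, remaining points).  The sort is stable, so
   ties between covariate values are broken by position; they have probability
   zero for continuous covariates. *)
Definition dopt_step (st : seq 'I_n * seq 'I_n) (j : 'I_p) :=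
  let s := sort (fun a b => Z a j <= Z b j) st.2 in
  (st.1 ++ take r s ++ drop (size s - r) s,
   drop r (take (size s - r) s)).

Definition dopt_select : seq 'I_n :=
  (foldl dopt_step ([::], enum 'I_n) (enum 'I_p)).1.

Definition design (m : nat) (M : 'M[R]_(m, p)) : 'M[R]_(m, 1 + p) :=
  row_mx (const_mx 1) M.

Definition ols (m q : nat) (X : 'M[R]_(m, q)) (y : 'cV[R]_m) : 'cV[R]_q :=
  invmx (X^T *m X) *m X^T *m y.

Definition dopt_ols (y : 'cV[R]_n) : 'cV[R]_(1 + p) :=
  let sel := tnth (in_tuple dopt_select) in
  ols (design (rowsub sel Z)) (rowsub sel y).

End DOptimalSubdata.

Section LinearModel.
Context {d : measure_display} {T : measurableType d}.
Context {R : realType} (P : probability T R) (p : nat).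
Context (z : nat -> {RV P >-> p.-tuple R}) (eps : nat -> {RV P >-> R}).

Definition covmx (n : nat) (w : T) : 'M[R]_(n, p) :=
  \matrix_(i, j) tnth (z i w) j.

Definition sigmaZ (n : nat) : set (set T) :=
  g_sigma_algebra_preimage (fun w => [tuple z i w | i < n]).

Definition response (beta : 'cV[R]_(1 + p)) (n : nat) (w : T) : 'cV[R]_n :=
  design (covmx n w) *m beta + \col_i eps i w.

(* As the conditional means are 0, the second clause is on the conditional
   variances and covariances. *)
Definition homoscedastic_errors (sigma : R) :=
  forall n i j, (i < n)%N -> (j < n)%N ->
    is_condexp P (sigmaZ n) (eps i) (cst 0) /\
    is_condexp P (sigmaZ n) (fun w => eps i w * eps j w)
      (cst (if i == j then sigma ^+ 2 else 0)).

Definition betaD (r : nat) (beta : 'cV[R]_(1 + p)) (n : nat) (w : T) :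
    'cV[R]_(1 + p) :=
  dopt_ols r (covmx n w) (response beta n w).

End LinearModel.

(* Main.v *)
(** Given the covariates, the estimator is a linear function of the errors, so
    its conditional covariance matrix is almost surely [sigma^2 (X^T X)^-1]
    for the design [X] of the subdata, whenever [X^T X] is invertible.  With the
    columns of [X] divided by the diagonal of [A_n], the Gram matrix converges
    to [r * sum_(j, s) v v^T], where [v = v j s] is the limit of the normalized
    regressors in the block of the largest or smallest values of covariate [j];
    the rate is preserved by matrix inversion, which is locally Lipschitz.

    For the limits [v j s], let [S] be the standardized normal covariates and
    let [c] be the level with [n P(S_j > c) = lambda].  When [lambda] is large,
    there are at least [2 p r] exceedances of [c] in every direction with high
    probability, so that excluding the points already selected never pushes a
    selected point below [c], while the Gaussian tail puts [c] and the maximum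
    within [delta] of [sqrt (2 log n)].  The residual [S_l - rho_jl S_j] is
    independent of [S_j] by rotation invariance; since only about [lambda]
    points exceed [c], it is bounded over all of them with high probability. *)

Require Import Defs.
From HB Require Import structures.
From mathcomp Require Import all_boot all_order all_algebra.
From mathcomp Require Import all_classical all_reals all_analysis.
From mathcomp Require Import measurable_realfun ring lra.

Set Implicit Arguments.
Unset Strict Implicit.
Unset Printing Implicit Defensive.

Import Order.TTheory GRing.Theory Num.Theory.
Import numFieldNormedType.Exports.

Local Open Scope classical_set_scope.
Local Open Scope ring_scope.

(** * Conditional expectation *)

(** Distance 1 suffices for normal covariates, which get divided by [sqrt (log n)]; lognormal ones
    are exponentials, and only an absolute error tending to 0 leaves a factor tending to 1. A
    nonrandom level [c] avoids the joint law of order statistics under a selection that adapts to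
    earlier choices; all matrix steps are then deterministic off an event of probability at most
    [e]. In the block of covariate [j], the standardized covariate [l] is near plus or minus
    [rho j l * sqrt (2 log n)]. In the normal case the opposite signs cancel the terms mixing
    intercept and slopes, and summing over [j] produces the product of [rho] with itself. In the
    lognormal case full rank gives [|rho j l| < 1] for [l != j], so that exponentiation leaves only
    covariate [j] itself at its upper end, and [rho] disappears from the limit. *)

Section ConditionalExpectation.
Context {d : measure_display} {T : measurableType d} {R : realType}.
Context (P : probability T R) (G : set (set T)).
Context (HG : sigma_algebra setT G) (Gm : G `<=` measurable).

(** [G] is a bare family of sets, as in [is_condexp]; [gmeasE] passes to the measurable structure
    that it generates when closure properties are wanted. *)
Definition gmeas (h : T -> R) := forall B : set R, measurable B -> G (h @^-1` B).

Lemma gmeasE h : gmeas h <-> measurable_fun [set: g_sigma_algebraType G] h.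
Proof.
split=> [gh _ B mB|mh B mB].
  by rewrite setTI; apply: sub_sigma_algebra; exact: gh.
have := mh measurableT B mB; rewrite setTI => H.
by rewrite -(sigma_algebra_id HG).
Qed.

Lemma gmeas_measurable h : gmeas h -> measurable_fun setT h.
Proof. by move=> gh _ B mB; rewrite setTI; apply: Gm; exact: gh. Qed.

Lemma gmeas_cst c : gmeas (cst c).
Proof. by apply/gmeasE; exact: measurable_cst. Qed.

Lemma gmeasD h1 h2 : gmeas h1 -> gmeas h2 -> gmeas (fun w => h1 w + h2 w).
Proof. by move=> /gmeasE H1 /gmeasE H2; apply/gmeasE; exact: measurable_funD. Qed.

Lemma gmeasB h1 h2 : gmeas h1 -> gmeas h2 -> gmeas (fun w => h1 w - h2 w).
Proof. by move=> /gmeasE H1 /gmeasE H2; apply/gmeasE; exact: measurable_funB. Qed.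

Lemma gmeasM h1 h2 : gmeas h1 -> gmeas h2 -> gmeas (fun w => h1 w * h2 w).
Proof. by move=> /gmeasE H1 /gmeasE H2; apply/gmeasE; exact: measurable_funM. Qed.

Lemma gmeas_sum I (s : seq I) (h : I -> T -> R) : (forall i, gmeas (h i)) ->
  gmeas (fun w => \sum_(i <- s) h i w).
Proof.
move=> gh; elim: s => [|i s IH].
  by under eq_fun do rewrite big_nil; exact: gmeas_cst.
by under eq_fun do rewrite big_cons; exact: gmeasD.
Qed.

Lemma gset_setI A B : G A -> G B -> G (A `&` B).
Proof.
move=> GA GB; rewrite -(sigma_algebra_id HG).
by apply: (@measurableI _ (g_sigma_algebraType G)); apply: sub_sigma_algebra.
Qed.

Lemma gset_bounded h m : gmeas h -> G [set w | `|h w| <= m].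
Proof.
move=> gh; have -> : [set w | `|h w| <= m] = h @^-1` `[- m, m]%classic.
  by apply/seteqP; split=> w /=; rewrite in_itv /= ler_norml.
by apply: gh; exact: measurable_itv.
Qed.

Lemma gset_lt h m : gmeas h -> G [set w | m < h w].
Proof.
move=> gh; have -> : [set w | m < h w] = h @^-1` `]m, +oo[%classic.
  by apply/seteqP; split=> w /=; rewrite in_itv /= andbT.
by apply: gh; exact: measurable_itv.
Qed.

Lemma gset_ltr h1 h2 : gmeas h1 -> gmeas h2 -> G [set w | h1 w < h2 w].
Proof.
move=> g1 g2; rewrite (_ : [set _ | _] = [set w | 0 < h2 w - h1 w]).
  by apply: gset_lt; exact: gmeasB.
by apply/seteqP; split=> w /=; rewrite subr_gt0.
Qed.

Lemma gset_ge h m : gmeas h -> G [set w | h w <= m].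
Proof.
move=> gh; have -> : [set w | h w <= m] = h @^-1` `]-oo, m]%classic.
  by apply/seteqP; split=> w /=; rewrite in_itv.
by apply: gh; exact: measurable_itv.
Qed.

Lemma integrable_bounded_mul (h X : T -> R) (B : set T) (M : R) :
  measurable B -> measurable_fun setT h -> (forall w, B w -> `|h w| <= M) ->
  P.-integrable B (EFin \o X) ->
  P.-integrable B (EFin \o (fun w => h w * X w)).
Proof.
move=> mB mh hM iX.
have mX : measurable_fun B X by apply/measurable_EFinP; exact: measurable_int iX.
apply: (@le_integrable _ _ _ P B mB _ (fun w => M%:E * (X w)%:E)%E).
- apply/measurable_EFinP; apply: measurable_funM => //.
  exact: measurable_funTS.
- move=> w Bw /=; rewrite lee_fin !normrM ler_wpM2r//.
  by rewrite (le_trans (hM w Bw))// ler_norm.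
- exact: integrableZl.
Qed.

(* Each split of [B] at the midpoint of the range of [h] halves that range, and
   the constant part of [h] integrates to 0 against [D]. *)
Lemma integral_bisection (D h : T -> R) (N : nat) (B : set T) (m rho : R) :
  gmeas h -> G B -> P.-integrable B (EFin \o D) ->
  (forall C, G C -> C `<=` B -> \int[P]_(w in C) (D w)%:E = 0)%E ->
  (forall w, B w -> `|h w - m| <= rho) ->
  (`|\int[P]_(w in B) (h w * D w)%:E|
    <= (rho / 2 ^+ N)%:E * \int[P]_(w in B) `|(D w)%:E|)%E.
Proof.
move=> gh; have mh := gmeas_measurable gh.
elim: N B m rho => [|N IH] B m rho GB iD D0 hB.
  have mB := Gm GB.
  have mD : measurable_fun B D by apply/measurable_EFinP; exact: measurable_int iD.
  have hm : forall w, B w -> `|h w| <= `|m| + rho.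
    move=> w Bw; rewrite -[h w](subrK m) addrC (le_trans (ler_normD _ _))//.
    by rewrite lerD2l hB.
  have -> : (\int[P]_(w in B) (h w * D w)%:E =
             \int[P]_(w in B) ((h w - m) * D w)%:E)%E.
    transitivity (\int[P]_(w in B) ((h w * D w)%:E - (m * D w)%:E))%E; last first.
      by apply: eq_integral => w _; rewrite mulrBl.
    rewrite integralB_EFin//.
    - have -> : (\int[P]_(w in B) (m * D w)%:E = 0)%E.
        under eq_integral do rewrite EFinM.
        by rewrite integralZl// D0// mule0.
      by rewrite sube0.
    - exact: (integrable_bounded_mul (M := `|m| + rho)).
    - by apply: (integrable_bounded_mul (h := cst m) (M := `|m|)) => // w _.
  have [E0|/set0P[w0 Bw0]] := eqVneq B set0.
    by rewrite E0 !integral_set0 mule0 abse0.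
  have rho0 : 0 <= rho by rewrite (le_trans _ (hB w0 Bw0)).
  rewrite expr0 divr1.
  have m1 : measurable_fun B (fun w => (h w - m) * D w).
    by apply: measurable_funM => //; apply: measurable_funB => //; exact: measurable_funTS.
  apply: (le_trans (le_abse_integral _ _ _)) => //.
    exact/measurable_EFinP.
  rewrite -ge0_integralZl//.
  - apply: ge0_le_integral => //.
    + by apply: measurableT_comp => //; exact/measurable_EFinP.
    + apply: emeasurable_funM => //; apply: measurableT_comp => //.
      exact/measurable_EFinP.
    + by move=> w Bw; rewrite /= lee_fin normrM ler_wpM2r// hB.
  - by apply: measurableT_comp => //; exact/measurable_EFinP.
have mB := Gm GB.
have mD : measurable_fun B D by apply/measurable_EFinP; exact: measurable_int iD.
pose B1 := B `&` [set w | m < h w]; pose B2 := B `&` [set w | h w <= m].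
have GB1 : G B1 by apply: gset_setI => //; exact: gset_lt.
have GB2 : G B2 by apply: gset_setI => //; exact: gset_ge.
have BE : B = B1 `|` B2.
  apply/seteqP; split=> [w Bw|w [[]|[]]//].
  by have [?|?] := ltP m (h w); [left|right].
have B12 : [disjoint B1 & B2].
  apply/disj_setPS => w [[_ /= a] [_ /= b]].
  by move: (lt_le_trans a b); rewrite ltxx.
have s1 : B1 `<=` B by move=> w [].
have s2 : B2 `<=` B by move=> w [].
have IH1 := IH B1 (m + rho / 2) (rho / 2) GB1 (integrableS mB (Gm GB1) s1 iD)
  (fun C GC CB => D0 C GC (subset_trans CB s1)).
have IH2 := IH B2 (m - rho / 2) (rho / 2) GB2 (integrableS mB (Gm GB2) s2 iD)
  (fun C GC CB => D0 C GC (subset_trans CB s2)).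
have mhD : measurable_fun B (fun w => (h w * D w)%:E).
  by apply/measurable_EFinP; apply: measurable_funM => //; exact: measurable_funTS.
have maD : measurable_fun B (fun w => `|(D w)%:E|%E).
  by apply: measurableT_comp => //; exact/measurable_EFinP.
move: mhD maD; rewrite BE => mhD maD.
rewrite integral_setU//; [|exact: Gm..].
rewrite ge0_integral_setU//; [|exact: Gm..].
rewrite muleDr//; last by rewrite ge0_adde_def// inE integral_ge0.
have -> : rho / 2 ^+ N.+1 = rho / 2 / 2 ^+ N by rewrite exprS invfM mulrA.
apply: (le_trans (lee_abs_add _ _)); apply: leeD.
  apply: IH1 => w [Bw /= mw]; have := hB w Bw.
  by rewrite !ler_norml => /andP[? ?]; apply/andP; split; lra.
apply: IH2 => w [Bw /= mw]; have := hB w Bw.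
by rewrite !ler_norml => /andP[? ?]; apply/andP; split; lra.
Qed.

(** Letting the number of bisections grow sends the bound of [integral_bisection] to 0, so a bounded
    [G]-measurable factor is handled without approximating it by simple functions. *)
Lemma integral_gmeas_mul0 (D h : T -> R) (B : set T) (M : R) :
  gmeas h -> G B -> P.-integrable B (EFin \o D) ->
  (forall C, G C -> C `<=` B -> \int[P]_(w in C) (D w)%:E = 0)%E ->
  (forall w, B w -> `|h w| <= M) ->
  (\int[P]_(w in B) (h w * D w)%:E = 0)%E.
Proof.
move=> gh GB iD D0 hM.
have I N := integral_bisection N (m := 0) (rho := M) gh GB iD D0.
have {}I N : (`|\int[P]_(w in B) (h w * D w)%:E|
    <= (M / 2 ^+ N)%:E * \int[P]_(w in B) `|(D w)%:E|)%E.
  by apply: I => w Bw; rewrite subr0 hM.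
have fI : (\int[P]_(w in B) `|(D w)%:E| \is a fin_num)%E.
  move/integrableP : (iD) => [_ lty].
  by rewrite ge0_fin_numE// integral_ge0.
move: I fI; case: (\int[P]_(w in B) `|_|)%E => // a I _.
apply/eqP; rewrite -abse_eq0 eq_le abse_ge0 andbT.
have := I 0%N; rewrite expr0 divr1 => I0.
move: I; case: (`|_|)%E => [b||] // I; last first.
  by have := I 0%N; rewrite -EFinM leye_eq.
rewrite lee_fin; apply/ler_addgt0Pr => e e0; rewrite add0r.
have [N Ne] : exists N, `|M * a| / 2 ^+ N <= e.
  have /cvgrPdist_le/(_ e e0) : (fun N => `|M * a| * (2^-1) ^+ N) @ \oo --> `|M * a| * (0:R).
    by apply: cvgM; [exact: cvg_cst|apply: cvg_expr; rewrite ger0_norm; lra].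
  case=> N _ /(_ N (leqnn _)); rewrite mulr0 sub0r normrN => H.
  by exists N; rewrite -exprVn; apply: le_trans H; exact: ler_norm.
have := I N; rewrite -EFinM lee_fin => /le_trans; apply.
apply: le_trans Ne; rewrite mulrAC ler_wpM2r ?invr_ge0 ?exprn_ge0//.
exact: ler_norm.
Qed.


(** Truncation at integer levels adds indices to a cover, hence the triples; [pickle] enumerates
    them by [nat], and numbers that code no triple get the empty set. *)
Lemma is_condexp_cover (X Y : T -> R) (F : nat * nat * nat -> set T) :
  gmeas Y -> (forall k, G (F k)) -> (forall w, exists k, F k w) ->
  (forall k, P.-integrable (F k) (EFin \o X)) ->
  (forall k B, G B -> B `<=` F k ->
     (\int[P]_(w in B) (X w)%:E = \int[P]_(w in B) (Y w)%:E)%E) ->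
  is_condexp P G X Y.
Proof.
move=> gY GF cF iF eF; split=> //.
pose F' n := if unpickle n is Some k then F k else set0.
have G0 : G set0 by case: HG.
exists F'; split.
- by move=> n; rewrite /F'; case: unpickle.
- apply/seteqP; split=> // w _; have [k Fk] := cF w.
  by exists (pickle k) => //; rewrite /F' pickleK.
- by move=> n; rewrite /F'; case: unpickle => // ; exact: integrable_set0.
- move=> n B GB; rewrite /F'; case: unpickle => [k|]; first exact: eF.
  by rewrite subset0 => ->; rewrite !integral_set0.
Qed.

(** The cover is intersected with the sets where [|Y|] is at most an integer, the second index, so
    that integrability of [Y] on each piece is immediate. *)
Lemma is_condexp_bounded (X Y : T -> R) : is_condexp P G X Y ->
  exists F : nat * nat -> set T,
    [/\ forall k, G (F k), forall w, exists k, F k w,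
        forall k, P.-integrable (F k) (EFin \o X),
        forall k w, F k w -> `|Y w| <= k.2%:R
      & forall k B, G B -> B `<=` F k ->
          (\int[P]_(w in B) (X w)%:E = \int[P]_(w in B) (Y w)%:E)%E].
Proof.
move=> [gY [F [GF cF iF eF]]].
exists (fun k => F k.1 `&` [set w | `|Y w| <= k.2%:R]); split.
- by move=> k; apply: gset_setI => //; exact: gset_bounded.
- move=> w; have [k _ Fk] : (\bigcup_k F k) w by rewrite cF.
  exists (k, (Num.truncn `|Y w|).+1); split=> //=.
  by rewrite ltW// truncnS_gt.
- move=> k; apply: (integrableS (Gm (GF k.1)) _ _ (iF k.1)) => //.
  by apply: Gm; apply: gset_setI => //; exact: gset_bounded.
- by move=> k w [].
- by move=> k B GB BF; apply: (eF k.1) => // w /BF [].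
Qed.

Lemma integrable_bounded (Y : T -> R) (B : set T) (M : R) :
  measurable B -> measurable_fun setT Y -> (forall w, B w -> `|Y w| <= M) ->
  P.-integrable B (EFin \o Y).
Proof.
move=> mB mY YM.
have i1 : P.-integrable B (EFin \o cst (1:R)).
  by apply: finite_measure_integrable_cst.
by have := integrable_bounded_mul mB mY YM i1; under eq_fun do rewrite mulr1.
Qed.

Lemma is_condexpD (X Y X' Y' : T -> R) :
  is_condexp P G X Y -> is_condexp P G X' Y' ->
  is_condexp P G (fun w => X w + X' w) (fun w => Y w + Y' w).
Proof.
move=> cX cX'; have [gY _] := cX; have [gY' _] := cX'.
have [F [GF cF iF bF eF]] := is_condexp_bounded cX.
have [F' [GF' cF' iF' bF' eF']] := is_condexp_bounded cX'.
pose H (k : (nat * nat) * (nat * nat)) := F k.1 `&` F' k.2.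
(* A pair of indices, one from each cover, is coded by the first component of the triple; the other
   two components are dummies. *)
pose e (n : nat * nat * nat) : (nat * nat) * (nat * nat) :=
  odflt ((0, 0), (0, 0))%N (unpickle n.1.1).
have GH k : G (H k) by exact: gset_setI.
have iH k : P.-integrable (H k) (EFin \o X).
  by apply: integrableS (iF k.1) => //; [exact: Gm|exact: Gm|move=> w []].
have iH' k : P.-integrable (H k) (EFin \o X').
  by apply: integrableS (iF' k.2) => //; [exact: Gm|exact: Gm|move=> w []].
apply: (is_condexp_cover (F := H \o e)) => /=.
- exact: gmeasD.
- by move=> k; exact: GH.
- move=> w; have [k Fk] := cF w; have [k' Fk'] := cF' w.
  by exists (pickle (k, k'), 0, 0)%N; rewrite /e /= pickleK.
- move=> k; rewrite (_ : _ \o _ = (EFin \o X) \+ (EFin \o X'))%E//.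
  by apply: integrableD => //; exact: Gm.
- move=> k B GB BH; have mB := Gm GB.
  have sF : B `<=` F (e k).1 by move=> w /BH [].
  have sF' : B `<=` F' (e k).2 by move=> w /BH [].
  under eq_integral do rewrite EFinD.
  under [RHS]eq_integral do rewrite EFinD.
  rewrite !integralD_EFin//.
  + by rewrite (eF _ _ GB sF) (eF' _ _ GB sF').
  + apply: (integrable_bounded (M := (e k).1.2%:R)) => //.
      exact: gmeas_measurable.
    by move=> w /sF /bF.
  + apply: (integrable_bounded (M := (e k).2.2%:R)) => //.
      exact: gmeas_measurable.
    by move=> w /sF' /bF'.
  + by apply: integrableS (iH (e k)) => //; exact: Gm.
  + by apply: integrableS (iH' (e k)) => //; exact: Gm.
Qed.

Lemma is_condexp_gmeas (Y : T -> R) : gmeas Y -> is_condexp P G Y Y.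
Proof.
move=> gY; apply: (is_condexp_cover (F := fun k => [set w | `|Y w| <= k.1.1%:R])) => //.
- by move=> k; exact: gset_bounded.
- move=> w; exists ((Num.truncn `|Y w|).+1, 0, 0)%N => /=.
  by rewrite ltW// truncnS_gt.
- move=> k; apply: (integrable_bounded (M := k.1.1%:R)) => //.
    by apply: Gm; exact: gset_bounded.
  exact: gmeas_measurable.
Qed.

(** On a piece of the cover where [h] is bounded, [X - c] integrates to 0 over every [G]-subset, so
    [integral_gmeas_mul0] applies. The conditional moments of the errors are constants, while [h]
    may be unbounded as a whole. *)
Lemma is_condexp_mul_cst (X h : T -> R) (c : R) :
  is_condexp P G X (cst c) -> gmeas h ->
  is_condexp P G (fun w => h w * X w) (fun w => h w * c).
Proof.
move=> cX gh; have [F [GF cF iF _ eF]] := is_condexp_bounded cX.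
pose H (k : nat * nat * nat) := F k.1 `&` [set w | `|h w| <= k.2%:R].
have GH k : G (H k) by apply: gset_setI => //; exact: gset_bounded.
have mh := gmeas_measurable gh.
apply: (is_condexp_cover (F := H)) => //.
- by apply: gmeasM => //; exact: gmeas_cst.
- move=> w; have [k Fk] := cF w.
  exists (k, (Num.truncn `|h w|).+1); split=> //=.
  by rewrite ltW// truncnS_gt.
- move=> k; apply: (integrable_bounded_mul (M := k.2%:R)) => //.
  + exact: Gm.
  + by move=> w [].
  + by apply: integrableS (iF k.1) => //; [exact: Gm|exact: Gm|move=> w []].
- move=> k B GB BH; have mB := Gm GB.
  have bB w : B w -> `|h w| <= k.2%:R by move=> /BH [].
  have sF : B `<=` F k.1 by move=> w /BH [].
  have iX : P.-integrable B (EFin \o X).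
    by apply: integrableS (iF k.1) => //; exact: Gm.
  have ic C : measurable C -> P.-integrable C (EFin \o cst c).
    by move=> mC; exact: finite_measure_integrable_cst.
  have iD : P.-integrable B (EFin \o (fun w => X w - c)).
    rewrite (_ : _ \o _ = (EFin \o X) \- (EFin \o cst c))%E//.
    by apply: integrableB => //; exact: ic.
  have D0 C : G C -> C `<=` B -> (\int[P]_(w in C) (X w - c)%:E = 0)%E.
    move=> GC CB; have mC := Gm GC.
    under eq_integral do rewrite EFinB.
    rewrite (@integralB_EFin _ _ _ P C X (cst c) mC)//.
    + rewrite (eF k.1 C)//; last by move=> w /CB /sF.
      by rewrite subee// integrable_fin_num//; exact: ic.
    + exact: integrableS iX.
    + exact: ic.
  have E := integral_gmeas_mul0 gh GB iD D0 bB.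
  have -> : (\int[P]_(w in B) (h w * X w)%:E =
     \int[P]_(w in B) ((h w * (X w - c))%:E + (h w * c)%:E))%E.
    by apply: eq_integral => w _; rewrite -EFinD -mulrDr subrK.
  rewrite integralD_EFin//.
  + by rewrite E add0e.
  + exact: (integrable_bounded_mul (M := k.2%:R)).
  + by apply: (integrable_bounded_mul (M := k.2%:R) (X := cst c)) => //; exact: ic.
Qed.

(** On the part of a piece of both covers where [Y' < Y], the integral of [Y - Y'], which is that of
    its absolute value, is 0. Countably many such parts exhaust the set. *)
Lemma is_condexp_le_ae (X Y Y' : T -> R) :
  is_condexp P G X Y -> is_condexp P G X Y' -> P [set w | Y' w < Y w] = 0%E.
Proof.
move=> cY cY'; have [gY _] := cY; have [gY' _] := cY'.
have [F [GF cF iF bF eF]] := is_condexp_bounded cY.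
have [F' [GF' cF' iF' bF' eF']] := is_condexp_bounded cY'.
have GL : G [set w | Y' w < Y w] by exact: gset_ltr.
pose B (n : nat) := if unpickle n is Some (k, k')
  then F k `&` F' k' `&` [set w | Y' w < Y w] else set0.
have GB n : G (B n).
  rewrite /B; case: unpickle => [[k k']|]; last by case: HG.
  by apply: gset_setI => //; exact: gset_setI.
have B0 n : P (B n) = 0%E.
  have := GB n; rewrite /B; case: unpickle => [[k k']|]; last by rewrite measure0.
  set C := _ `&` [set w | _] => GC; have mC := Gm GC.
  have iY : P.-integrable C (EFin \o Y).
    apply: (integrable_bounded (M := k.2%:R)) => //.
      exact: gmeas_measurable.
    by move=> w [[/bF]].
  have iY' : P.-integrable C (EFin \o Y').
    apply: (integrable_bounded (M := k'.2%:R)) => //.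
      exact: gmeas_measurable.
    by move=> w [[_ /bF']].
  have I0 : (\int[P]_(w in C) `|(Y w - Y' w)%:E| = 0)%E.
    transitivity (\int[P]_(w in C) ((Y w)%:E - (Y' w)%:E))%E.
      apply: eq_integral => w; rewrite inE => -[_ /= h].
      by rewrite ger0_norm// subr_ge0 ltW.
    rewrite integralB_EFin// -(eF k C)//; last by move=> w [[]].
    rewrite -(eF' k' C)//; last by move=> w [[]].
    rewrite subee//; apply: integrable_fin_num => //.
    by apply: integrableS (iF k) => //; [exact: Gm|move=> w [[]]].
  have mD : measurable_fun C (fun w => (Y w - Y' w)%:E).
    by apply/measurable_EFinP/measurable_funTS/gmeas_measurable/gmeasB.
  have [N [mN N0 NC]] := (ae_eq_integral_abs P mC mD).1 I0.
  apply: (subset_measure0 mC mN _ N0) => w Cw; apply: NC => /=.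
  move=> /(_ Cw) [] /eqP; case: Cw => _ /= lt.
  by rewrite subr_eq0 => /eqP E; rewrite E ltxx in lt.
have LB : [set w | Y' w < Y w] `<=` \bigcup_n B n.
  move=> w lt; have [k Fk] := cF w; have [k' Fk'] := cF' w.
  by exists (pickle (k, k')) => //; rewrite /B pickleK.
apply/eqP; rewrite eq_le measure_ge0 andbT.
have mB n : measurable (B n) := Gm (GB n).
apply: (@le_trans _ _ (P (\bigcup_n B n))).
  by apply: le_measure => //; rewrite ?inE; [exact: Gm|exact: bigcup_measurable].
apply: (@le_trans _ _ (\sum_(n <oo) P (B n))%E).
  by apply: measure_sigma_subadditive => //; exact: bigcup_measurable.
by rewrite eseries0.
Qed.

Lemma is_condexp_unique (X Y Y' : T -> R) :
  is_condexp P G X Y -> is_condexp P G X Y' -> {ae P, forall w, Y w = Y' w}.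
Proof.
move=> cY cY'; have [gY _] := cY; have [gY' _] := cY'.
exists ([set w | Y' w < Y w] `|` [set w | Y w < Y' w]); split.
- by apply: measurableU; apply: Gm; exact: gset_ltr.
- rewrite measureU0; [|by apply: Gm; exact: gset_ltr..|].
    exact: is_condexp_le_ae cY cY'.
  exact: is_condexp_le_ae cY' cY.
- move=> w /= /eqP; rewrite neq_lt => /orP[]; [by right|by left].
Qed.

Lemma is_condexp_ae_eq (X X' Y : T -> R) : measurable_fun setT X' ->
  {ae P, forall w, X w = X' w} -> is_condexp P G X Y -> is_condexp P G X' Y.
Proof.
move=> mX' ae [gY [F [GF cF iF eF]]]; split=> //; exists F.
have mXF k : measurable_fun (F k) (EFin \o X) by exact: measurable_int (iF k).
have aeF (B : set T) : ae_eq P B (EFin \o X) (EFin \o X').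
  by apply: filterS ae => w /= -> _.
split=> // [k|k B GB BF].
- have mF := Gm (GF k).
  have mX'F : measurable_fun (F k) (EFin \o X').
    by apply/measurable_EFinP; exact: measurable_funTS.
  have /integrableP[_ lty] := iF k.
  apply/integrableP; split=> //.
  rewrite (_ : integral _ _ _ = \int[P]_(w in F k) `|(EFin \o X) w|)%E//.
  apply: ae_eq_integral => //; [exact: measurableT_comp..|].
  by apply: filterS ae => w /= ->.
- rewrite -(eF k)//; apply: ae_eq_integral.
  + exact: Gm.
  + by apply/measurable_EFinP; exact: measurable_funTS.
  + by apply: measurable_funS (mXF k) => //; exact: Gm.
  + by apply: filterS ae => w /= -> _.
Qed.

Lemma condexp_version (X Y : T -> R) : is_condexp P G X Y -> is_condexp P G X (condexp P G X).
Proof. by move=> cY; rewrite /condexp; case: xgetP => [? -> //|/(_ Y)]. Qed.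

Lemma condexpE (X Y : T -> R) : is_condexp P G X Y ->
  {ae P, forall w, condexp P G X w = Y w}.
Proof. by move=> cY; exact: is_condexp_unique (condexp_version cY) cY. Qed.

Lemma is_condexp_sum I (s : seq I) (X Y : I -> T -> R) :
  (forall i, is_condexp P G (X i) (Y i)) ->
  is_condexp P G (fun w => \sum_(i <- s) X i w) (fun w => \sum_(i <- s) Y i w).
Proof.
move=> cXY; elim: s => [|i s IH].
  under eq_fun do rewrite big_nil; under [in X in is_condexp _ _ _ X]eq_fun do rewrite big_nil.
  exact/is_condexp_gmeas/gmeas_cst.
under eq_fun do rewrite big_cons; under [in X in is_condexp _ _ _ X]eq_fun do rewrite big_cons.
exact: is_condexpD.
Qed.

Section LinearPredictor.
Context (n : nat) (e : 'I_n -> T -> R) (sigma : R).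
Context (me : forall i, measurable_fun setT (e i)).
Context (e0 : forall i, is_condexp P G (e i) (cst 0)).
Context (e2 : forall i j, is_condexp P G (fun w => e i w * e j w)
                 (cst (if i == j then sigma ^+ 2 else 0))).

Lemma condexp_linear (X g : T -> R) (h : 'I_n -> T -> R) :
  gmeas g -> (forall i, gmeas (h i)) ->
  (forall w, X w = g w + \sum_i h i w * e i w) -> is_condexp P G X g.
Proof.
move=> gg gh XE; have -> : X = (fun w => g w + \sum_i h i w * e i w) by exact/funext.
have : is_condexp P G (fun w => g w + \sum_i h i w * e i w)
                  (fun w => g w + \sum_i h i w * 0).
  apply: is_condexpD; first exact: is_condexp_gmeas.
  by apply: is_condexp_sum => i; exact: is_condexp_mul_cst.
by under [in X in is_condexp _ _ _ X -> _]eq_fun do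
  (under eq_bigr do rewrite mulr0; rewrite big1// addr0).
Qed.

(** The [condexp] inside the covariance is a chosen version and agrees with [g] only almost surely;
    up to a null set the centred product is a double sum over the errors, of which only the diagonal
    has a nonzero conditional moment. The covers in [is_condexp] absorb unbounded weights [h]. *)
Lemma is_condcov_linear (X g X' g' : T -> R) (h h' : 'I_n -> T -> R) :
  gmeas g -> (forall i, gmeas (h i)) -> gmeas g' -> (forall i, gmeas (h' i)) ->
  (forall w, X w = g w + \sum_i h i w * e i w) ->
  (forall w, X' w = g' w + \sum_i h' i w * e i w) ->
  is_condexp P G
    (fun w => (X w - condexp P G X w) * (X' w - condexp P G X' w))
    (fun w => sigma ^+ 2 * \sum_i h i w * h' i w).
Proof.
move=> gg gh gg' gh' XE XE'.
have cX := condexp_linear gg gh XE; have cX' := condexp_linear gg' gh' XE'.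
have mh h1 : (forall i, gmeas (h1 i)) -> measurable_fun setT (fun w => \sum_i h1 i w * e i w).
  move=> gh1; apply: measurable_sum => i; apply: measurable_funM => //.
  exact: gmeas_measurable.
have mX : measurable_fun setT X.
  rewrite (_ : X = fun w => g w + \sum_i h i w * e i w); last exact/funext.
  by apply: measurable_funD; [exact: gmeas_measurable|exact: mh].
have mX' : measurable_fun setT X'.
  rewrite (_ : X' = fun w => g' w + \sum_i h' i w * e i w); last exact/funext.
  by apply: measurable_funD; [exact: gmeas_measurable|exact: mh].
apply: (is_condexp_ae_eq
  (X := fun w => \sum_i \sum_j (h i w * h' j w) * (e i w * e j w))).
- by apply: measurable_funM; apply: measurable_funB => //; apply: gmeas_measurable;
    [case: (condexp_version cX)|case: (condexp_version cX')].
- apply: filterS2 (condexpE cX) (condexpE cX') => w -> ->.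
  rewrite XE XE' (addrC (g w)) (addrC (g' w)) !addrK big_distrl /=.
  apply: eq_bigr => i _; rewrite big_distrr /=; apply: eq_bigr => j _.
  by rewrite mulrACA.
- have : is_condexp P G
      (fun w => \sum_i \sum_j (h i w * h' j w) * (e i w * e j w))
      (fun w => \sum_i \sum_j (h i w * h' j w) * (if i == j then sigma ^+ 2 else 0)).
    apply: is_condexp_sum => i; apply: is_condexp_sum => j.
    by apply: is_condexp_mul_cst => //; exact: gmeasM.
  congr is_condexp; apply/funext => w; rewrite big_distrr /=.
  apply: eq_bigr => i _; rewrite (bigD1 i)//= eqxx big1 ?addr0 1?mulrC// => j ji.
  by rewrite eq_sym (negbTE ji) mulr0.
Qed.

End LinearPredictor.

End ConditionalExpectation.

(** * Rotation invariance and linear combinations of independent normals *)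

Section NormalRotation.
Context {R : realType}.
Local Notation mu := (@lebesgue_measure R).
Local Notation N01 := (@normal_prob R 0 1).
Local Notation phi := (@normal_pdf R 0 1).
Implicit Types a b c s x y : R.

Lemma measurable_affine a b :
  measurable_fun [set: measurableTypeR R] (fun x : measurableTypeR R => a * x + b : measurableTypeR R).
Proof. by apply: measurable_funD => //; exact: measurable_funM. Qed.

(** Both sides are measures of [A] that agree on half-open intervals; for negative [a] the preimage
    is closed at the other end, which changes no length. *)
Lemma lebesgue_measure_affine a b (A : set R) : a != 0 -> measurable A ->
  mu A = (`|a|%:E * mu ((fun x => a * x + b)%R @^-1` A))%E.
Proof.
move=> a0 mA.
pose f : measurableTypeR R -> measurableTypeR R := fun x => a * x + b.
have mf : measurable_fun setT f := measurable_affine a b.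
pose m1 : {measure set (measurableTypeR R) -> \bar R} :=
  mscale (NngNum (normr_ge0 a)) (pushforward mu f).
pose m' := m1 mf.
suff H : forall X, ocitv X -> mu X = m' X.
  by rewrite (lebesgue_measure_unique H).
move=> X /ocitvP[->|[[u v] /= uv ->]]; first by rewrite !measure0.
have E : m' `]u, v]%classic = (`|a|%:E * mu ((fun x => a * x + b)%R @^-1` `]u, v]%classic))%E by [].
rewrite {}E lebesgue_measure_itv/= lte_fin uv.
move: a0; rewrite neq_lt => /orP[a0|a0].
- have -> : (fun x => a * x + b) @^-1` `]u, v]%classic = `[(v - b) / a, (u - b) / a[%classic.
    apply/seteqP; split=> x /=; rewrite !in_itv/= ler_ndivrMr// ltr_ndivlMr//;
      move=> /andP[? ?]; apply/andP; split; lra.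
  rewrite lebesgue_measure_itv/= lte_fin ltr_nM2r ?invr_lt0// ltrD2r uv.
  rewrite -!EFinB -EFinM ltr0_norm//; congr EFin; field; lra.
- have -> : (fun x => a * x + b) @^-1` `]u, v]%classic = `](u - b) / a, (v - b) / a]%classic.
    apply/seteqP; split=> x /=; rewrite !in_itv/= ltr_pdivrMr// ler_pdivlMr//;
      move=> /andP[? ?]; apply/andP; split; lra.
  rewrite lebesgue_measure_itv/= lte_fin ltr_pM2r ?invr_gt0// ltrD2r uv.
  rewrite -!EFinB -EFinM gtr0_norm//; congr EFin; field; lra.
Qed.

Lemma integral_affine a b (f : R -> \bar R) : a != 0 ->
  measurable_fun setT f -> (forall x, 0 <= f x)%E ->
  (\int[mu]_x f x = `|a|%:E * \int[mu]_x f (a * x + b)%R)%E.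
Proof.
move=> a0 mf f0.
pose g : measurableTypeR R -> measurableTypeR R := fun x => a * x + b.
have mg : measurable_fun setT g := measurable_affine a b.
pose m1 : {measure set (measurableTypeR R) -> \bar R} :=
  mscale (NngNum (normr_ge0 a)) (pushforward mu g).
pose m' := m1 mg.
transitivity (\int[m']_x f x)%E.
  by apply: eq_measure_integral => A mA _; exact: lebesgue_measure_affine.
rewrite ge0_integral_mscale//=; congr (_ * _)%E.
by rewrite ge0_integral_pushforward.
Qed.

Lemma normal_pdf01E x : phi x = normal_peak 1 * expR (- x ^+ 2 / 2).
Proof. by rewrite normal_pdfE ?oner_neq0// /normal_fun subr0 expr1n. Qed.

Lemma normal_pdfN x : phi (- x) = phi x.
Proof. by rewrite !normal_pdf01E sqrrN. Qed.

Lemma measurable_normal_pdf01 : measurable_fun setT (fun x : R => (phi x)%:E).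
Proof. by apply/measurable_EFinP; exact: measurable_normal_pdf. Qed.

(** The Radon-Nikodym derivative is some density of the normal law; it equals [phi] almost
    everywhere because both integrate to the same measure. *)
Lemma integral_normal_prob (f : R -> \bar R) : N01.-integrable setT f ->
  (\int[N01]_x f x = \int[mu]_x (f x * (phi x)%:E))%E.
Proof.
move=> fi; have mf := measurable_int _ fi.
have dom := @normal_prob_dominates R 0 1.
rewrite -(Radon_Nikodym_change_of_variables dom)//=.
apply: ae_eq_integral => //.
- apply: emeasurable_funM => //; apply: (measurable_int mu).
- by apply: emeasurable_funM => //; exact: measurable_normal_pdf01.
- apply: ae_eqe_mul2l => /=; rewrite Radon_NikodymE//=.
  case: cid => /= h [h1 h2 h3]; apply: integral_ae_eq => //=.
  + exact: measurable_normal_pdf01.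
  + by move=> E _ mE; rewrite -h3.
Qed.

Lemma normal_probE (A : set R) : measurable A ->
  N01 A = (\int[mu]_x ((\1_A x : R)%:E * (phi x)%:E))%E.
Proof.
move=> mA; rewrite /normal_prob integral_mkcond; apply: eq_integral => x _.
by rewrite patchE indicE; case: ifP; rewrite ?mul1e ?mul0e.
Qed.

Lemma normal_prob_opp (A : set R) : measurable A ->
  N01 ((fun x => - x) @^-1` A) = N01 A.
Proof.
move=> mA; have mA' : measurable ((fun x : R => - x) @^-1` A).
  rewrite -[X in measurable X]setTI.
  have mo : measurable_fun [set: R] (fun x : R => - x) by exact: measurable_funN.
  exact: mo.
rewrite !normal_probE// [RHS](@integral_affine (-1) 0) ?oppr_eq0 ?oner_eq0//.
- rewrite normrN1 mul1e; apply: eq_integral => x _.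
  by rewrite mulN1r addr0 normal_pdfN.
- apply: emeasurable_funM; last exact: measurable_normal_pdf01.
  exact/measurable_EFinP/measurable_indic.
- by move=> x; rewrite -EFinM lee_fin mulr_ge0// normal_pdf_ge0.
Qed.

Lemma lebesgue_tonelli (H : R -> R -> \bar R) :
  measurable_fun [set: R * R] (fun z => H z.1 z.2) -> (forall x y, 0 <= H x y)%E ->
  (\int[mu]_x \int[mu]_y H x y = \int[mu]_y \int[mu]_x H x y)%E.
Proof.
move=> mH H0.
exact: (@fubini_tonelli _ _ (measurableTypeR R) (measurableTypeR R) R mu mu
  (fun z => H z.1 z.2) mH (fun z => H0 z.1 z.2)).
Qed.

(** The rotation is split into two substitutions in one variable each: first [x] becomes
    [x / c - s / c * y] for fixed [y], then [y] becomes [c * y + s * x] for fixed [x]. Their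
    Jacobians [|1 / c|] and [|c|] cancel, and the remaining density depends on the norm only. *)
Lemma normal_pair_rotation_prod c s (A B : set R) : c ^+ 2 + s ^+ 2 = 1 -> c != 0 ->
  measurable A -> measurable B ->
  (N01 \x N01)%E [set z | A (c * z.1 + s * z.2) /\ B (- s * z.1 + c * z.2)]
  = (N01 A * N01 B)%E.
Proof.
move=> cs1 c0 mA mB; set E := [set z | _].
have mfst2 : measurable_fun [set: R * R] (fun z => c * z.1 + s * z.2).
  by apply: measurable_funD; apply: measurable_funM.
have msnd2 : measurable_fun [set: R * R] (fun z => - s * z.1 + c * z.2).
  by apply: measurable_funD; apply: measurable_funM.
have mE : measurable E.
  have -> : E = (fun z => c * z.1 + s * z.2) @^-1` A `&` (fun z => - s * z.1 + c * z.2) @^-1` B by [].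
  by apply: measurableI; rewrite -[X in measurable X]setTI; [exact: mfst2|exact: msnd2].
pose F x y : \bar R := ((\1_A (c * x + s * y) * \1_B (- s * x + c * y)) * (phi x * phi y) : R)%:E.
have F0 x y : (0 <= F x y)%E.
  by rewrite lee_fin !mulr_ge0// normal_pdf_ge0.
have mF : measurable_fun [set: R * R] (fun z => F z.1 z.2).
  apply/measurable_EFinP; apply: measurable_funM; apply: measurable_funM.
  - by apply: (measurableT_comp (f := \1_A : R -> R) _ mfst2); exact: measurable_indic.
  - by apply: (measurableT_comp (f := \1_B : R -> R) _ msnd2); exact: measurable_indic.
  - by apply: (measurableT_comp (f := phi)) => //; exact: measurable_normal_pdf.
  - by apply: (measurableT_comp (f := phi)) => //; exact: measurable_normal_pdf.
transitivity (\int[mu]_x \int[mu]_y F x y)%E.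
  rewrite /product_measure1 integral_normal_prob; last first.
    apply: (@le_integrable _ _ _ N01 _ measurableT _ (EFin \o cst 1)).
    - exact: measurable_fun_xsection.
    - move=> x _ /=; rewrite normr1 gee0_abs//; apply: probability_le1.
      exact: measurable_xsection.
    - exact: finite_measure_integrable_cst.
  apply: eq_integral => x _ /=.
  rewrite normal_probE; last exact: measurable_xsection.
  rewrite muleC -ge0_integralZl//.
  - apply: eq_integral => y _; rewrite -!EFinM; congr EFin.
    rewrite (_ : \1_(xsection E x) y = \1_A (c * x + s * y) * \1_B (- s * x + c * y) :> R).
      by rewrite [LHS]mulrC mulrAC [RHS]mulrA mulrAC.
    rewrite !indicE mem_xsection -natrM mulnb; congr (nat_of_bool _)%:R.
    by apply/idP/andP => [|[]]; rewrite !inE // => -[].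
  - apply: emeasurable_funM; last exact: measurable_normal_pdf01.
    by apply/measurable_EFinP/measurable_indic; exact: measurable_xsection.
  - by move=> y _; rewrite -EFinM lee_fin mulr_ge0// normal_pdf_ge0.
  - by rewrite lee_fin normal_pdf_ge0.
rewrite (lebesgue_tonelli mF F0).
have cV0 : c^-1 != 0 by rewrite invr_eq0.
pose K (z : R * R) := F (c^-1 * z.1 + - s / c * z.2) z.2.
have K0 z : (0 <= K z)%E by exact: F0.
have mK : measurable_fun [set: R * R] K.
  apply: (measurableT_comp (f := fun z => F z.1 z.2) mF
    (g := fun z : R * R => (c^-1 * z.1 + - s / c * z.2, z.2))).
  by apply: measurable_fun_pair => //; apply: measurable_funD; apply: measurable_funM.
transitivity (\int[mu]_y \int[mu]_x (`|c^-1|%:E * K (x, y)))%E.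
  apply: eq_integral => y _.
  rewrite (@integral_affine c^-1 (- s / c * y) (F^~ y))//.
    rewrite ge0_integralZl//.
    exact: (measurableT_comp mK (measurable_pair2 _)).
  exact: (measurableT_comp mF (measurable_pair2 _)).
have mK2 : measurable_fun [set: R * R] (fun z => (`|c^-1|%:E * K z)%E).
  exact: emeasurable_funM.
rewrite -(@lebesgue_tonelli (fun x y => (`|c^-1|%:E * K (x, y))%E)); last 2 first.
- by apply: eq_measurable_fun mK2 => -[].
- by move=> x y; rewrite mule_ge0.
transitivity (\int[mu]_x (((\1_A x * phi x : R)%:E) * N01 B))%E.
  apply: eq_integral => x _.
  rewrite (@integral_affine c (s * x) (fun y => `|c^-1|%:E * K (x, y))%E)//; last 2 first.
  - exact: (measurableT_comp mK2 (measurable_pair1 _)).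
  - by move=> y; rewrite mule_ge0.
  rewrite -ge0_integralZl//; last first.
  - by move=> y _; rewrite mule_ge0.
  - apply: (measurableT_comp (f := fun z => (`|c^-1|%:E * K z)%E) mK2
      (g := fun y : R => (x, c * y + s * x))).
    by apply: measurable_fun_pair => //; apply: measurable_funD => //; exact: measurable_funM.
  rewrite normal_probE// -ge0_integralZl//.
  - apply: eq_integral => y _; have cc : (`|c|%:E * `|c^-1|%:E = 1)%E.
      by rewrite -EFinM -normrM divff// normr1.
    rewrite muleA cc mul1e.
    rewrite /K /F /= -!EFinM; congr EFin.
    have e1 : c^-1 * x + - s / c * (c * y + s * x) = c * x - s * y.
      by rewrite (_ : c^-1 * x = (c ^+ 2 + s ^+ 2) / c * x); [field|rewrite cs1 mul1r].
    have e2 : c * (c * x - s * y) + s * (c * y + s * x) = x.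
      by transitivity ((c ^+ 2 + s ^+ 2) * x); [ring|rewrite cs1 mul1r].
    have e3 : - s * (c * x - s * y) + c * (c * y + s * x) = y.
      by transitivity ((c ^+ 2 + s ^+ 2) * y); [ring|rewrite cs1 mul1r].
    rewrite e1 e2 e3 [RHS]mulrACA; congr (_ * _)%R.
    rewrite !normal_pdf01E mulrACA [RHS]mulrACA -!expRD; congr (_ * expR _).
    transitivity (- ((c ^+ 2 + s ^+ 2) * (x ^+ 2 + y ^+ 2)) / 2); last by rewrite cs1; field.
    by field.
  - apply: emeasurable_funM; last exact: measurable_normal_pdf01.
    exact/measurable_EFinP/measurable_indic.
  - by move=> y _; rewrite -EFinM lee_fin mulr_ge0// normal_pdf_ge0.
  - by rewrite lee_fin mulr_ge0// normal_pdf_ge0.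
under eq_integral do rewrite muleC.
rewrite ge0_integralZl//.
- rewrite muleC; congr (_ * _)%E; rewrite normal_probE//.
- apply/measurable_EFinP; apply: measurable_funM => //; exact: measurable_normal_pdf.
- by move=> x _; rewrite lee_fin mulr_ge0// normal_pdf_ge0.
Qed.

End NormalRotation.

Section NormalPair.
Context {d : measure_display} {T : measurableType d} {R : realType}.
Context (P : probability T R).
Local Notation N01 := (@normal_prob R 0 1).

(** On the event [Q], of probability [k], the pair behaves like two independent standard normals.
    [Q] will be a cylinder over further coordinates, which stay available while two are rotated. *)
Definition normal_pair_on (Q : set T) (k : \bar R) (X Y : T -> R) :=
  forall A B, measurable A -> measurable B ->
    P (Q `&` (X @^-1` A `&` Y @^-1` B)) = (k * (N01 A * N01 B))%E.

(** The law of the pair on [Q], divided by [k], is the product measure, by uniqueness on rectangles.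
    Mass 0 cannot be normalized and is treated apart. *)
Lemma normal_pair_rotation (Q : set T) (k c s : R) (X Y : T -> R) :
  measurable Q -> measurable_fun setT X -> measurable_fun setT Y -> 0 <= k ->
  c ^+ 2 + s ^+ 2 = 1 -> c != 0 ->
  normal_pair_on Q k%:E X Y ->
  normal_pair_on Q k%:E (fun w => c * X w + s * Y w) (fun w => - s * X w + c * Y w).
Proof.
move=> mQ mX mY k0 cs1 c0 XY A B mA mB.
pose f w : measurableTypeR R * measurableTypeR R := (X w, Y w).
have mf : measurable_fun setT f by apply/measurable_fun_pairP.
set E := [set z : R * R | A (c * z.1 + s * z.2) /\ B (- s * z.1 + c * z.2)].
have mE : measurable (E : set (R * R)).
  have -> : E = (fun z => c * z.1 + s * z.2) @^-1` A `&` (fun z => - s * z.1 + c * z.2) @^-1` B by [].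
  by apply: measurableI; rewrite -[X in measurable X]setTI;
    apply: (measurable_funD _ _ measurableT) => //; apply: measurable_funM.
have [k00|kn0] := eqVneq k 0.
  rewrite k00 mul0e; apply/eqP; rewrite eq_le measure_ge0 andbT.
  have P0 : P Q = 0%E.
    by have := XY setT setT measurableT measurableT; rewrite k00 mul0e !preimage_setT !setIT.
  rewrite -P0; apply: le_measure; rewrite ?inE//; apply: measurableI => //.
  by apply: measurableI; rewrite -[X in measurable X]setTI;
    apply: (measurable_funD _ _ measurableT) => //; apply: measurable_funM.
have kV0 : 0 <= k^-1 by rewrite invr_ge0.
pose m1 : {measure set (measurableTypeR R * measurableTypeR R) -> \bar R} :=
  mscale (NngNum kV0) (pushforward (mrestr P mQ) f).
pose m' := m1 mf.
have m'E C : m' C = (k^-1%:E * P (Q `&` f @^-1` C))%E.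
  by rewrite setIC.
have : (N01 \x N01)%E E = m' E.
  have U := @product_measure_unique _ _ _ _ R N01 N01 m'.
  apply: U => // A1 B1 mA1 mB1.
  rewrite m'E (_ : f @^-1` (A1 `*` B1) = X @^-1` A1 `&` Y @^-1` B1)//.
  by rewrite XY// muleA -EFinM mulVf// mul1e.
rewrite normal_pair_rotation_prod// m'E => ->.
by rewrite muleA -EFinM mulfV// mul1e.
Qed.

End NormalPair.

Section UnionBound.
Context {d : measure_display} {T : measurableType d} {R : realType}.
Context (P : probability T R).

Lemma measurable_bigsetI I (s : seq I) (B : I -> set T) :
  (forall i, measurable (B i)) -> measurable (\big[setI/setT]_(i <- s) B i).
Proof. by move=> mB; elim/big_ind: _ => //; exact: measurableI. Qed.

Lemma measurable_bigsetU I (s : seq I) (B : I -> set T) :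
  (forall i, measurable (B i)) -> measurable (\big[setU/set0]_(i <- s) B i).
Proof. by move=> mB; elim/big_ind: _ => //; exact: measurableU. Qed.

Lemma bigsetU_seqP (I : eqType) (s : seq I) (B : I -> set T) w :
  (\big[setU/set0]_(i <- s) B i) w <-> exists2 i, i \in s & B i w.
Proof.
elim: s => [|i s IH]; first by rewrite big_nil; split=> // -[].
rewrite big_cons; split=> [[Bi|/IH[j js Bj]]|[j]].
- by exists i; rewrite ?mem_head.
- by exists j; rewrite // inE js orbT.
- rewrite inE => /predU1P[->|js] Bj; [by left|right; apply/IH; by exists j].
Qed.

Lemma bigsetI_seqP (I : eqType) (s : seq I) (B : I -> set T) w :
  (\big[setI/setT]_(i <- s) B i) w <-> forall i, i \in s -> B i w.
Proof.
elim: s => [|i s IH]; first by rewrite big_nil; split.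
rewrite big_cons; split=> [[Bi /IH H] j|H].
- by rewrite inE => /predU1P[->|/H].
- by split; [apply: H; rewrite mem_head|apply/IH => j js; apply: H; rewrite inE js orbT].
Qed.

Lemma union_bound (I : eqType) (s : seq I) (A : set T) (B : I -> set T) :
  measurable A -> (forall i, measurable (B i)) ->
  (forall w, A w -> exists2 i, i \in s & B i w) ->
  (P A <= \sum_(i <- s) P (B i))%E.
Proof.
move=> mA mB AB; apply: (@le_trans _ _ (P (\big[setU/set0]_(i <- s) B i))).
  apply: le_measure; rewrite ?inE//; first exact: measurable_bigsetU.
  by move=> w /AB h; apply/bigsetU_seqP.
elim: s {AB} => [|i s IH]; first by rewrite !big_nil measure0.
rewrite !big_cons (le_trans (measureU2 _ _ _))//; first exact: measurable_bigsetU.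
exact: leeD2l.
Qed.

End UnionBound.

Section NormalCombination.
Context {d : measure_display} {T : measurableType d} {R : realType}.
Context (P : probability T R) (p : nat) (g : 'I_p -> {RV P >-> R}).
Local Notation N01 := (@normal_prob R 0 1).
Context (g_indep : mutually_independent g).
Context (g_law : forall j (B : set R), measurable B -> distribution P (g j) B = N01 B).
Implicit Types (s t : seq 'I_p) (a b : 'I_p -> R) (B : set R) (C : 'I_p -> set R).

Definition gcyl t C := \big[setI/setT]_(m <- t) (g m @^-1` C m).

Definition lincomb s a w := \sum_(m <- s) a m * g m w.

Lemma measurable_preimageR (h : T -> R) B : measurable_fun setT h ->
  measurable B -> measurable (h @^-1` B).
Proof. by move=> mh mB; rewrite -[X in measurable X]setTI; exact: mh. Qed.

Lemma measurable_g m : measurable_fun setT (g m).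
Proof. exact: measurable_funPT. Qed.

Lemma measurable_gcyl t C : (forall j, measurable (C j)) -> measurable (gcyl t C).
Proof.
by move=> mC; apply: measurable_bigsetI => i; apply: measurable_preimageR => //; exact: measurable_g.
Qed.

Lemma measurable_lincomb s a : measurable_fun setT (lincomb s a).
Proof.
apply: measurable_sum => m; apply: measurable_funM => //; exact: measurable_g.
Qed.

Lemma prob_gcyl t C : uniq t -> (forall j, measurable (C j)) ->
  P (gcyl t C) = (\prod_(m <- t) N01 (C m))%E.
Proof.
move=> ut mC; rewrite /gcyl g_indep//.
by apply: eq_bigr => m _; exact: g_law.
Qed.

Lemma prob_gcyl_cons t C m B : uniq (m :: t) -> (forall j, measurable (C j)) ->
  measurable B ->
  P (gcyl t C `&` g m @^-1` B) = (\prod_(m <- t) N01 (C m) * N01 B)%E.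
Proof.
move=> /= /andP[mt ut] mC mB.
pose C' j := if j == m then B else C j.
have mC' j : measurable (C' j) by rewrite /C'; case: ifP.
have := @prob_gcyl (m :: t) C' _ mC'; rewrite /= mt ut => /(_ isT).
rewrite /gcyl !big_cons {1}/C' eqxx {2}/C' eqxx setIC muleC => E.
have e1 : (\big[setI/setT]_(j <- t) (g j @^-1` C' j)) = \big[setI/setT]_(j <- t) (g j @^-1` C j).
  rewrite !big_seq; apply: eq_bigr => j jt; rewrite /C'; case: eqP => // jm.
  by rewrite -jm jt in mt.
have e2 : (\prod_(j <- t) N01 (C' j) = \prod_(j <- t) N01 (C j))%E.
  rewrite !big_seq; apply: eq_bigr => j jt; rewrite /C'; case: eqP => // jm.
  by rewrite -jm jt in mt.
by rewrite -e2 -E e1.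
Qed.

Lemma gcyl_cons t C m : gcyl (m :: t) C = g m @^-1` C m `&` gcyl t C.
Proof. by rewrite /gcyl big_cons. Qed.

Lemma prod_normal_fin t C : (forall j, measurable (C j)) ->
  exists2 k : R, 0 <= k & (\prod_(m <- t) N01 (C m))%E = k%:E.
Proof.
move=> mC; elim: t => [|m t [k k0 IH]]; first by exists 1; rewrite ?big_nil.
rewrite big_cons IH.
have f : N01 (C m) \is a fin_num by apply: fin_num_measure; exact: mC.
exists (fine (N01 (C m)) * k); first by rewrite mulr_ge0// fine_ge0.
by rewrite EFinM fineK.
Qed.

Lemma lincomb_cons m s a w : lincomb (m :: s) a w = a m * g m w + lincomb s a w.
Proof. by rewrite /lincomb big_cons. Qed.

Lemma lincomb0 s a w : \sum_(m <- s) a m ^+ 2 = 0 -> lincomb s a w = 0.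
Proof.
move=> h; rewrite /lincomb big_seq big1// => m ms.
have /eqP := h; rewrite psumr_eq0; last by move=> i _; exact: sqr_ge0.
by move=> /allP/(_ m ms) /=; rewrite sqrf_eq0 => /eqP ->; rewrite mul0r.
Qed.

(** The induction rotates the pair made of [g m] and the normalized combination of the later
    coordinates, so that the wanted combination is the first rotated coordinate. The cylinder over
    [t] makes the induction pass: [g m] is moved into it to obtain the joint law of the pair. The
    two degenerate cases are a vanishing sine, where the normalization fails, and a vanishing
    cosine, which the rotation excludes. *)
Lemma normal_unit_comb s t a C B : uniq (s ++ t) ->
  (forall j, measurable (C j)) -> measurable B -> \sum_(m <- s) a m ^+ 2 = 1 ->
  P (gcyl t C `&` lincomb s a @^-1` B) = (\prod_(m <- t) N01 (C m) * N01 B)%E.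
Proof.
elim: s t a C B => [|m s IH] t a C B ust mC mB.
  by rewrite big_nil => /eqP; rewrite eq_sym oner_eq0.
rewrite big_cons => a1.
move: (ust); rewrite /= mem_cat negb_or => /andP[/andP[ms mt] ust'].
have umt : uniq (m :: t) by rewrite /= mt; move: ust'; rewrite cat_uniq => /and3P[].
set b2 := \sum_(j <- s) _ in a1.
have b20 : 0 <= b2 by apply: sumr_ge0 => i _; exact: sqr_ge0.
have [bz|bn0] := eqVneq b2 0.
  have : (a m == 1) || (a m == -1).
    by rewrite -sqrf_eq1 -a1 bz addr0.
  case/orP => /eqP am.
  - rewrite (_ : lincomb (m :: s) a = g m); first exact: prob_gcyl_cons.
    by apply/funext => w; rewrite lincomb_cons lincomb0// am mul1r addr0.
  - rewrite (_ : lincomb (m :: s) a = (fun x => - x) \o g m); last first.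
      by apply/funext => w; rewrite lincomb_cons lincomb0// am mulN1r addr0.
    have mB' : measurable ((fun x : R => - x) @^-1` B).
      by rewrite -[X in measurable X]setTI; exact: (oppr_measurable measurableT).
    by rewrite comp_preimage prob_gcyl_cons// normal_prob_opp.
have [az|an0] := eqVneq (a m) 0.
  rewrite (_ : lincomb (m :: s) a = lincomb s a).
    by apply: IH => //; rewrite -a1 az expr0n add0r.
  by apply/funext => w; rewrite lincomb_cons az mul0r add0r.
have bgt : 0 < b2 by rewrite lt_neqAle eq_sym bn0.
pose be := Num.sqrt b2.
have be0 : 0 < be by rewrite sqrtr_gt0.
have be2 : be ^+ 2 = b2 by rewrite sqr_sqrtr.
pose a' j := a j / be.
have a'1 : \sum_(j <- s) a' j ^+ 2 = 1.
  under eq_bigr do rewrite /a' expr_div_n be2.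
  by rewrite -mulr_suml divff.
have [k k0 kE] := prod_normal_fin t mC.
have pair : normal_pair_on P (gcyl t C) k%:E (g m) (lincomb s a').
  move=> A1 B1 mA1 mB1; pose C' j := if j == m then A1 else C j.
  have mC' j : measurable (C' j) by rewrite /C'; case: ifP.
  have u' : uniq (s ++ m :: t) by rewrite -cat1s uniq_catCA.
  have := IH (m :: t) a' C' B1 u' mC' mB1 a'1.
  rewrite gcyl_cons big_cons {1}/C' eqxx {2}/C' eqxx.
  have e1 : gcyl t C' = gcyl t C.
    rewrite /gcyl !big_seq; apply: eq_bigr => j jt; rewrite /C'; case: eqP => // jm.
    by rewrite -jm jt in mt.
  have e2 : (\prod_(j <- t) N01 (C' j) = k%:E)%E.
    rewrite -kE !big_seq; apply: eq_bigr => j jt; rewrite /C'; case: eqP => // jm.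
    by rewrite -jm jt in mt.
  rewrite e1 e2 => E; rewrite setIA (setIC (gcyl t C)) E.
  by rewrite (muleC (N01 A1)) muleA.
have := normal_pair_rotation (measurable_gcyl t mC) (measurable_g m)
  (measurable_lincomb s a') k0 _ an0 pair.
(* The second rotated coordinate is left free by taking the whole line for its set. *)
move=> /(_ be); rewrite be2 => /(_ a1) /(_ B setT mB measurableT).
rewrite preimage_setT setIT probability_setT mule1 kE => <-.
rewrite (_ : lincomb (m :: s) a = fun w => a m * g m w + be * lincomb s a' w)//.
apply/funext => w; rewrite lincomb_cons; congr (_ + _); rewrite /lincomb mulr_sumr.
by apply: eq_bigr => j _; rewrite /a' mulrA mulrCA divff ?gt_eqF// mulr1.
Qed.

Definition comb a := lincomb (enum 'I_p) a.

Lemma combE m a w : comb a w = a m * g m w + lincomb (rem m (enum 'I_p)) a w.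
Proof.
by rewrite /comb /lincomb (big_rem m) ?mem_enum.
Qed.

Lemma comb_sum a w : comb a w = \sum_m a m * g m w.
Proof. by rewrite /comb /lincomb big_enum. Qed.

Lemma measurable_comb a : measurable_fun setT (comb a).
Proof. exact: measurable_lincomb. Qed.

Lemma normal_comb a B : measurable B -> \sum_m a m ^+ 2 = 1 ->
  P (comb a @^-1` B) = N01 B.
Proof.
move=> mB a1.
have := @normal_unit_comb (enum 'I_p) [::] a (fun=> setT) B.
rewrite cats0 enum_uniq /gcyl !big_nil setTI mul1e ; apply => //.
by rewrite big_enum.
Qed.

Lemma measurable_abs_gt (M : R) : measurable [set x : R | M < `|x|].
Proof.
rewrite (_ : [set _ | _] = (fun x : R => `|x|) @^-1` `]M, +oo[%classic).
  by rewrite -[X in measurable X]setTI; exact: (normr_measurable measurableT).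
by apply/seteqP; split=> x /=; rewrite in_itv/= andbT.
Qed.

Lemma measurable_fun_abs_gt (h : T -> R) (M : R) : measurable_fun setT h ->
  measurable [set w | M < `|h w|].
Proof. by move=> mh; apply: (measurable_preimageR mh (measurable_abs_gt M)). Qed.

(** If [Y] is the normalized combination of the other coordinates and [be] its coefficient, the
    residual is [- be] times [- be * g m + a m * Y], the second coordinate of the rotation whose
    first one is [comb a]. The two are independent, and [be <= 1] is where equality becomes an
    inequality. *)
Lemma normal_residual a m B (M : R) : measurable B -> \sum_m a m ^+ 2 = 1 -> 0 <= M ->
  (P (comb a @^-1` B `&` [set w | M < `|g m w - a m * comb a w|]%R) <=
   N01 B * N01 [set x | M < `|x|]%R)%E.
Proof.
move=> mB a1 M0; set s := rem m (enum 'I_p).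
have us : uniq (s ++ [:: m]).
  rewrite cats1 rcons_uniq rem_uniq ?enum_uniq// mem_rem_uniqF ?enum_uniq//.
have mm := measurable_abs_gt M.
have mc := measurable_comb a.
have mE : measurable (comb a @^-1` B `&` [set w | M < `|g m w - a m * comb a w|]%R).
  apply: measurableI; first exact: measurable_preimageR.
  apply: (measurable_fun_abs_gt (h := fun w => g m w - a m * comb a w)).
  by apply: measurable_funB; [exact: measurable_g|exact: measurable_funM].
have a1' : a m ^+ 2 + \sum_(j <- s) a j ^+ 2 = 1.
  have E : \sum_(j <- enum 'I_p) a j ^+ 2 = 1 by rewrite big_enum.
  by rewrite -[RHS]E [RHS](big_rem m) ?mem_enum.
set b2 := \sum_(j <- s) _ in a1'.
have b20 : 0 <= b2 by apply: sumr_ge0 => i _; exact: sqr_ge0.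
have [bz|bn0] := eqVneq b2 0.
  rewrite (_ : _ `&` _ = set0) ?measure0 ?mule_ge0//.
  apply/seteqP; split=> // w [_ /=]; rewrite (combE m) lincomb0// addr0 mulrA -expr2.
  by move: a1'; rewrite bz addr0 => ->; rewrite mul1r subrr normr0 ltNge M0.
have [az|an0] := eqVneq (a m) 0.
  have bz : b2 = 1 by rewrite -a1' az expr0n add0r.
  have := @normal_unit_comb s [:: m] a (fun=> [set x | M < `|x|]%R) B us (fun=> mm) mB bz.
  rewrite /gcyl !big_seq1 setIC muleC => <-.
  rewrite le_eqVlt; apply/orP; left; apply/eqP; congr (P (_ `&` _)).
    by apply/seteqP; split=> w /=; rewrite (combE m) az mul0r add0r.
  by apply/seteqP; split=> w /=; rewrite az mul0r subr0.
have bgt : 0 < b2 by rewrite lt_neqAle eq_sym bn0.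
pose be := Num.sqrt b2.
have be0 : 0 < be by rewrite sqrtr_gt0.
have be2 : be ^+ 2 = b2 by rewrite sqr_sqrtr.
pose a' j := a j / be.
have a'1 : \sum_(j <- s) a' j ^+ 2 = 1.
  under eq_bigr do rewrite /a' expr_div_n be2.
  by rewrite -mulr_suml divff.
have pair : normal_pair_on P setT 1%:E (g m) (lincomb s a').
  move=> A1 B1 mA1 mB1.
  have := @normal_unit_comb s [:: m] a' (fun=> A1) B1 us (fun=> mA1) mB1 a'1.
  by rewrite /gcyl !big_seq1 setTI mul1e.
have H := normal_pair_rotation measurableT (measurable_g m)
  (measurable_lincomb s a') ler01 (s := be) _ an0 pair.
rewrite be2 in H; have := H a1' B _ mB mm; rewrite setTI mul1e => <-.
have cE w : a m * g m w + be * lincomb s a' w = comb a w.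
  rewrite (combE m); congr (_ + _); rewrite /lincomb mulr_sumr.
  by apply: eq_bigr => j _; rewrite /a' mulrA mulrCA divff ?gt_eqF// mulr1.
have be1 : be <= 1.
  have := sqr_ge0 (a m); move: a1'; rewrite -be2 !expr2 => a1' a0.
  by clear -a1' a0 be0; nra.
apply: le_measure; rewrite ?inE//.
  apply: measurableI; apply: measurable_preimageR => //.
    by apply: measurable_funD; apply: measurable_funM => //; exact: measurable_lincomb.
  by apply: measurable_funD; apply: measurable_funM => //; exact: measurable_lincomb.
move=> w [/= h1 h2]; split; first by rewrite /= cE.
apply: (lt_le_trans h2); rewrite /= -cE.
have -> : g m w - a m * (a m * g m w + be * lincomb s a' w) =
    - be * (- be * g m w + a m * lincomb s a' w).
  transitivity ((a m ^+ 2 + be ^+ 2) * g m w - a m * (a m * g m w + be * lincomb s a' w)).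
    by rewrite be2 a1' mul1r.
  by ring.
by rewrite normrM normrN (gtr0_norm be0) ler_piMl.
Qed.

(** By orthogonality [comb b] is unchanged when each [g m] is replaced by its residual
    [g m - a m * comb a]. A value above [2 * p * M] then forces one of the [p] residuals above [M],
    so the joint law of [comb a] and [comb b] is never computed. *)
Lemma normal_comb_tail a b B (M : R) : measurable B -> 0 <= M ->
  \sum_m a m ^+ 2 = 1 -> \sum_m a m * b m = 0 -> (forall m, `|b m| <= 2) ->
  (P (comb a @^-1` B `&` [set w | 2 * p%:R * M < `|comb b w|]%R) <=
   p%:R%:E * (N01 B * N01 [set x | M < `|x|]%R))%E.
Proof.
move=> mB M0 a1 ab b2; have mc := measurable_comb a.
have mE m : measurable (comb a @^-1` B `&` [set w | M < `|g m w - a m * comb a w|]%R).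
  apply: measurableI; first exact: measurable_preimageR.
  apply: (measurable_fun_abs_gt (h := fun w => g m w - a m * comb a w)).
  by apply: measurable_funB; [exact: measurable_g|exact: measurable_funM].
apply: (le_trans (@union_bound _ _ _ P _ (enum 'I_p) _
  (fun m => comb a @^-1` B `&` [set w | M < `|g m w - a m * comb a w|]%R) _ mE _)).
- apply: measurableI; first exact: measurable_preimageR.
  exact: (measurable_fun_abs_gt _ (measurable_comb b)).
- move=> w [Bw /= h]; apply: contrapT => hn.
  have hm m : `|g m w - a m * comb a w| <= M.
    by rewrite leNgt; apply/negP => lt; apply: hn; exists m; rewrite ?mem_enum.
  move: h; apply/negP; rewrite -leNgt.
  rewrite (comb_sum b); have -> : \sum_m b m * g m w = \sum_m b m * (g m w - a m * comb a w).
    under [RHS]eq_bigr do rewrite mulrBr mulrA (mulrC (b _) (a _)).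
    by rewrite sumrB -mulr_suml ab mul0r subr0.
  rewrite (le_trans (ler_norm_sum _ _ _))//.
  apply: (@le_trans _ _ (\sum_(m < p) 2 * M)).
    by apply: ler_sum => m _; rewrite normrM ler_pM.
  by rewrite sumr_const card_ord -[leLHS]mulr_natr mulrAC.
- apply: (@le_trans _ _ (\sum_(m <- enum 'I_p) N01 B * N01 [set x | M < `|x|]%R)%E).
    by apply: lee_sum => m _; exact: normal_residual.
  have [v vE] : exists v : R, (N01 B * N01 [set x | M < `|x|]%R)%E = v%:E.
    exists (fine (N01 B * N01 [set x | M < `|x|]%R)%E); rewrite fineK// fin_numM//.
      exact: fin_num_measure.
    by apply: fin_num_measure; exact: measurable_abs_gt.
  rewrite vE big_enum /= sumEFin sumr_const card_ord.
  by rewrite -EFinM mulr_natl.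
Qed.

End NormalCombination.

(** * Normal tails *)

Section NormalTail.
Context {R : realType}.
Local Notation mu := (@lebesgue_measure R).
Local Notation N01 := (@normal_prob R 0 1).
Local Notation phi := (@normal_pdf R 0 1).
Implicit Types x y c e : R.

Definition normal_tail x : R := fine (N01 `]x, +oo[%classic).

Lemma normal_tailE x : N01 `]x, +oo[%classic = (normal_tail x)%:E.
Proof. by rewrite /normal_tail fineK//; apply: fin_num_measure. Qed.

(** After a shift by [x], the density at [x + y] is at most [expR (- x ^+ 2 / 2)] times the density
    at [y], because [x * y >= 0] on the range of integration. *)
Lemma normal_tail_le x : 0 <= x -> normal_tail x <= expR (- x ^+ 2 / 2).
Proof.
move=> x0; rewrite -lee_fin -normal_tailE normal_probE//.
rewrite (@integral_affine _ 1 x) ?oner_neq0//; first last.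
- by move=> y; rewrite -EFinM lee_fin mulr_ge0// normal_pdf_ge0.
- apply: emeasurable_funM; last exact: measurable_normal_pdf01.
  exact/measurable_EFinP/measurable_indic.
rewrite normr1 mul1e.
apply: (@le_trans _ _ (\int[mu]_y ((expR (- x ^+ 2 / 2))%:E * (phi y)%:E))%E); last first.
  rewrite ge0_integralZl//.
  - by rewrite integral_normal_pdf mule1.
  - exact: measurable_normal_pdf01.
  - by move=> y _; rewrite lee_fin normal_pdf_ge0.
apply: ge0_le_integral => //.
- by move=> y _; rewrite -EFinM lee_fin mulr_ge0// normal_pdf_ge0.
- apply: (measurableT_comp
    (f := fun z : R => ((\1_(`]x, +oo[) z : R)%:E * (phi z)%:E)%E)
    _ (measurable_affine 1 x)).
  apply: emeasurable_funM; last exact: measurable_normal_pdf01.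
  exact/measurable_EFinP/measurable_indic.
- by apply: emeasurable_funM => //; exact: measurable_normal_pdf01.
- move=> y _; rewrite -!EFinM lee_fin indicE.
  case: (boolP (_ \in _)) => [|_]; last by rewrite mul0r mulr_ge0// ?expR_ge0// normal_pdf_ge0.
  rewrite mul1r inE /= in_itv/= andbT mul1r => xy.
  rewrite !normal_pdf01E mulrCA -expRD ler_wpM2l ?normal_peak_ge0//.
  rewrite ler_expR; have y0 : 0 < y by lra.
  have : 0 <= x * y by rewrite mulr_ge0// ltW.
  by rewrite !expr2; lra.
Qed.

Lemma normal_tail_le_inv x : 1 <= x -> normal_tail x <= 2 / x.
Proof.
move=> x1; have x0 : 0 < x by lra.
apply: (le_trans (normal_tail_le (ltW x0))).
rewrite mulNr expRN -[leRHS]invrK lef_pV2 ?posrE ?expR_gt0 ?invr_gt0 ?divr_gt0//.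
rewrite invf_div; apply: (le_trans _ (expR_ge1Dx _)).
by rewrite expr2; nra.
Qed.

Lemma normal_pdf_decr x y : 0 <= x -> x <= y -> phi y <= phi x.
Proof.
move=> x0 xy; rewrite !normal_pdf01E ler_wpM2l ?normal_peak_ge0// ler_expR.
by rewrite !expr2; nra.
Qed.

(** Only the slab of width [e] to the right of [x] is kept; the density there is at least its value
    at the right end. *)
Lemma normal_tail_ge x e : 0 <= x -> 0 <= e -> e * phi (x + e) <= normal_tail x.
Proof.
move=> x0 e0; rewrite -lee_fin -normal_tailE.
apply: (@le_trans _ _ (N01 `]x, x + e]%classic)); last first.
  apply: le_measure; rewrite ?inE//.
  by move=> y /=; rewrite !in_itv/= andbT => /andP[].
rewrite /normal_prob.
apply: (@le_trans _ _ (\int[mu]_(y in `]x, (x + e)%R]) (phi (x + e))%:E)%E).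
  rewrite integral_cst//= lebesgue_measure_itv/= lte_fin.
  case: ifPn => [_|]; first by rewrite -EFinB -EFinM lee_fin addrAC subrr add0r mulrC.
  by rewrite -leNgt => h; rewrite mule0 lee_fin (_ : e = 0) ?mul0r//; lra.
apply: ge0_le_integral => //.
- by move=> y _; rewrite lee_fin normal_pdf_ge0.
- by apply: measurable_funTS; exact: measurable_normal_pdf01.
- move=> y; rewrite /= in_itv/= => /andP[xy ye]; rewrite lee_fin.
  by apply: normal_pdf_decr => //; lra.
Qed.

Lemma normal_tail_lipschitz x y : x <= y ->
  normal_tail y <= normal_tail x <= normal_tail y + normal_peak 1 * (y - x).
Proof.
move=> xy; have E : N01 `]x, +oo[%classic = (N01 `]x, y]%classic + N01 `]y, +oo[%classic)%E.
  rewrite -measureU//; last first.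
    apply/seteqP; split=> // z [] /=; rewrite !in_itv/= andbT => /andP[_ zy] yz.
    by move: (lt_le_trans yz zy); rewrite ltxx.
  congr (N01 _); apply/seteqP; split=> z /=; rewrite !in_itv/= ?andbT.
    by move=> ->; have [?|?] := leP z y; [left|right].
  by case=> [/andP[]//|]; exact: le_lt_trans.
have U : (N01 `]x, y]%classic <= (normal_peak 1 * (y - x))%:E)%E.
  apply: (@le_trans _ _ (\int[mu]_(z in `]x, y]) (normal_peak 1)%:E)%E).
    apply: ge0_le_integral => //.
    - by move=> z _; rewrite lee_fin normal_pdf_ge0.
    - by apply: measurable_funTS; exact: measurable_normal_pdf01.
    - by move=> z _; rewrite lee_fin normal_pdf_ub// oner_neq0.
  rewrite integral_cst//= lebesgue_measure_itv/= lte_fin.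
  case: ifPn => [_|]; first by rewrite -EFinB -EFinM.
  by move=> _; rewrite mule0 lee_fin mulr_ge0 ?normal_peak_ge0// subr_ge0.
rewrite -!lee_fin EFinD -!normal_tailE E; apply/andP; split.
  by rewrite leeDr.
by rewrite [leRHS]addeC; exact: leeD2r.
Qed.

Lemma continuous_normal_tail : continuous normal_tail.
Proof.
move=> x; apply/cvgrPdist_le => e e0.
have pk0 : 0 < normal_peak (1 : R) by rewrite normal_peak_gt0 ?oner_neq0.
have ep0 : 0 < e / normal_peak 1 by rewrite divr_gt0.
near=> y.
have : `|x - y| <= e / normal_peak 1.
  by near: y; exists (e / normal_peak 1) => //= z /ltW.
rewrite ler_pdivlMr// => h; apply: (le_trans _ h).
have [xy|yx] := leP x y.
- have /andP[h1 h2] := normal_tail_lipschitz xy.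
  rewrite ger0_norm ?subr_ge0// ler0_norm ?subr_le0//.
  by move: h2; rewrite opprB; lra.
- have /andP[h1 h2] := normal_tail_lipschitz (ltW yx).
  rewrite ler0_norm ?subr_le0// ger0_norm ?subr_ge0 ?(ltW yx)//.
  by move: h2; lra.
Unshelve. all: by end_near. Qed.

(** Intermediate values between 0 and [1 + 2 / y]: [normal_tail_le_inv] bounds the tail at the right
    end, and the slab of width 1 shows that the tail at 0 is at least [phi 1]. *)
Lemma normal_threshold y : 0 < y -> y <= phi 1 ->
  exists2 c, 0 <= c & normal_tail c = y.
Proof.
move=> y0 y1.
have b0 : 0 <= 1 + 2 / y by rewrite addr_ge0// divr_ge0// ltW.
have [||c] := @IVT R normal_tail 0 (1 + 2 / y) y b0.
- by apply: continuous_subspaceT => z; exact: continuous_normal_tail.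
- have lb : y <= normal_tail 0.
    have := @normal_tail_ge 0 1 (lexx _) ler01; rewrite mul1r add0r.
    exact: le_trans.
  have ub : normal_tail (1 + 2 / y) <= y.
    have i1 : 1 <= 1 + 2 / y by rewrite lerDl divr_ge0// ltW.
    apply: (le_trans (normal_tail_le_inv i1)).
    rewrite ler_pdivrMr; last by rewrite (lt_le_trans ltr01).
    rewrite mulrDr mulr1 mulrCA divff ?gt_eqF// mulr1; lra.
  by rewrite ge_min le_max lb ub orbT.
by rewrite in_itv/= => /andP[c0 _] <-; exists c.
Qed.

Lemma normal_abs_tail e : 0 < e ->
  exists2 M, 0 <= M & (N01 [set x | M < `|x|]%R <= e%:E)%E.
Proof.
(* Each of the two tails is at most [2 / M], and this choice makes that at most [e / 2]. *)
move=> e0; pose M := 1 + 4 / e.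
have M1 : 1 <= M by rewrite lerDl divr_ge0// ltW.
exists M; first lra.
have mI : measurable (`]M, +oo[%classic : set R) by exact: measurable_itv.
have mI' : measurable ((fun x : R => - x) @^-1` `]M, +oo[%classic).
  by rewrite -[X in measurable X]setTI; exact: (oppr_measurable measurableT).
have -> : [set x | M < `|x|]%R = `]M, +oo[%classic `|` (fun x : R => - x) @^-1` `]M, +oo[%classic.
  apply/seteqP; split=> x /=; rewrite !in_itv/= !andbT lter_normr => h.
    by case/orP: h => h; [left|right].
  by apply/orP; case: h => h; [left|right].
apply: (@le_trans _ _ (N01 `]M, +oo[%classic + N01 ((fun x : R => - x)%R @^-1` `]M, +oo[%classic))%E).
  exact: measureU2.
rewrite normal_prob_opp// normal_tailE -EFinD lee_fin.
have := normal_tail_le_inv M1.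
have : 2 / M <= e / 2.
  rewrite ler_pdivrMr; last lra.
  by rewrite mulrDr mulr1 (_ : e / 2 * (4 / e) = 2); [lra|field; rewrite gt_eqF].
by lra.
Qed.

End NormalTail.

(** * The selected blocks *)

Section SortedExtremes.
Context {I : eqType} {R : realType} (f : I -> R) (r : nat).
Implicit Types (s : seq I) (x : R).
Local Notation fle := (fun a b => f a <= f b).

Let fle_trans : transitive fle.
Proof. by move=> y x z; exact: le_trans. Qed.

(** If a point [b] among the last [r] were at most [x], so would be all points before it, and the
    exceedances of [x] would lie strictly after [b]: fewer than [r] of them. *)
Lemma sorted_largest_gt s x b : sorted fle s ->
  (r <= count (fun i => (x < f i)%R) s)%N -> b \in drop (size s - r) s -> x < f b.
Proof.
move=> ss cs bs; rewrite ltNge; apply/negP => bx.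
have sz : (size (drop (size s - r) s) <= r)%N by rewrite size_drop leq_subLR addnC -leq_subLR.
move: ss cs; rewrite -{1 2}(cat_take_drop (size s - r) s).
case/splitPr: bs sz => d1 d2 sz; rewrite catA sorted_pairwise// pairwise_cat.
rewrite allrel_consr => /andP[/andP[lb _] _]; rewrite count_cat /= ltNge bx add0n.
rewrite (_ : count _ _ = 0)%N ?add0n => [cd2|].
  move: sz; rewrite size_cat /= addnS ltnNge (leq_trans cd2)//.
  by rewrite (leq_trans (count_size _ _))// leq_addl.
apply/eqP; rewrite -leqn0 leqNgt -has_count; apply/hasPn => i /(allP lb) /= ib.
by rewrite -leNgt (le_trans ib).
Qed.

Lemma sorted_smallest_lt s x b : sorted fle s ->
  (r <= count (fun i => (f i < x)%R) s)%N -> b \in take r s -> f b < x.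
Proof.
move=> ss cs bs; rewrite ltNge; apply/negP => bx.
have sz : (size (take r s) <= r)%N by rewrite size_take_min geq_minl.
move: ss cs; rewrite -{1 2}(cat_take_drop r s).
case/splitPr: bs sz => d1 d2 sz; rewrite -catA cat_cons sorted_pairwise//.
rewrite pairwise_cat /= => /and3P[_ _ /andP[lb _]].
rewrite count_cat /= ltNge bx add0n.
rewrite (_ : count _ (d2 ++ _) = 0)%N ?addn0 => [cd1|].
  move: sz; rewrite size_cat /= addnS ltnNge (leq_trans cd1)//.
  by rewrite (leq_trans (count_size _ _))// leq_addr.
apply/eqP; rewrite -leqn0 leqNgt -has_count; apply/hasPn => i /(allP lb) /= ib.
by rewrite -leNgt (le_trans bx).
Qed.

End SortedExtremes.

Section DOptimalSelection.
Context {R : realType} {n p : nat} (r : nat) (Z : 'M[R]_(n, p)).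
Implicit Types (js : seq 'I_p) (lo hi : 'I_p -> seq 'I_n).

Let step := @dopt_step R n p r Z.

Lemma dopt_step_spec st j (s := sort (fun a b => Z a j <= Z b j) st.2) :
  (2 * r <= size st.2)%N ->
  [/\ perm_eq ((take r s ++ drop (size s - r) s) ++ (step st j).2) st.2,
      (step st j).1 = st.1 ++ (take r s ++ drop (size s - r) s),
      size (take r s) = r & size (drop (size s - r) s) = r].
Proof.
move=> sz; have ss : size s = size st.2 by rewrite size_sort.
have r2 : (r + r <= size s)%N by rewrite ss addnn -mul2n.
have rs : (r <= size s)%N by rewrite (leq_trans _ r2)// leq_addr.
have rs' : (r <= size s - r)%N by rewrite leq_subRL.
split=> //; last 2 first.
- by rewrite size_takel.
- by rewrite size_drop subKn.
have ps : perm_eq s st.2 by rewrite perm_sort.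
apply: perm_trans ps; rewrite /step /dopt_step /= -/s.
have sE : s = take r s ++ drop r (take (size s - r) s) ++ drop (size s - r) s.
  rewrite catA -[X in _ = X ++ _](_ : take (size s - r) s = _) ?cat_take_drop//.
  rewrite -[LHS](cat_take_drop r); congr (_ ++ _).
  by rewrite take_takel.
rewrite [X in perm_eq _ X]sE -catA perm_cat2l perm_catC.
exact: perm_refl.
Qed.

(** Each step removes [2 * r] points, hence at most that many exceedances of any level. A supply of
    [2 * r] exceedances for each covariate still to be treated is therefore inherited by the shorter
    list, and covers the [r] points of the block being chosen. *)
Lemma dopt_foldl js st : uniq js -> uniq (st.1 ++ st.2) ->
  (2 * r * size js <= size st.2)%N ->
  exists lo hi, [/\ (foldl step st js).1 = st.1 ++ flatten [seq lo j ++ hi j | j <- js],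
    uniq (foldl step st js).1,
    forall j, j \in js -> size (lo j) = r /\ size (hi j) = r,
    forall j x b, j \in js ->
      (2 * r * size js <= count (fun i => (x < Z i j)%R) st.2)%N -> b \in hi j -> x < Z b j
  & forall j x b, j \in js ->
      (2 * r * size js <= count (fun i => (Z i j < x)%R) st.2)%N -> b \in lo j -> Z b j < x].
Proof.
elim: js st => [|j js IH] st /=.
  move=> _ us _; exists (fun=> [::]), (fun=> [::]); rewrite cats0; split=> //.
  by move: us; rewrite cat_uniq => /and3P[].
move=> /andP[jjs ujs] us sz.
have sz2 : (2 * r <= size st.2)%N.
  by rewrite (leq_trans _ sz)// mulnS leq_addr.
have [pe e1 sl sh] := dopt_step_spec j sz2.
set s := sort _ _ in pe e1 sl sh.
set st1 := step st j in pe e1 *.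
set ex := take r s ++ drop (size s - r) s in pe e1.
have szex : size ex = (2 * r)%N by rewrite /ex size_cat sl sh mul2n addnn.
have ce (P : pred 'I_n) : (count P st.2 <= 2 * r + count P st1.2)%N.
  by rewrite -(permP pe) count_cat leq_add2r -szex count_size.
have us1 : uniq (st1.1 ++ st1.2).
  have -> : uniq (st1.1 ++ st1.2) = uniq (st.1 ++ st.2).
    by apply: perm_uniq; rewrite e1 -catA perm_cat2l.
  by [].
have sz1 : (2 * r * size js <= size st1.2)%N.
  have := perm_size pe; rewrite size_cat szex => E.
  by move: sz; rewrite -E mulnS leq_add2l.
have [lo [hi [E U S H L]]] := IH st1 ujs us1 sz1.
have jn j' : j' \in js -> (j' == j) = false.
  by move=> j'js; apply/eqP => jj; rewrite -jj j'js in jjs.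
have ss : sorted (fun a b => Z a j <= Z b j) s.
  by apply: sort_sorted => a b; exact: le_total.
have cs (P : pred 'I_n) : count P s = count P st.2.
  by apply/permP; rewrite perm_sort.
have rle : (r <= 2 * r * (size js).+1)%N.
  by rewrite mulnS (leq_trans _ (leq_addr _ _))// leq_pmull.
exists (fun j' => if j' == j then take r s else lo j'),
       (fun j' => if j' == j then drop (size s - r) s else hi j'); split.
- rewrite E e1 eqxx -[LHS]catA; congr (_ ++ (_ ++ _)); congr flatten.
  by apply/eq_in_map => j' /jn ->.
- exact: U.
- move=> j'; rewrite inE => /predU1P[->|j'js]; first by rewrite eqxx.
  by rewrite jn//; exact: S.
- move=> j' x b; rewrite inE => /predU1P[->|j'js].
    by rewrite eqxx -cs => c; exact: (@sorted_largest_gt _ _ (Z^~ j) r s x b ss (leq_trans rle c)).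
  rewrite jn// => c; apply: H => //.
  by move: (leq_trans c (ce _)); rewrite mulnS leq_add2l.
- move=> j' x b; rewrite inE => /predU1P[->|j'js].
    by rewrite eqxx -cs => c; exact: (@sorted_smallest_lt _ _ (Z^~ j) r s x b ss (leq_trans rle c)).
  rewrite jn// => c; apply: L => //.
  by move: (leq_trans c (ce _)); rewrite mulnS leq_add2l.
Qed.

Definition dopt_blocks lo hi :=
  [/\ dopt_select r Z = flatten [seq lo j ++ hi j | j <- enum 'I_p],
      uniq (dopt_select r Z)
    & forall j, size (lo j) = r /\ size (hi j) = r].

Lemma dopt_selectP : (2 * p * r <= n)%N ->
  exists lo hi, [/\ dopt_blocks lo hi,
    forall j x b, (2 * p * r <= count (fun i => (x < Z i j)%R) (enum 'I_n))%N ->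
      b \in hi j -> x < Z b j
  & forall j x b, (2 * p * r <= count (fun i => (Z i j < x)%R) (enum 'I_n))%N ->
      b \in lo j -> Z b j < x].
Proof.
move=> pn; have E : (2 * r * size (enum 'I_p) = 2 * p * r)%N.
  by rewrite size_enum_ord mulnAC.
have [||| lo [hi [E1 U S H L]]] := @dopt_foldl (enum 'I_p) ([::], enum 'I_n).
- exact: enum_uniq.
- exact: enum_uniq.
- by rewrite E /= size_enum_ord.
exists lo, hi; rewrite E /= in H L *; split.
- by split=> // j; apply: S; rewrite mem_enum.
- by move=> j x b c; apply: H => //; rewrite mem_enum.
- by move=> j x b c; apply: L => //; rewrite mem_enum.
Qed.

End DOptimalSelection.

(** * Local Lipschitz continuity of matrix inversion *)

Section InversePerturbation.
Context {R : realType}.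

(** The entrywise 1-norm: it is submultiplicative and dominates every entry. *)
Definition sumnorm m n (A : 'M[R]_(m, n)) : R := \sum_i \sum_j `|A i j|.

Lemma sumnorm_ge0 m n (A : 'M[R]_(m, n)) : 0 <= sumnorm A.
Proof. by do 2 apply: sumr_ge0 => ? _. Qed.

Lemma le_entry_sumnorm m n (A : 'M[R]_(m, n)) i j : `|A i j| <= sumnorm A.
Proof.
rewrite /sumnorm (bigD1 i)//= (bigD1 j)//= -addrA lerDl.
by rewrite addr_ge0 ?sumr_ge0// => ? _; rewrite sumr_ge0.
Qed.

Lemma sumnormD m n (A B : 'M[R]_(m, n)) : sumnorm (A + B) <= sumnorm A + sumnorm B.
Proof.
rewrite /sumnorm -big_split /=; apply: ler_sum => i _.
rewrite -big_split /=; apply: ler_sum => j _.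
by rewrite mxE ler_normD.
Qed.

Lemma sumnormN m n (A : 'M[R]_(m, n)) : sumnorm (- A) = sumnorm A.
Proof. by do 2 apply: eq_bigr => ? _; rewrite mxE normrN. Qed.

Lemma sumnormM m n q (A : 'M[R]_(m, n)) (B : 'M[R]_(n, q)) :
  sumnorm (A *m B) <= sumnorm A * sumnorm B.
Proof.
rewrite {1 2}/sumnorm mulr_suml; apply: ler_sum => i _.
apply: (@le_trans _ _ (\sum_j \sum_k `|A i k| * `|B k j|)).
  apply: ler_sum => j _; rewrite mxE (le_trans (ler_norm_sum _ _ _))//.
  by apply: ler_sum => k _; rewrite normrM.
rewrite exchange_big /= mulr_suml; apply: ler_sum => k _.
rewrite -mulr_sumr ler_wpM2l// /sumnorm (bigD1 k)//= lerDl.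
by do 2 apply: sumr_ge0 => ? _.
Qed.

Lemma sumnorm_le m n (A : 'M[R]_(m, n)) (e : R) :
  (forall i j, `|A i j| <= e) -> sumnorm A <= (m * n)%:R * e.
Proof.
move=> h; apply: (@le_trans _ _ (\sum_(i < m) \sum_(j < n) e)).
  by do 2 apply: ler_sum => ? _.
by rewrite !sumr_const !card_ord -mulrnA mulr_natl mulnC.
Qed.

Lemma sumnorm_eq0 m n (A : 'M[R]_(m, n)) : sumnorm A = 0 -> A = 0.
Proof.
move=> h; apply/matrixP => i j; rewrite mxE; apply/eqP.
by rewrite -normr_le0 -h le_entry_sumnorm.
Qed.

(** The radius makes [sumnorm (G - G0) * C0] at most one half. A left null vector [v] of [G] equals
    [- v (G - G0) G0^-1], so its norm is at most half of itself. The resolvent identity then gives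
    first [sumnorm (invmx G) <= 2 * C0] and next the Lipschitz bound. [Q] is the number of entries,
    and the added 1 keeps the radius positive when [q = 0]. *)
Lemma invmx_perturb q (G0 : 'M[R]_q) : G0 \in unitmx ->
  exists C e0, [/\ 0 <= C, 0 < e0 & forall (e : R) (G : 'M[R]_q), 0 <= e -> e <= e0 ->
    (forall a b, `|G a b - G0 a b| <= e) ->
    G \in unitmx /\ forall a b, `|invmx G a b - invmx G0 a b| <= C * e].
Proof.
move=> u0; pose C0 := sumnorm (invmx G0); pose Q : R := (q * q)%:R.
have C00 : 0 <= C0 := sumnorm_ge0 _.
have Q0 : 0 <= Q := ler0n _ _.
exists (2 * C0 * Q * C0), (2 * (Q * C0 + 1))^-1; split.
- by rewrite !mulr_ge0.
- by rewrite invr_gt0 mulr_gt0// ltr_wpDl// mulr_ge0.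
move=> e G eg0 ee0 he.
have Ne : sumnorm (G - G0) <= Q * e by apply: sumnorm_le => a b; rewrite !mxE.
have small : sumnorm (G - G0) * C0 <= 2^-1.
  apply: (@le_trans _ _ (Q * e * C0)); first by rewrite ler_wpM2r.
  have h : 0 < 2 * (Q * C0 + 1) by rewrite mulr_gt0// ltr_wpDl// mulr_ge0.
  move: ee0; rewrite -[X in _ <= X]mul1r ler_pdivlMr// => h2.
  by rewrite -[leRHS]mul1r ler_pdivlMr//; nra.
have uG : G \in unitmx.
  rewrite unitmxE unitfE; apply/negP => /det0P[v vn0 vG].
  move/eqP: vn0; apply; apply: sumnorm_eq0.
  have vE : v = - (v *m ((G - G0) *m invmx G0)).
    by rewrite mulmxA mulmxBr vG sub0r mulNmx opprK mulmxK.
  have := sumnorm_ge0 v; have : sumnorm v <= sumnorm v * (sumnorm (G - G0) * C0).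
    rewrite {1}vE sumnormN (le_trans (sumnormM _ _))// ler_wpM2l ?sumnorm_ge0//.
    exact: sumnormM.
  move=> h1 h2; apply/eqP; rewrite eq_le h2 andbT.
  by nra.
split=> // a b.
have dE : invmx G - invmx G0 = - (invmx G *m ((G - G0) *m invmx G0)).
  rewrite mulmxA mulmxBr mulVmx// mulmxBl mul1mx -mulmxA mulmxV// mulmx1.
  by rewrite opprB.
have N1 : sumnorm (invmx G - invmx G0) <= sumnorm (invmx G) * (sumnorm (G - G0) * C0).
  rewrite dE sumnormN (le_trans (sumnormM _ _))// ler_wpM2l ?sumnorm_ge0//.
  exact: sumnormM.
have N2 : sumnorm (invmx G) <= 2 * C0.
  have : sumnorm (invmx G) <= C0 + sumnorm (invmx G - invmx G0).
    by rewrite -{1}(subrK (invmx G0) (invmx G)) addrC sumnormD.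
  have := sumnorm_ge0 (invmx G); nra.
have -> : invmx G a b - invmx G0 a b = (invmx G - invmx G0) a b by rewrite !mxE.
rewrite (le_trans (le_entry_sumnorm _ _ _))// (le_trans N1)//.
apply: (@le_trans _ _ (2 * C0 * (Q * e * C0))).
  apply: ler_pM => //; rewrite ?sumnorm_ge0 ?mulr_ge0 ?sumnorm_ge0//.
  by rewrite ler_wpM2r.
by rewrite le_eqVlt; apply/orP; left; apply/eqP; ring.
Qed.

End InversePerturbation.

(** * The Gram matrix of the subdata *)

Section DOptimalGram.
Context {R : realType} {n p : nat} (r : nat) (Z : 'M[R]_(n, p)).

Definition dopt_index := tnth (in_tuple (dopt_select r Z)).

Definition dopt_design := design (rowsub dopt_index Z).

Definition dopt_gram := dopt_design^T *m dopt_design.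

(** The last factor is the selection matrix. It gives the weights one column for each of the [n]
    observations, so that the estimator is a linear map of the whole response. *)
Definition dopt_weights : 'M[R]_(1 + p, n) :=
  invmx dopt_gram *m dopt_design^T *m rowsub dopt_index 1%:M.

Lemma dopt_olsE (y : 'cV[R]_n) : dopt_ols r Z y = dopt_weights *m y.
Proof.
by rewrite /dopt_ols /ols /dopt_weights -[RHS]mulmxA mul_rowsub_mx mul1mx.
Qed.

Lemma design_rowsub m (f : 'I_m -> 'I_n) i a :
  design (rowsub f Z) i a = design Z (f i) a.
Proof. by rewrite /design !mxE; case: (fintype.split a) => ?; rewrite !mxE. Qed.

Lemma dopt_gramE a b :
  dopt_gram a b = \sum_(i <- dopt_select r Z) design Z i a * design Z i b.
Proof.
rewrite mxE (big_tnth _ _ (dopt_select r Z)); apply: eq_bigr => i _.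
by rewrite mxE !design_rowsub.
Qed.

Lemma dopt_gram_sym : dopt_gram^T = dopt_gram.
Proof. by rewrite trmx_mul trmxK. Qed.

(** The rows of the selection matrix are orthonormal because no point is selected twice; what
    remains is a Gram matrix between two copies of its inverse. *)
Lemma dopt_weights_gram : uniq (dopt_select r Z) -> dopt_gram \in unitmx ->
  dopt_weights *m dopt_weights^T = invmx dopt_gram.
Proof.
move=> us ug; have SS : rowsub dopt_index 1%:M *m (rowsub dopt_index 1%:M)^T = 1%:M
  :> 'M[R]_(size (dopt_select r Z)).
  rewrite mul_rowsub_mx mul1mx; apply/matrixP => a b; rewrite !mxE eq_sym.
  congr (nat_of_bool _)%:R.
  by rewrite /dopt_index !(tnth_nth (dopt_index a)) nth_uniq.
pose W := invmx dopt_gram *m dopt_design^T.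
rewrite /dopt_weights -/W trmx_mul mulmxA -(mulmxA W) SS mulmx1.
rewrite /W trmx_mul trmxK -mulmxA (mulmxA dopt_design^T) mulmxA mulVmx// mul1mx.
by rewrite trmx_inv dopt_gram_sym.
Qed.

Lemma sum_dopt_blocks lo hi (F : 'I_n -> R) : dopt_blocks r Z lo hi ->
  \sum_(i <- dopt_select r Z) F i = \sum_j (\sum_(i <- lo j) F i + \sum_(i <- hi j) F i).
Proof.
case=> -> _ _; rewrite big_flatten big_map big_enum /=.
by apply: eq_bigr => j _; rewrite big_cat.
Qed.

End DOptimalGram.

Lemma sum_approx (R : realType) (I : eqType) (s : seq I) (F : I -> R) (c e : R) :
  (forall i, i \in s -> `|F i - c| <= e) ->
  `|\sum_(i <- s) F i - (size s)%:R * c| <= (size s)%:R * e.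
Proof.
elim: s => [|i s IH] h; first by rewrite big_nil !mul0r subr0 normr0.
rewrite big_cons /=.
have -> : F i + \sum_(j <- s) F j - (size s).+1%:R * c =
          (F i - c) + (\sum_(j <- s) F j - (size s)%:R * c) by rewrite -natr1; ring.
have -> : (size s).+1%:R * e = e + (size s)%:R * e by rewrite -natr1; ring.
rewrite (le_trans (ler_normD _ _))// lerD//; first by rewrite h// mem_head.
by apply: IH => k ks; apply: h; rewrite inE ks orbT.
Qed.

Section DOptimalCovariance.
Context {R : realType} {p : nat} (r : nat).
(* [v j s] is the limit of the normalized regressors in the block of the
   largest ([s = true]) or smallest values of covariate [j]. *)
Context (v : 'I_p -> bool -> 'I_(1 + p) -> R).

Definition gram_limit : 'M[R]_(1 + p) :=
  \matrix_(a, b) (r%:R * \sum_j (v j false a * v j false b + v j true a * v j true b)).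

(** A deterministic statement, uniform in [n] and [Z]. With [G] the Gram matrix of the columns
    divided by [D], the product in the conclusion is exactly [invmx G], so it remains to place [G]
    within [B * e] of its limit. *)
Lemma dopt_cov_approx : gram_limit \in unitmx ->
  exists C e0, [/\ 0 <= C, 0 < e0 & forall n (Z : 'M[R]_(n, p)) (D : 'rV[R]_(1 + p)) lo hi e,
    dopt_blocks r Z lo hi -> (forall a, 0 < D ord0 a) -> 0 <= e -> e <= e0 ->
    (forall j i a, i \in hi j -> `|design Z i a / D ord0 a - v j true a| <= e) ->
    (forall j i a, i \in lo j -> `|design Z i a / D ord0 a - v j false a| <= e) ->
    forall a b, `|((diag_mx D *m dopt_weights r Z) *m (diag_mx D *m dopt_weights r Z)^T) a b
                  - invmx gram_limit a b| <= C * e].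
Proof.
move=> uG; have [C [e0 [C0 e00 H]]] := invmx_perturb uG.
pose V : R := \sum_j \sum_a (`|v j false a| + `|v j true a|).
have V0 : 0 <= V by do 2 apply: sumr_ge0 => ? _; rewrite addr_ge0.
have vV j s a : `|v j s a| <= V.
  rewrite /V (bigD1 j)//= (bigD1 a)//= -addrA.
  have h : 0 <= \sum_(i | i != a) (`|v j false i| + `|v j true i|) +
      \sum_(i | i != j) \sum_a0 (`|v i false a0| + `|v i true a0|).
    by rewrite addr_ge0 ?sumr_ge0// => ? _; rewrite ?addr_ge0 ?sumr_ge0// => ? _; rewrite addr_ge0.
  by rewrite (le_trans _ (_ : `|v j false a| + `|v j true a| <= _)) ?lerDl//;
    case: s; rewrite ?lerDl ?lerDr.
pose B := p%:R * (2 * r%:R * (2 * V + 1)).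
have B0 : 0 <= B by rewrite !mulr_ge0// addr_ge0// mulr_ge0.
(* [e <= 1] absorbs the quadratic term in the product of two approximations, which leaves an error
   [(2 * V + 1) * e] per point; [B] adds this over the [2 * r] points selected for each of the [p]
   covariates. *)
exists (C * B), (Num.min 1 (e0 / (B + 1))); split.
- by rewrite mulr_ge0.
- by rewrite lt_min ltr01 divr_gt0// ltr_wpDl.
move=> n Z D lo hi e bl D0 ege0; rewrite le_min => /andP[e1 ee0] hhi hlo.
have Be : B * e <= e0.
  move: ee0; rewrite ler_pdivlMr ?ltr_wpDl// => h; nra.
pose G := diag_mx (\row_a (D ord0 a)^-1) *m dopt_gram r Z *m diag_mx (\row_a (D ord0 a)^-1).
have GE a b : G a b = \sum_(i <- dopt_select r Z)
    (design Z i a / D ord0 a) * (design Z i b / D ord0 b).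
  rewrite /G mul_mx_diag mxE mul_diag_mx mxE dopt_gramE !mxE mulr_sumr mulr_suml.
  by apply: eq_bigr => i _; ring.
have prodE (x y x' y' : R) : `|x - x'| <= e -> `|y - y'| <= e -> `|x'| <= V -> `|y'| <= V ->
    `|x * y - x' * y'| <= (2 * V + 1) * e.
  move=> hx hy hx' hy'.
  have -> : x * y - x' * y' = (x - x') * (y - y') + x' * (y - y') + (x - x') * y' by ring.
  rewrite (le_trans (ler_normD _ _))// (le_trans (lerD (ler_normD _ _) (lexx _)))//.
  rewrite !normrM.
  have a1 : `|x - x'| * `|y - y'| <= 1 * e by apply: ler_pM => //; exact: le_trans e1.
  have a2 : `|x'| * `|y - y'| <= V * e by apply: ler_pM.
  have a3 : `|x - x'| * `|y'| <= e * V by apply: ler_pM.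
  by lra.
have GG a b : `|G a b - gram_limit a b| <= B * e.
  rewrite GE (sum_dopt_blocks _ bl) mxE mulr_sumr -sumrB.
  apply: (@le_trans _ _ (\sum_(j < p) 2 * r%:R * (2 * V + 1) * e)); last first.
    rewrite sumr_const card_ord -[leLHS]mulr_natl le_eqVlt; apply/orP; left.
    by apply/eqP; rewrite /B; ring.
  apply: (le_trans (ler_norm_sum _ _ _)); apply: ler_sum => j _.
  have [_ _ /(_ j)[sl sh]] := bl.
  have h1 := @sum_approx R _ (lo j) (fun i => (design Z i a / D ord0 a) * (design Z i b / D ord0 b))
     (v j false a * v j false b) ((2 * V + 1) * e).
  have h2 := @sum_approx R _ (hi j) (fun i => (design Z i a / D ord0 a) * (design Z i b / D ord0 b))
     (v j true a * v j true b) ((2 * V + 1) * e).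
  rewrite sl in h1; rewrite sh in h2.
  rewrite mulrDr opprD addrACA (le_trans (ler_normD _ _))//.
  have -> : 2 * r%:R * (2 * V + 1) * e = r%:R * ((2 * V + 1) * e) + r%:R * ((2 * V + 1) * e) by ring.
  apply: lerD.
    by apply: h1 => i il; apply: prodE => //; apply: hlo.
  by apply: h2 => i ih; apply: prodE => //; apply: hhi.
have [uGG E] := H (B * e) G (mulr_ge0 B0 ege0) Be GG.
pose DV := diag_mx (\row_a (D ord0 a)^-1).
have DDV : diag_mx D *m DV = 1%:M.
  apply/matrixP => a b; rewrite mul_diag_mx !mxE.
  by case: eqP => [->|_]; rewrite ?mulr0// mulr1n divff// gt_eqF.
have DVD := mulmx1C DDV.
have gE : dopt_gram r Z = diag_mx D *m G *m diag_mx D.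
  by rewrite /G -/DV !mulmxA DDV mul1mx -mulmxA DVD mulmx1.
have uDV : DV \in unitmx by have [] := mulmx1_unit DDV.
have uD : diag_mx D \in unitmx by have [] := mulmx1_unit DDV.
have ug : dopt_gram r Z \in unitmx by rewrite gE unitmx_mul (unitmx_mul _ G) uD uGG.
have us : uniq (dopt_select r Z) by case: bl.
move=> a b; have -> : (diag_mx D *m dopt_weights r Z) *m (diag_mx D *m dopt_weights r Z)^T = invmx G.
  rewrite trmx_mul tr_diag_mx mulmxA -(mulmxA (diag_mx D)) dopt_weights_gram//.
  apply: (can_inj (mulKmx uGG)); rewrite mulmxV//.
  rewrite {1}/G -/DV -!mulmxA (mulmxA DV (diag_mx D)) DVD mul1mx.
  rewrite (mulmxA (dopt_design r Z)^T) -/(dopt_gram r Z) (mulmxA (dopt_gram r Z)).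
  by rewrite mulmxV// mul1mx DVD.
by rewrite (le_trans (E a b))// mulrA.
Qed.

End DOptimalCovariance.

(** * Extremes and their concomitants *)

Section ExceedanceCounts.
Context {d d' : measure_display} {T : measurableType d} {T' : measurableType d'}.
Context {R : realType} (P : probability T R) (z : nat -> {RV P >-> T'}).
Context (z_indep : mutually_independent z).

Lemma measurable_preimage_RV i (E : set T') : measurable E -> measurable (z i @^-1` E).
Proof. by move=> mE; rewrite -[X in measurable X]setTI; exact: measurable_funPT. Qed.

(* One exceedance in each of [K] disjoint blocks gives [K] exceedances. *)
Lemma exceedance_count (K n : nat) (E : set T') (q : R) : measurable E ->
  (forall i, P (z i @^-1` E) = q%:E) ->
  exists N, [/\ measurable N, (P N <= (K%:R * (1 - q) ^+ (n %/ K))%:E)%E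
    & forall w, ~ N w -> (K <= count (fun i => z i w \in E) (iota 0 n))%N].
Proof.
move=> mE qE; set m := (n %/ K)%N.
pose B b := \big[setI/setT]_(i <- iota (b * m) m) (z i @^-1` (~` E)).
have mB b : measurable (B b).
  by apply: measurable_bigsetI => i; apply: measurable_preimage_RV; exact: measurableC.
have PB b : P (B b) = ((1 - q) ^+ m)%:E.
  rewrite /B z_indep ?iota_uniq//; last by move=> i _; exact: measurableC.
  have qC i : P (z i @^-1` (~` E)) = (1 - q)%:E.
    rewrite preimage_setC probability_setC ?qE//; exact: measurable_preimage_RV.
  under eq_bigr do rewrite qC.
  elim: m {B mB} (b * m)%N => [|k IH] a; first by rewrite big_nil expr0.
  by rewrite /= big_cons IH -EFinM exprS.
exists (\big[setU/set0]_(b <- iota 0 K) B b); split.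
- exact: measurable_bigsetU.
- apply: (le_trans (@union_bound _ _ _ P _ (iota 0 K) _ B _ mB _)).
  + exact: measurable_bigsetU.
  + by move=> w /bigsetU_seqP.
  + under eq_bigr do rewrite PB.
    rewrite sumEFin big_const_seq count_predT size_iota iter_addr addr0.
    by rewrite mulr_natl.
- move=> w Nw; have hb b : (b < K)%N -> has (fun i => z i w \in E) (iota (b * m) m).
    move=> bK; apply: contrapT => /negP; rewrite -all_predC => /allP h.
    apply: Nw; apply/bigsetU_seqP; exists b; first by rewrite mem_iota.
    by apply/bigsetI_seqP => i /h /=; rewrite notin_setE.
  have cK k : (k <= K)%N -> (k <= count (fun i => z i w \in E) (iota 0 (k * m)))%N.
    elim: k => // k IH kK; rewrite mulSn addnC iotaD count_cat add0n -addn1.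
    by apply: leq_add; [exact/IH/ltnW|rewrite -has_count; exact: hb].
  apply: (leq_trans (cK K (leqnn _))).
  have Kn : (K * m <= n)%N by rewrite mulnC leq_divM.
  by rewrite -(subnKC Kn) iotaD count_cat leq_addr.
Qed.

End ExceedanceCounts.

(** * Normal tails near the level sqrt (2 log n) *)

Section ExtremeLevels.
Context {R : realType}.
Implicit Types (n : nat) (e : R).

(** Chosen so that [n] is the inverse of the Gaussian factor [expR (- t n ^+ 2 / 2)]. *)
Definition extreme_level n : R := Num.sqrt (2 * ln n%:R).
Local Notation t := extreme_level.

Lemma extreme_level_ge0 n : 0 <= t n.
Proof. exact: sqrtr_ge0. Qed.

Lemma natr_extreme_level n : (0 < n)%N -> n%:R = expR (t n ^+ 2 / 2).
Proof.
move=> n0; have l0 : 0 <= ln (n%:R : R) by rewrite ln_ge0// ler1n.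
rewrite sqr_sqrtr ?mulr_ge0// mulrAC divff// mul1r lnK// posrE ltr0n//.
Qed.

Lemma near_extreme_level_ge e : \forall n \near \oo, e <= t n.
Proof.
near=> n.
have n0 : (0 < n)%N by near: n; exact: nbhs_infty_gt.
have : expR (e ^+ 2 / 2) <= n%:R by near: n; exact: nbhs_infty_ger.
rewrite (natr_extreme_level n0) ler_expR ler_pM2r ?invr_gt0// => h.
have [e0|e0] := ltP e 0; first by rewrite ltW// (lt_le_trans e0) ?extreme_level_ge0.
by move: h; rewrite ler_pXn2r ?nnegrE ?extreme_level_ge0.
Unshelve. all: by end_near. Qed.

(** The factor [n] cancels the square of [t n] in the exponent, leaving
    [- (t n * e) - e ^+ 2 / 2]. *)
Lemma normal_tail_level_le n e : (0 < n)%N -> 0 <= e ->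
  n%:R * normal_tail (t n + e) <= expR (- (t n * e)).
Proof.
move=> n0 e0; have tp := extreme_level_ge0 n.
apply: (@le_trans _ _ (n%:R * expR (- (t n + e) ^+ 2 / 2))).
  by rewrite ler_wpM2l// normal_tail_le// addr_ge0.
rewrite (natr_extreme_level n0) -expRD ler_expR.
have := sqr_ge0 e; rewrite !expr2; lra.
Qed.

(** The slab of width [e / 2] starting at [t n - e] ends at [t n - e / 2], where [n] times the
    Gaussian factor is [expR (t n * e / 2 - e ^+ 2 / 8)]. The crude bound [x <= expR x] still grows
    without limit with [t n]. *)
Lemma normal_tail_level_ge n e : (0 < n)%N -> 0 < e -> e <= t n ->
  e / 2 * normal_peak 1 * (t n * e / 2 - e ^+ 2 / 8) <= n%:R * normal_tail (t n - e).
Proof.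
move=> n0 e0 et; have tp := extreme_level_ge0 n.
have h : e / 2 * normal_pdf 0 1 (t n - e + e / 2) <= normal_tail (t n - e).
  by apply: normal_tail_ge; [rewrite subr_ge0|rewrite divr_ge0// ltW].
apply: (@le_trans _ _ (n%:R * (e / 2 * normal_pdf 0 1 (t n - e + e / 2)))); last first.
  by rewrite ler_wpM2l.
rewrite normal_pdf01E natr_extreme_level//.
set y := - _ / 2; rewrite (_ : expR _ * _ = e / 2 * normal_peak 1 * 
  (expR (t n ^+ 2 / 2) * expR y)); last by ring.
rewrite ler_wpM2l ?mulr_ge0 ?normal_peak_ge0 ?divr_ge0 ?(ltW e0)//.
rewrite -expRD (_ : t n ^+ 2 / 2 + y = t n * e / 2 - e ^+ 2 / 8); last by rewrite /y; field.
by apply: (le_trans _ (expR_ge1Dx _)); rewrite lerDr.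
Qed.

Lemma normal_tail_antitone (x y : R) : x <= y -> normal_tail y <= normal_tail x.
Proof. by move=> /normal_tail_lipschitz/andP[]. Qed.

(** With [q = l / n] and [m = n %/ K], the power is at most [expR (- (m * q))], hence at most
    [1 / (m * q)]; rounding in the division costs the factor 2. *)
Lemma pow_one_sub_le (K n : nat) (l : R) : (0 < K)%N -> (K <= n)%N -> 0 < l -> l <= n%:R ->
  (1 - l / n%:R) ^+ (n %/ K) <= 2 * K%:R / l.
Proof.
move=> K0 Kn l0 ln.
have n0 : 0 < n%:R :> R by rewrite ltr0n (leq_trans K0).
have q1 : l / n%:R <= 1 by rewrite ler_pdivrMr// mul1r.
apply: (@le_trans _ _ (expR (- (l / n%:R)) ^+ (n %/ K))).
  rewrite lerXn2r ?nnegrE ?subr_ge0// ?expR_ge0//.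
  by rewrite (le_trans _ (expR_ge1Dx _)).
rewrite -expRM_natl mulrN expRN.
have m1 : n%:R <= 2 * K%:R * (n %/ K)%:R :> R.
  rewrite -!natrM ler_nat.
  have d1 : (0 < n %/ K)%N by rewrite divn_gt0.
  rewrite {1}(divn_eq n K) mulnC -mulnA mul2n -addnn leq_add2l.
  by rewrite (leq_trans (ltnW (ltn_pmod n K0)))// leq_pmulr.
have k0 : 0 < K%:R :> R by rewrite ltr0n.
rewrite -[leRHS]invrK lef_pV2 ?posrE ?expR_gt0 ?invr_gt0 ?divr_gt0 ?mulr_gt0//.
apply: (le_trans _ (expR_ge1Dx _)).
apply: (@le_trans _ _ ((n %/ K)%:R * (l / n%:R))); last by rewrite lerDr.
rewrite invf_div ler_pdivrMr ?mulr_gt0//.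
rewrite (_ : _ * _ * _ = l * (2 * K%:R * (n %/ K)%:R / n%:R)); last by ring.
by rewrite ler_peMr ?(ltW l0)// ler_pdivlMr// mul1r.
Qed.

End ExtremeLevels.

Section ExtremesAndConcomitants.
Context {d d' : measure_display} {T : measurableType d} {T' : measurableType d'}.
Context {R : realType} (P : probability T R) (z : nat -> {RV P >-> T'}).
Context (z_indep : mutually_independent z) (p : nat) (p_gt0 : (0 < p)%N).
Context (S : 'I_p -> T' -> R) (rho : 'M[R]_p).
Local Notation t := (@extreme_level R).
Local Notation N01 := (@normal_prob R 0 1).

(** A sign that lets the smallest values of [S] be treated as the largest values of [- S]. *)
Definition sgb (s : bool) : R := if s then 1 else -1.

Context (mS : forall j, measurable_fun setT (S j)).
Context (S_law : forall i j s c,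
  P [set w | c < sgb s * S j (z i w)] = (normal_tail c)%:E).
Context (S_pair : forall i j l s c M, 0 <= M ->
  (P [set w | (c < sgb s * S j (z i w)) /\
              (2 * p%:R * M < `|S l (z i w) - rho j l * S j (z i w)|)]%R
   <= p%:R%:E * ((normal_tail c)%:E * N01 [set x | M < `|x|]%R))%E).

Lemma measurable_exceed (j : 'I_p) (s : bool) (c : R) : measurable [set x | c < sgb s * S j x].
Proof.
have mf : measurable_fun setT (fun x => sgb s * S j x) by exact: measurable_funM.
rewrite (_ : [set _ | _] = (fun x => sgb s * S j x) @^-1` `]c, +oo[%classic).
  by rewrite -[X in measurable X]setTI; exact: mf.
by apply/seteqP; split=> x /=; rewrite in_itv/= andbT.
Qed.

Lemma measurable_concomitant (j l : 'I_p) (s : bool) (c M : R) :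
  measurable [set x | (c < sgb s * S j x) /\ (M < `|S l x - rho j l * S j x|)].
Proof.
rewrite (_ : [set _ | _] = [set x | c < sgb s * S j x] `&`
  [set x | M < `|S l x - rho j l * S j x|])//.
apply: measurableI; first exact: measurable_exceed.
apply: (@measurable_fun_abs_gt _ T' R (fun x => S l x - rho j l * S j x)).
by apply: measurable_funB => //; exact: measurable_funM.
Qed.

Let idx := [seq (j, s) | j <- enum 'I_p, s <- [:: true; false]].

Let size_idx : size idx = (2 * p)%N.
Proof. by rewrite size_allpairs size_enum_ord mulnC. Qed.

Let mem_idx j s : (j, s) \in idx.
Proof. by apply: allpairs_f; rewrite ?mem_enum//; case: s. Qed.

Lemma sum_le_const (I : Type) (r : seq I) (F : I -> \bar R) (e : R) :
  (forall i, F i <= e%:E)%E -> (\sum_(i <- r) F i <= ((size r)%:R * e)%:E)%E.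
Proof.
move=> h; elim: r => [|i r IH]; first by rewrite big_nil mul0r.
by rewrite big_cons -natr1 mulrDl mul1r addrC EFinD leeD.
Qed.

(** For each of the [2 * p] directions there are three bad events, each of probability at most
    [e / (6 * p)]: too few exceedances of [c] ([NA]), a value above [t n + del] ([NB]), an
    exceedance with a large residual ([NC]). The last one depends on [n] only through the expected
    number [lam] of exceedances, which is why [M] precedes [del]. *)
Lemma extremes_concomitants (K : nat) (e : R) : (0 < K)%N -> 0 < e ->
  exists2 M, 0 <= M & forall del, 0 < del -> \forall n \near \oo,
  exists N, [/\ measurable N, (P N <= e%:E)%E & forall w, ~ N w ->
    exists c, [/\ t n - del <= c, 0 <= c,
      forall j s, (K <= count (fun i => (c < sgb s * S j (z i w))%R) (iota 0 n))%N,
      forall i j s, (i < n)%N -> sgb s * S j (z i w) <= t n + del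
    & forall i j s l, (i < n)%N -> c < sgb s * S j (z i w) ->
        `|S l (z i w) - rho j l * S j (z i w)| <= M]].
Proof.
move=> K0 e0.
have p0 : 0 < p%:R :> R by rewrite ltr0n.
have k0 : 0 < K%:R :> R by rewrite ltr0n.
have [lam lamE] : exists lam : R, lam = 12 * p%:R * K%:R * K%:R / e by eexists.
have lam0 : 0 < lam by rewrite lamE divr_gt0// !mulr_gt0.
(* Of the three factors [p], one is the share of the direction, one pays for the union over [l] and
   one for the factor in [S_pair]; [lam] pays for the exceedances. *)
have e10 : 0 < e / (6 * p%:R * p%:R * p%:R * lam) by rewrite divr_gt0// !mulr_gt0.
have [M0 M00 tM0] := normal_abs_tail e10.
exists (2 * p%:R * M0); first by rewrite !mulr_ge0.
move=> del del0.
have pk0 : 0 < normal_peak (1 : R) by rewrite normal_peak_gt0 ?oner_neq0.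
near=> n.
have n0 : (0 < n)%N by near: n; exact: nbhs_infty_gt.
have nr0 : 0 < n%:R :> R by rewrite ltr0n.
have Kn : (K <= n)%N by near: n; exact: nbhs_infty_ge.
have ln : lam <= n%:R by near: n; exact: nbhs_infty_ger.
have lphi : lam / normal_pdf 0 1 1 <= n%:R by near: n; exact: nbhs_infty_ger.
have tdel : del <= t n by near: n; exact: near_extreme_level_ge.
(* [tmax] makes [expR (- (t n * del))] at most [e / (6 * p)]; [tlow] makes
   [n * normal_tail (t n - del)] larger than [lam], which forces [t n - del <= c]. *)
have tmax : 6 * p%:R / (e * del) <= t n by near: n; exact: near_extreme_level_ge.
have tlow : (lam / (del / 2 * normal_peak 1) + del ^+ 2 / 8) * (2 / del) + 1 <= t n.
  by near: n; exact: near_extreme_level_ge.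
have phi0 : 0 < normal_pdf (0 : R) 1 1.
  by rewrite normal_pdf01E mulr_gt0// expR_gt0.
have [c c0 qc] : exists2 c, 0 <= c & normal_tail c = lam / n%:R.
  apply: normal_threshold; first by rewrite divr_gt0.
  by rewrite ler_pdivrMr// mulrC -ler_pdivrMr.
have cge : t n - del <= c.
  rewrite leNgt; apply/negP => clt.
  have := normal_tail_antitone (ltW clt); rewrite qc.
  have := normal_tail_level_ge n0 del0 tdel.
  rewrite ler_pdivlMr// => h1 h2; have := le_trans h1 (_ : _ <= lam).
  rewrite mulrC h2 => /(_ isT); apply/negP; rewrite -ltNge.
  rewrite mulrC -ltr_pdivrMr ?mulr_gt0 ?divr_gt0//.
  set A := lam / _; have : A + del ^+ 2 / 8 < t n * (del / 2).
    rewrite -ltr_pdivrMr ?divr_gt0// invf_div; apply: lt_le_trans tlow.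
    by rewrite ltrDl.
  by move=> h; rewrite mulrA in h; lra.
have qq i j s : P (z i @^-1` [set x | c < sgb s * S j x]) = (lam / n%:R)%:E.
  by rewrite -qc -(S_law i j s c).
pose NA (js : 'I_p * bool) := projT1 (cid (exceedance_count z_indep K n
   (measurable_exceed js.1 js.2 c) (fun i => qq i js.1 js.2))).
have NAP js := projT2 (cid (exceedance_count z_indep K n
   (measurable_exceed js.1 js.2 c) (fun i => qq i js.1 js.2))).
pose NB (js : 'I_p * bool) := \big[setU/set0]_(i <- iota 0 n)
   (z i @^-1` [set x | t n + del < sgb js.2 * S js.1 x]).
pose NC (js : 'I_p * bool) := \big[setU/set0]_(i <- iota 0 n) \big[setU/set0]_(l <- enum 'I_p)
   (z i @^-1` [set x | (c < sgb js.2 * S js.1 x) /\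
      (2 * p%:R * M0 < `|S l x - rho js.1 l * S js.1 x|)]).
have mNA js : measurable (NA js) by have [] := NAP js.
have mNB js : measurable (NB js).
  by apply: measurable_bigsetU => i; apply: measurable_preimage_RV; exact: measurable_exceed.
have mNC js : measurable (NC js).
  apply: measurable_bigsetU => i; apply: measurable_bigsetU => l.
  by apply: measurable_preimage_RV; exact: measurable_concomitant.
have PNA js : (P (NA js) <= (e / (6 * p%:R))%:E)%E.
  have [_ h _] := NAP js; apply: (le_trans h); rewrite lee_fin.
  have := pow_one_sub_le K0 Kn lam0 ln.
  move=> /(ler_wpM2l (ltW k0)) /le_trans; apply.
  rewrite le_eqVlt; apply/orP; left; apply/eqP; rewrite lamE; field.
  by rewrite !gt_eqF.
have PNB js : (P (NB js) <= (e / (6 * p%:R))%:E)%E.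
  apply: (le_trans (@union_bound _ _ _ P _ (iota 0 n) _
    (fun i => z i @^-1` [set x | t n + del < sgb js.2 * S js.1 x]) (mNB js) _ _)).
  - by move=> i; apply: measurable_preimage_RV; exact: measurable_exceed.
  - by move=> w /bigsetU_seqP.
  apply: (le_trans (@sum_le_const _ _ _ (normal_tail (t n + del)) _)).
    by move=> i; rewrite -(S_law i js.1 js.2).
  rewrite lee_fin size_iota (le_trans (normal_tail_level_le n0 (ltW del0)))//.
  rewrite expRN -[leRHS]invrK lef_pV2 ?posrE ?expR_gt0 ?invr_gt0 ?divr_gt0 ?mulr_gt0//.
  apply: (le_trans _ (expR_ge1Dx _)); rewrite invf_div.
  move: tmax; rewrite invfM mulrA ler_pdivrMr// => h.
  by apply: (le_trans h); rewrite lerDr.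
have PNC js : (P (NC js) <= (e / (6 * p%:R))%:E)%E.
  apply: (le_trans (@union_bound _ _ _ P _ (iota 0 n) _
    (fun i => \big[setU/set0]_(l <- enum 'I_p)
      (z i @^-1` [set x | (c < sgb js.2 * S js.1 x) /\
      (2 * p%:R * M0 < `|S l x - rho js.1 l * S js.1 x|)])) (mNC js) _ _)).
  - move=> i; apply: measurable_bigsetU => l.
    by apply: measurable_preimage_RV; exact: measurable_concomitant.
  - by move=> w /bigsetU_seqP.
  pose e1 := e / (6 * p%:R * p%:R * p%:R * lam).
  apply: (le_trans (@sum_le_const _ _ _ (p%:R * (p%:R * (lam / n%:R * e1))) _)).
    move=> i; apply: (le_trans (@union_bound _ _ _ P _ (enum 'I_p) _
      (fun l => z i @^-1` [set x | (c < sgb js.2 * S js.1 x) /\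
      (2 * p%:R * M0 < `|S l x - rho js.1 l * S js.1 x|)]) _ _ _)).
    - apply: measurable_bigsetU => l.
      by apply: measurable_preimage_RV; exact: measurable_concomitant.
    - by move=> l; apply: measurable_preimage_RV; exact: measurable_concomitant.
    - by move=> w /bigsetU_seqP.
    apply: (le_trans (@sum_le_const _ _ _ (p%:R * (lam / n%:R * e1)) _)).
      move=> l; apply: (le_trans (S_pair i js.1 l js.2 c M00)).
      have -> : (p%:R * (lam / n%:R * e1))%:E = (p%:R%:E * ((lam / n%:R)%:E * e1%:E))%E.
        by rewrite -!EFinM.
      rewrite qc; apply: lee_wpmul2l; first by rewrite lee_fin ltW.
      by apply: lee_wpmul2l => //; rewrite lee_fin divr_ge0// ltW.
    by rewrite size_enum_ord.
  rewrite size_iota lee_fin le_eqVlt; apply/orP; left; apply/eqP.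
  by rewrite /e1; field; rewrite !gt_eqF.
exists (\big[setU/set0]_(js <- idx) (NA js `|` (NB js `|` NC js))).
have mN js : measurable (NA js `|` (NB js `|` NC js)).
  by do 2 apply: measurableU => //.
split.
- exact: measurable_bigsetU.
- apply: (le_trans (@union_bound _ _ _ P _ idx _
    (fun js => NA js `|` (NB js `|` NC js)) _ mN _)).
  + exact: measurable_bigsetU.
  + by move=> w /bigsetU_seqP.
  apply: (le_trans (@sum_le_const _ _ _ (3 * (e / (6 * p%:R))) _)).
    move=> js; apply: (le_trans (measureU2 _ _ _)) => //; first exact: measurableU.
    rewrite (_ : 3 * _ = e / (6 * p%:R) + (e / (6 * p%:R) + e / (6 * p%:R))); last by ring.
    rewrite !EFinD; apply: leeD; first exact: PNA.
    apply: (le_trans (measureU2 _ _ _)) => //.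
    by apply: leeD; [exact: PNB|exact: PNC].
  rewrite size_idx lee_fin natrM le_eqVlt; apply/orP; left; apply/eqP.
  by field; rewrite gt_eqF.
- move=> w Nw.
  have nA js : js \in idx -> ~ NA js w.
    by move=> ji h; apply: Nw; apply/bigsetU_seqP; exists js => //; left.
  have nB js : js \in idx -> ~ NB js w.
    by move=> ji h; apply: Nw; apply/bigsetU_seqP; exists js => //; right; left.
  have nC js : js \in idx -> ~ NC js w.
    by move=> ji h; apply: Nw; apply/bigsetU_seqP; exists js => //; right; right.
  exists c; split=> //.
  + move=> j s; have [_ _ h] := NAP (j, s); have := h w (nA _ (mem_idx j s)).
    move=> /leq_trans; apply; apply: eq_leq; apply: eq_count => i /=.
    by apply/idP/idP; rewrite ?inE//= => ?; rewrite inE.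
  + move=> i j s iln; rewrite leNgt; apply/negP => h.
    apply: (nB _ (mem_idx j s)); apply/bigsetU_seqP; exists i => //.
    by rewrite mem_iota.
  + move=> i j s l iln cS; rewrite leNgt; apply/negP => h.
    apply: (nC _ (mem_idx j s)); apply/bigsetU_seqP; exists i; first by rewrite mem_iota.
    by apply/bigsetU_seqP; exists l; rewrite ?mem_enum.
Unshelve. all: by end_near. Qed.

End ExtremesAndConcomitants.

(** * Conditional covariance of the estimator *)

Section MatrixMeasurability.
Context {d : measure_display} {T : measurableType d} {R : realType} (G : set (set T)).
Context (HG : sigma_algebra setT G).
Local Notation gmeas := (@gmeas d T R G).

Lemma gsetE (A : set T) : G A <-> measurable (A : set (g_sigma_algebraType G)).
Proof.
split=> [GA|mA]; first exact: sub_sigma_algebra.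
by rewrite -(sigma_algebra_id HG).
Qed.

Lemma gmeas_prod I (s : seq I) (h : I -> T -> R) : (forall i, gmeas (h i)) ->
  gmeas (fun w => \prod_(i <- s) h i w).
Proof.
move=> gh; elim: s => [|i s IH].
  by under eq_fun do rewrite big_nil; exact: gmeas_cst.
by under eq_fun do rewrite big_cons; exact: gmeasM.
Qed.

Lemma gmeas_indic (A : set T) : G A -> gmeas (\1_A).
Proof. by move=> /gsetE mA; apply/gmeasE => //; exact: measurable_indic. Qed.

(* [x^-1 = x (x^2)^-1] also at [x = 0], and [powR] is measurable. *)
Lemma gmeasV (h : T -> R) : gmeas h -> gmeas (fun w => (h w)^-1).
Proof.
move=> gh; have -> : (fun w => (h w)^-1) = fun w => h w * (h w * h w) `^ (-1).
  apply/funext => w; rewrite -expr2 powR_inv1 ?sqr_ge0//.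
  have [->|h0] := eqVneq (h w) 0; first by rewrite invr0 mul0r.
  by rewrite expr2; field.
apply: gmeasM => //; have /(gmeasE HG) m2 := gmeasM HG gh gh.
by apply/(gmeasE HG); apply: (measurableT_comp (f := fun x : R => x `^ (-1)) _ m2);
  exact: measurable_powR.
Qed.

(** Finitely many cases, each decided by an event of [G]: this serves the singular branch of [invmx]
    and the list of selected points. *)
Lemma gmeas_fin (I : finType) (c : T -> I) (h : I -> T -> R) :
  (forall i, G [set w | c w = i]) -> (forall i, gmeas (h i)) ->
  gmeas (fun w => h (c w) w).
Proof.
move=> Gc gh; have -> : (fun w => h (c w) w) =
    fun w => \sum_i (\1_[set w | c w = i] w * h i w).
  apply/funext => w; rewrite (bigD1 (c w))//= big1 => [|i ic].
    by rewrite indicE mem_set// mul1r addr0.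
  by rewrite indicE memNset ?mul0r// => /= ci; rewrite ci eqxx in ic.
by apply: gmeas_sum => // i; apply: gmeasM => //; exact: gmeas_indic.
Qed.

Definition mxmeas m n (M : T -> 'M[R]_(m, n)) := forall a b, gmeas (fun w => M w a b).

Lemma mxmeas_cst m n (A : 'M[R]_(m, n)) : mxmeas (fun=> A).
Proof. by move=> a b; exact: gmeas_cst. Qed.

Lemma mxmeasM m n q (A : T -> 'M[R]_(m, n)) (B : T -> 'M[R]_(n, q)) :
  mxmeas A -> mxmeas B -> mxmeas (fun w => A w *m B w).
Proof.
move=> mA mB a b; under eq_fun do rewrite mxE.
by apply: gmeas_sum => // k; exact: gmeasM.
Qed.

Lemma mxmeas_tr m n (A : T -> 'M[R]_(m, n)) : mxmeas A -> mxmeas (fun w => (A w)^T).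
Proof. by move=> mA a b; under eq_fun do rewrite mxE; exact: mA. Qed.

Lemma gmeas_det n (A : T -> 'M[R]_n) : mxmeas A -> gmeas (fun w => \det (A w)).
Proof.
move=> mA; apply: gmeas_sum => // s; apply: gmeasM => //; first exact: gmeas_cst.
by apply: gmeas_prod => i; exact: mA.
Qed.

Lemma mxmeas_adj n (A : T -> 'M[R]_n) : mxmeas A -> mxmeas (fun w => \adj (A w)).
Proof.
move=> mA a b; under eq_fun do rewrite mxE.
apply: gmeasM => //; first exact: gmeas_cst.
apply: gmeas_det => i j; under eq_fun do rewrite !mxE.
exact: mA.
Qed.

Lemma mxmeas_inv n (A : T -> 'M[R]_n) : mxmeas A -> mxmeas (fun w => invmx (A w)).
Proof.
move=> mA a b.
(* By convention [invmx] returns its argument when that is singular, and this branch has to be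
   measurable too. *)
pose h (c : bool) w := if c then (\det (A w))^-1 * \adj (A w) a b else A w a b.
have -> : (fun w => invmx (A w) a b) = fun w => h (\det (A w) != 0) w.
  apply/funext => w; rewrite /invmx /h unitmxE unitfE.
  by case: ifP => //; rewrite mxE.
have G0 : G [set w | \det (A w) = 0].
  exact: (gmeas_det mA (measurable_set1 0)).
apply: (@gmeas_fin _ (fun w => \det (A w) != 0) h) => -[] /=.
- rewrite (_ : [set _ | _] = ~` [set w | \det (A w) = 0]).
    by apply/gsetE; apply: measurableC; exact/gsetE.
  by apply/seteqP; split=> w /= => [/eqP|/eqP ->].
- rewrite (_ : [set _ | _] = [set w | \det (A w) = 0])//.
  by apply/seteqP; split=> w /= => [/negbFE/eqP|->]//; rewrite eqxx.
- by apply: gmeasM => //; [exact/gmeasV/gmeas_det|exact: mxmeas_adj].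
- exact: mA.
Qed.

Lemma mxmeas_design m p (Z : T -> 'M[R]_(m, p)) : mxmeas Z ->
  mxmeas (fun w => design (Z w)).
Proof.
move=> mZ a b; rewrite /design; under eq_fun do rewrite mxE.
case: (fintype.split b) => c; last exact: mZ.
by under eq_fun do rewrite mxE; exact: gmeas_cst.
Qed.

Lemma mxmeas_rowsub m m' p (f : 'I_m' -> 'I_m) (Z : T -> 'M[R]_(m, p)) : mxmeas Z ->
  mxmeas (fun w => rowsub f (Z w)).
Proof. by move=> mZ a b; under eq_fun do rewrite mxE; exact: mZ. Qed.

Section Weights.
Context (n p r : nat).

Definition subdata_weights (s : seq 'I_n) (Z : 'M[R]_(n, p)) : 'M[R]_(1 + p, n) :=
  let f := tnth (in_tuple s) in let X := design (rowsub f Z) in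
  invmx (X^T *m X) *m X^T *m rowsub f 1%:M.

(** The algorithm sees the covariates only through pairwise comparisons. Run on a table of them, it
    is a function on a finite type, so the selected list is constant on each of finitely many events
    determined by the covariates. *)
Definition select_by (c : {ffun 'I_n * 'I_n * 'I_p -> bool}) : seq 'I_n :=
  (foldl (fun (st : seq 'I_n * seq 'I_n) j =>
    let s := sort (fun a b => c (a, b, j)) st.2 in
    (st.1 ++ take r s ++ drop (size s - r) s,
     drop r (take (size s - r) s))) ([::], enum 'I_n) (enum 'I_p)).1.

Definition comparisons (Z : 'M[R]_(n, p)) : {ffun 'I_n * 'I_n * 'I_p -> bool} :=
  [ffun x => Z x.1.1 x.2 <= Z x.1.2 x.2].

Lemma dopt_select_by Z : dopt_select r Z = select_by (comparisons Z).
Proof.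
rewrite /dopt_select /select_by; congr (foldl _ _ _).1.
apply/funext => st; apply/funext => j; rewrite /dopt_step.
by under [in RHS]eq_fun2 => a b do rewrite ffunE /=.
Qed.

Lemma mxmeas_dopt_weights (Z : T -> 'M[R]_(n, p)) : mxmeas Z ->
  mxmeas (fun w => dopt_weights r (Z w)).
Proof.
move=> mZ a b.
have -> : (fun w => dopt_weights r (Z w) a b) =
    fun w => subdata_weights (select_by (comparisons (Z w))) (Z w) a b.
  by apply/funext => w; rewrite -dopt_select_by.
apply: (@gmeas_fin _ (fun w => comparisons (Z w))
  (fun c w => subdata_weights (select_by c) (Z w) a b)) => c; last first.
  have mX := mxmeas_design (mxmeas_rowsub (tnth (in_tuple (select_by c))) mZ).
  apply: mxmeasM; last exact: mxmeas_cst.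
  apply: mxmeasM; last exact: mxmeas_tr.
  by apply: mxmeas_inv; apply: mxmeasM => //; exact: mxmeas_tr.
have -> : [set w | comparisons (Z w) = c] =
   \big[setI/setT]_(x <- enum (('I_n * 'I_n * 'I_p)%type : finType))
      [set w | (Z w x.1.1 x.2 <= Z w x.1.2 x.2) = c x].
  apply/seteqP; split=> w /= h.
    by apply/bigsetI_seqP => x _ /=; rewrite -h ffunE.
  apply/ffunP => x; rewrite ffunE.
  by move/bigsetI_seqP: h => /(_ x); rewrite mem_enum => /(_ isT).
apply/gsetE; apply: measurable_bigsetI => x; apply/gsetE.
have G1 : G [set w | Z w x.1.1 x.2 <= Z w x.1.2 x.2].
  rewrite (_ : [set _ | _] = [set w | Z w x.1.1 x.2 - Z w x.1.2 x.2 <= 0]).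
    by apply: (gset_ge 0); exact: gmeasB.
  by apply/seteqP; split=> w /=; rewrite subr_le0.
case: (c x).
- rewrite (_ : [set _ | _] = [set w | Z w x.1.1 x.2 <= Z w x.1.2 x.2])//.
- rewrite (_ : [set _ | _] = ~` [set w | Z w x.1.1 x.2 <= Z w x.1.2 x.2]).
    by apply/gsetE; apply: measurableC; exact/gsetE.
  by apply/seteqP; split=> w /= => [->|/negP/negbTE].
Qed.

End Weights.

End MatrixMeasurability.

Section ConditionalCovariance.
Context {d : measure_display} {T : measurableType d} {R : realType}.
Context (P : probability T R) (p r : nat).
Context (z : nat -> {RV P >-> p.-tuple R}) (eps : nat -> {RV P >-> R}).
Context (beta : 'cV[R]_(1 + p)) (sigma : R).
Context (eps_err : homoscedastic_errors z eps sigma).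

Lemma sigma_algebra_sigmaZ n : sigma_algebra setT (sigmaZ z n).
Proof.
apply: sigma_algebra_preimage; exact: sigma_algebra_measurable.
Qed.

Lemma sigmaZ_measurable n : sigmaZ z n `<=` measurable.
Proof.
move=> A [B mB <-]; rewrite setTI -[X in measurable X]setTI.
have mf : measurable_fun setT (fun w => [tuple z i w | i < n]).
  apply/measurable_fun_tnthP => i.
  rewrite (_ : _ \o _ = z i); first exact: measurable_funPT.
  by apply/funext => w /=; rewrite tnth_mktuple.
exact: mf.
Qed.

Lemma mxmeas_covmx n : mxmeas (sigmaZ z n) (fun w => covmx z n w).
Proof.
move=> i j B mB; under eq_fun do rewrite mxE.
have m1 : measurable_fun setT (fun x : n.-tuple (p.-tuple R) => tnth (tnth x i) j).
  apply: (measurableT_comp (f := fun y : p.-tuple R => tnth y j)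
    (g := fun x : n.-tuple (p.-tuple R) => tnth x i)).
    exact: measurable_tnth.
  exact: measurable_tnth.
exists ((fun x : n.-tuple (p.-tuple R) => tnth (tnth x i) j) @^-1` B).
  by rewrite -[X in measurable X]setTI; exact: m1.
by rewrite setTI; apply/seteqP; split=> w /=; rewrite tnth_mktuple.
Qed.

(** The estimator is the weight matrix, a function of the covariates, applied to a response that is
    linear in the errors. Stated with the weights, the formula also holds where the Gram matrix is
    singular. Measurability is recorded because deviations of the chosen version have to be
    events. *)
Lemma condcov_mx_betaD n (D : 'rV[R]_(1 + p)) a b :
  measurable_fun setT (fun w => condcov_mx P (sigmaZ z n)
     (fun v => diag_mx D *m betaD z eps r beta n v) w a b) /\
  {ae P, forall w, condcov_mx P (sigmaZ z n)
     (fun v => diag_mx D *m betaD z eps r beta n v) w a b =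
     sigma ^+ 2 * ((diag_mx D *m dopt_weights r (covmx z n w)) *m
                   (diag_mx D *m dopt_weights r (covmx z n w))^T) a b}.
Proof.
pose H w := diag_mx D *m dopt_weights r (covmx z n w).
have HG := sigma_algebra_sigmaZ n; have Gm := @sigmaZ_measurable n.
have mZ := @mxmeas_covmx n.
have mH : mxmeas (sigmaZ z n) H.
  by apply: mxmeasM => //; [exact: mxmeas_cst|exact: mxmeas_dopt_weights].
pose g w := H w *m (design (covmx z n w) *m beta).
have mg : mxmeas (sigmaZ z n) g.
  apply: mxmeasM => //; apply: mxmeasM => //; first exact: mxmeas_design.
  exact: mxmeas_cst.
have XE c w : (diag_mx D *m betaD z eps r beta n w) c ord0 =
    g w c ord0 + \sum_i H w c i * eps i w.
  rewrite /betaD dopt_olsE mulmxA -/(H w) /response mulmxDr mxE -/(g w).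
  congr (_ + _); rewrite [LHS]mxE; apply: eq_bigr => i _; congr (_ * _); exact: mxE.
have e0 (i : 'I_n) : is_condexp P (sigmaZ z n) (eps i) (cst 0).
  by have [] := @eps_err n i i (ltn_ord i) (ltn_ord i).
have e2 (i j : 'I_n) : is_condexp P (sigmaZ z n) (fun w => eps i w * eps j w)
    (cst (if i == j then sigma ^+ 2 else 0)).
  by have [_] := @eps_err n i j (ltn_ord i) (ltn_ord j).
have me (i : 'I_n) : measurable_fun setT (eps i) by exact: measurable_funPT.
have C := is_condcov_linear HG Gm me e0 e2 (mg a ord0) (fun i => mH a i)
   (mg b ord0) (fun i => mH b i) (XE a) (XE b).
have cE : (fun w => condcov_mx P (sigmaZ z n)
     (fun v => diag_mx D *m betaD z eps r beta n v) w a b) =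
   condexp P (sigmaZ z n) (fun w =>
     ((diag_mx D *m betaD z eps r beta n w) a ord0 -
       condexp P (sigmaZ z n) (fun v => (diag_mx D *m betaD z eps r beta n v) a ord0) w) *
     ((diag_mx D *m betaD z eps r beta n w) b ord0 -
       condexp P (sigmaZ z n) (fun v => (diag_mx D *m betaD z eps r beta n v) b ord0) w)).
  by apply/funext => w; rewrite mxE.
rewrite cE; split.
  by apply: (gmeas_measurable Gm); case: (condexp_version C).
apply: filterS (condexpE HG Gm C) => w h.
move: (congr1 (fun f => f w) cE) => /= ->; rewrite h; congr (_ * _).
rewrite [RHS]mxE; apply: eq_bigr => i _; congr (_ * _); exact/esym/mxE.
Qed.

End ConditionalCovariance.

(** * Standardized covariates *)

Section CorrelationRows.
Context {R : realType} (p : nat) (sd : 'rV[R]_p) (rho A : 'M[R]_p).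
Context (sd_ge0 : forall j, 0 <= sd ord0 j).
Context (rho_corr : correlation_matrix rho).
Context (Sigma_full : diag_mx sd *m rho *m diag_mx sd \in unitmx).

Lemma sd_gt0 j : 0 < sd ord0 j.
Proof.
rewrite lt_neqAle sd_ge0 andbT eq_sym; apply/eqP => s0.
move: Sigma_full; rewrite unitmx_mul => /andP[_].
by rewrite unitmxE det_diag unitfE (bigD1 j)//= s0 mul0r eqxx.
Qed.

Lemma rho_unit : rho \in unitmx.
Proof. by move: Sigma_full; rewrite !unitmx_mul => /andP[/andP[]]. Qed.

Lemma rho_diag j : rho j j = 1.
Proof. by have [_ _] := rho_corr. Qed.

Lemma rho_symE j l : rho j l = rho l j.
Proof. by have [/matrixP/(_ l j) + _ _] := rho_corr; rewrite mxE. Qed.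

Context (AE : A *m A^T = diag_mx sd *m rho *m diag_mx sd).

(** The rows of [Phi^-1 A], coefficients of the standardized covariates in the independent normals.
    For any square root [A] they are unit vectors with Gram matrix [rho]. *)
Definition std_row j m : R := A j m / sd ord0 j.

Lemma std_row_inner j l : \sum_m std_row j m * std_row l m = rho j l.
Proof.
have /matrixP/(_ j l) := AE; rewrite mul_mx_diag !mxE.
under [in RHS]eq_bigr do rewrite !mxE.
rewrite [in RHS](bigD1 j)//= [X in _ = (_ + X) * _]big1 => [|i ij]; last first.
  by rewrite eq_sym (negbTE ij) mulr0n mul0r.
rewrite eqxx mulr1n addr0.
under eq_bigr do rewrite mxE.
move=> E; have sj := sd_gt0 j; have sl := sd_gt0 l.
transitivity ((\sum_m A j m * A l m) / (sd ord0 j * sd ord0 l)).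
  rewrite mulr_suml; apply: eq_bigr => m _; rewrite /std_row.
  by field; rewrite !gt_eqF.
by rewrite E; field; rewrite !gt_eqF.
Qed.

Lemma std_row_norm j : \sum_m std_row j m ^+ 2 = 1.
Proof. by rewrite -(rho_diag j) -std_row_inner; apply: eq_bigr => m _; rewrite expr2. Qed.

Lemma std_row_le1 j m : `|std_row j m| <= 1.
Proof.
rewrite -(ler_pXn2r (n := 2)) ?nnegrE// expr1n real_normK ?num_real//.
rewrite -(std_row_norm j) (bigD1 m)//= lerDl.
by apply: sumr_ge0 => i _; exact: sqr_ge0.
Qed.

Lemma std_row_dist j l (e : R) : e ^+ 2 = 1 ->
  \sum_m (std_row j m - e * std_row l m) ^+ 2 = 2 - 2 * e * rho j l.
Proof.
move=> e2; rewrite -std_row_inner.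
transitivity (\sum_m (std_row j m ^+ 2 + e ^+ 2 * std_row l m ^+ 2
   - 2 * e * (std_row j m * std_row l m))).
  by apply: eq_bigr => m _; ring.
by rewrite sumrB big_split /= -!mulr_sumr !std_row_norm e2; ring.
Qed.

Lemma corr_le1 j l : `|rho j l| <= 1.
Proof.
have h (e : R) : e ^+ 2 = 1 -> 0 <= 2 - 2 * e * rho j l.
  by move=> e2; rewrite -std_row_dist//; apply: sumr_ge0 => m _; exact: sqr_ge0.
have := h 1 (expr1n _ _); have := h (-1); rewrite sqrrN expr1n => /(_ erefl).
by rewrite ler_norml => ? ?; apply/andP; split; lra.
Qed.

(** Equality would make two standardized rows equal up to sign, and their difference would give a
    nonzero left null vector of the nonsingular [A]. Strictness is what makes exponentiated
    concomitants negligible. *)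
Lemma corr_lt1 j l : l != j -> `|rho j l| < 1.
Proof.
move=> lj; rewrite lt_neqAle corr_le1 andbT; apply/eqP => r1.
have [e e2 er] : exists2 e : R, e ^+ 2 = 1 & e * rho j l = 1.
  have [r0|r0] := lerP 0 (rho j l).
    by exists 1; rewrite ?expr1n// mul1r -r1 ger0_norm.
  by exists (-1); rewrite ?sqrrN ?expr1n// mulN1r -r1 ltr0_norm.
have E0 : \sum_m (std_row j m - e * std_row l m) ^+ 2 = 0.
  by rewrite std_row_dist// -mulrA er; ring.
pose v : 'rV[R]_p := \row_i ((i == j)%:R / sd ord0 j - e * ((i == l)%:R / sd ord0 l)).
have vA : v *m A = 0.
  apply/rowP => m; rewrite !mxE.
  transitivity (std_row j m - e * std_row l m).
    under eq_bigr do rewrite mxE mulrBl.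
    rewrite sumrB; congr (_ - _).
      rewrite (bigD1 j)//= eqxx big1 => [|i ij]; last by rewrite (negbTE ij) !mul0r.
      by rewrite addr0 /std_row mul1r mulrC.
    rewrite (bigD1 l)//= eqxx big1 => [|i il]; last by rewrite (negbTE il) mul0r mulr0 mul0r.
    by rewrite addr0 /std_row mul1r -mulrA; congr (_ * _); rewrite mulrC.
  move/eqP: E0; rewrite psumr_eq0; last by move=> i _; exact: sqr_ge0.
  by move=> /allP/(_ m (mem_index_enum _)); rewrite /= sqrf_eq0 => /eqP.
have uA : A \in unitmx by move: Sigma_full; rewrite -AE unitmx_mul => /andP[].
have v0 : v = 0 by rewrite -[v](mulmxK uA) vA mul0mx.
move/rowP: v0 => /(_ j); rewrite !mxE eqxx eq_sym (negbTE lj) mul0r mulr0 subr0.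
by move/eqP; rewrite mul1r invr_eq0 gt_eqF// sd_gt0.
Qed.

End CorrelationRows.

Lemma probability_le_ae d (T : measurableType d) (R : realType) (P : probability T R)
  (A B : set T) : measurable A -> measurable B ->
  {ae P, forall w, A w -> B w} -> (P A <= P B)%E.
Proof.
move=> mA mB [N [mN N0 AB]].
apply: (@le_trans _ _ (P (B `|` N))).
  apply: le_measure; rewrite ?inE//; first exact: measurableU.
  move=> w Aw; have [Bw|nBw] := pselect (B w); [by left|right].
  by apply: AB => /= h; apply: nBw; exact: h.
apply: (@le_trans _ _ (P B + P N)%E); first exact: measureU2.
by rewrite N0 adde0.
Qed.

Section StandardizedLaw.
Context {d : measure_display} {T : measurableType d} {R : realType}.
Context (P : probability T R) (p : nat).
Context (z : nat -> {RV P >-> p.-tuple R}) (z_id : identically_distributed z).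
Context (g : 'I_p -> {RV P >-> R}) (g_indep : mutually_independent g).
Context (g_law : forall j (B : set R), measurable B ->
  distribution P (g j) B = normal_prob 0 1 B).
Context (a : 'I_p -> 'I_p -> R) (rho : 'M[R]_p).
Context (a_inner : forall j l, \sum_m a j m * a l m = rho j l).
Context (rho_diag : forall j, rho j j = 1) (rho_le1 : forall j l, `|rho j l| <= 1).
Context (a_le1 : forall j m, `|a j m| <= 1).
Context (S : 'I_p -> p.-tuple R -> R) (mS : forall j, measurable_fun setT (S j)).
Context (S_comb : {ae P, forall w, forall j, S j (z 0%N w) = comb g (a j) w}).

(** The Gaussian representation is taken at index 0, and equality of laws carries probabilities of
    covariate events to every index. *)
Lemma probability_same_law i (E : set (p.-tuple R)) : measurable E ->
  P (z i @^-1` E) = P (z 0%N @^-1` E).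
Proof. exact: z_id. Qed.

Let sa j (s : bool) m := sgb s * a j m.

Let sa_comb j s w : sgb s * comb g (a j) w = comb g (sa j s) w.
Proof. by rewrite !comb_sum mulr_sumr; apply: eq_bigr => m _; rewrite mulrA. Qed.

Let sgb2 s : sgb s * sgb s = 1 :> R.
Proof. by case: s; rewrite /sgb ?mulr1// mulrNN mulr1. Qed.

Let sa1 j s : \sum_m sa j s m ^+ 2 = 1.
Proof.
rewrite -(rho_diag j) -a_inner; apply: eq_bigr => m _.
by rewrite /sa expr2 mulrACA sgb2 mul1r.
Qed.

Lemma standardized_law i j s c :
  P [set w | c < sgb s * S j (z i w)] = (normal_tail c)%:E.
Proof.
have mE := measurable_exceed mS j s c.
rewrite (_ : [set w | _] = z i @^-1` [set x | c < sgb s * S j x])// probability_same_law//.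
have mB : measurable (`]c, +oo[%classic : set R) by exact: measurable_itv.
rewrite -normal_tailE -(normal_comb g_indep g_law mB (sa1 j s)).
have m0 : measurable (z 0%N @^-1` [set x | c < sgb s * S j x]).
  exact: measurable_preimage_RV.
have mc : measurable (comb g (sa j s) @^-1` `]c, +oo[%classic).
  by apply: measurable_preimageR => //; exact: measurable_comb.
apply/eqP; rewrite eq_le; apply/andP; split; apply: probability_le_ae => //;
  apply: filterS S_comb => w h; rewrite /= in_itv/= andbT -sa_comb h//.
Qed.

(** The residual has coefficients [a l - rho j l * a j], orthogonal to [a j]; correlations and
    entries of unit vectors being at most 1 in absolute value, they are bounded by 2, as
    [normal_comb_tail] asks. *)
Lemma standardized_pair i j l s c M : 0 <= M ->
  (P [set w | (c < sgb s * S j (z i w)) /\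
              (2 * p%:R * M < `|S l (z i w) - rho j l * S j (z i w)|)]%R
   <= p%:R%:E * ((normal_tail c)%:E * normal_prob 0 1 [set x | M < `|x|]%R))%E.
Proof.
move=> M0; pose E := [set x | (c < sgb s * S j x) /\ (2 * p%:R * M < `|S l x - rho j l * S j x|)].
have mE : measurable E := measurable_concomitant rho mS j l s c (2 * p%:R * M).
rewrite (_ : [set w | _] = z i @^-1` E)// probability_same_law//.
have mB : measurable (`]c, +oo[%classic : set R) by exact: measurable_itv.
pose b m := a l m - rho j l * a j m.
have ab : \sum_m sa j s m * b m = 0.
  transitivity (sgb s * (\sum_m a j m * a l m - rho j l * \sum_m a j m * a j m)).
    rewrite mulrBr !mulr_sumr -sumrB; apply: eq_bigr => m _.
    by rewrite /sa /b; ring.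
  by rewrite !a_inner rho_diag mulr1 subrr mulr0.
have b2 m : `|b m| <= 2.
  rewrite (le_trans (ler_normB _ _))// normrM (_ : 2 = 1 + 1)//.
  by rewrite lerD// mulr_ile1.
have H := normal_comb_tail g_indep g_law mB M0 (sa1 j s) ab b2.
rewrite normal_tailE in H; apply: le_trans H.
have bE w : comb g b w = comb g (a l) w - rho j l * comb g (a j) w.
  rewrite !comb_sum mulr_sumr -sumrB; apply: eq_bigr => m _.
  by rewrite /b; ring.
apply: probability_le_ae.
- exact: measurable_preimage_RV.
- apply: measurableI.
    by apply: measurable_preimageR => //; exact: measurable_comb.
  by apply: measurable_fun_abs_gt; exact: measurable_comb.
- apply: filterS S_comb => w h [/= h1 h2]; split.
    by rewrite /= in_itv/= andbT -sa_comb -h.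
  by rewrite /= bE -!h.
Qed.

End StandardizedLaw.

(** * Location of the selected points, with high probability *)

Section DOptimalEvent.
Context {d : measure_display} {T : measurableType d} {R : realType}.
Context (P : probability T R) (p r : nat) (p_gt0 : (0 < p)%N) (r_gt0 : (0 < r)%N).
Context (z : nat -> {RV P >-> p.-tuple R}) (z_indep : mutually_independent z).
Context (S : 'I_p -> p.-tuple R -> R) (mS : forall j, measurable_fun setT (S j)).
Context (rho : 'M[R]_p).
Context (S_law : forall i j s c,
  P [set w | c < sgb s * S j (z i w)] = (normal_tail c)%:E).
Context (S_pair : forall i j l s c M, 0 <= M ->
  (P [set w | (c < sgb s * S j (z i w)) /\
              (2 * p%:R * M < `|S l (z i w) - rho j l * S j (z i w)|)]%R
   <= p%:R%:E * ((normal_tail c)%:E * normal_prob 0 1 [set x | M < `|x|]%R))%E).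
(* [thr j c] is the value of covariate [j] at which its standardization is [c]. *)
Context (thr : 'I_p -> R -> R).
Context (S_thr : {ae P, forall w, forall i j c,
  ((thr j c < tnth (z i w) j) = (c < S j (z i w))) *
  ((tnth (z i w) j < thr j c) = (S j (z i w) < c))}).
Local Notation t := (@extreme_level R).

(** [dopt_selectP] puts every selected point beyond the level, and the maximum over all [n] points
    bounds it on the other side. The algorithm sorts covariates while the levels concern their
    standardizations, and [thr] translates: it will be affine for normal and exponential for
    lognormal covariates. The null set where the translation may fail joins the exceptional set. *)
Lemma dopt_event (e : R) : 0 < e ->
  exists2 M, 0 <= M & forall del, 0 < del -> \forall n \near \oo,
  exists N, [/\ measurable N, (P N <= e%:E)%E & forall w, ~ N w ->
    exists lo hi, dopt_blocks r (covmx z n w) lo hi /\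
      forall j s (i : 'I_n), i \in (if s then hi j else lo j) ->
        `|sgb s * S j (z i w) - t n| <= del /\
        forall l, `|S l (z i w) - rho j l * S j (z i w)| <= M].
Proof.
move=> e0; have K0 : (0 < 2 * p * r)%N by rewrite !muln_gt0 p_gt0 r_gt0.
have [M M0 H] := extremes_concomitants z_indep p_gt0 mS S_law S_pair K0 e0.
exists M => // del del0; have Hn := H del del0.
near=> n.
have Kn : (2 * p * r <= n)%N by near: n; exact: nbhs_infty_ge.
have [N [mN PN HN]] : exists N, [/\ measurable N, (P N <= e%:E)%E & forall w, ~ N w ->
    exists c, [/\ t n - del <= c, 0 <= c,
      forall j s, (2 * p * r <= count (fun i => (c < sgb s * S j (z i w))%R) (iota 0 n))%N,
      forall i j s, (i < n)%N -> sgb s * S j (z i w) <= t n + del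
    & forall i j s l, (i < n)%N -> c < sgb s * S j (z i w) ->
        `|S l (z i w) - rho j l * S j (z i w)| <= M]] by near: n.
have [N1 [mN1 PN1 HN1]] := S_thr.
exists (N `|` N1); split.
- exact: measurableU.
- apply: (@le_trans _ _ (P N + P N1)%E); first exact: measureU2.
  by rewrite PN1 adde0.
- move=> w NN; have nN : ~ N w by move=> h; apply: NN; left.
  have thrE i j c : ((thr j c < tnth (z i w) j) = (c < S j (z i w))) *
      ((tnth (z i w) j < thr j c) = (S j (z i w) < c)).
    have h : (fun w => forall i j c, ((thr j c < tnth (z i w) j) = (c < S j (z i w))) *
      ((tnth (z i w) j < thr j c) = (S j (z i w) < c))) w.
      by apply: contrapT => h; apply: NN; right; exact: HN1.
    exact: h.
  have [c [ct c0 cnt top con]] := HN w nN.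
  have [lo [hi [bl Hhi Hlo]]] := @dopt_selectP R n p r (covmx z n w) Kn.
  exists lo, hi; split=> // j s i is_.
  have cS : c < sgb s * S j (z i w).
    have cE (Q : pred nat) : count Q (iota 0 n) = count (fun i : 'I_n => Q i) (enum 'I_n).
      by rewrite -val_enum_ord count_map.
    have := cnt j s; rewrite cE; case: s is_ => is_; rewrite /sgb => cn.
      rewrite mul1r -(thrE i j c).1; have := Hhi j (thr j c) i.
      rewrite mxE; apply=> //; apply: (leq_trans cn); apply: eq_leq.
      by apply: eq_count => k; rewrite mxE thrE mul1r.
    (* In the lower block [c < - S] is read as [S < - c], so the level for the covariate is
       [thr j (- c)]. *)
    rewrite mulN1r ltrNr -(thrE i j (- c)).2; have := Hlo j (thr j (- c)) i.
    rewrite mxE; apply=> //; apply: (leq_trans cn); apply: eq_leq.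
    by apply: eq_count => k; rewrite mxE thrE mulN1r ltrNr.
  split=> [|l]; last by apply: (con _ _ s).
  have := top i j s (ltn_ord i); rewrite ler_distl => ->.
  by rewrite andbT (le_trans ct)// ltW.
Unshelve. all: by end_near. Qed.

Context (eps : nat -> {RV P >-> R}) (beta : 'cV[R]_(1 + p)) (sigma : R).
Context (eps_err : homoscedastic_errors z eps sigma).

Let condcov_mxB n D (L : 'M[R]_(1 + p)) a b w : (condcov_mx P (sigmaZ z n)
       (fun v => diag_mx D *m betaD z eps r beta n v) w - L) a b =
    condcov_mx P (sigmaZ z n) (fun v => diag_mx D *m betaD z eps r beta n v) w a b - L a b.
Proof. by rewrite [LHS]mxE; congr (_ + _); rewrite [LHS]mxE. Qed.

Lemma measurable_condcov_betaD_dev n (D : 'rV[R]_(1 + p)) (L : 'M[R]_(1 + p)) a b (B : R) :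
  measurable [set w | B < `|(condcov_mx P (sigmaZ z n)
       (fun v => diag_mx D *m betaD z eps r beta n v) w - L) a b|].
Proof.
have [mV _] := condcov_mx_betaD r beta eps_err n D a b.
apply: (@measurable_fun_abs_gt _ T R (fun w => (condcov_mx P (sigmaZ z n)
     (fun v => diag_mx D *m betaD z eps r beta n v) w - L) a b)).
rewrite (_ : (fun w => _) = fun w => condcov_mx P (sigmaZ z n)
  (fun v => diag_mx D *m betaD z eps r beta n v) w a b - L a b).
  exact: measurable_funB.
by apply/funext => w; exact: condcov_mxB.
Qed.

Lemma condcov_betaD_dev n (D : 'rV[R]_(1 + p)) (L : 'M[R]_(1 + p)) a b (B e : R) N :
  measurable N -> (P N <= e%:E)%E ->
  (forall w, ~ N w -> `|sigma ^+ 2 * ((diag_mx D *m dopt_weights r (covmx z n w)) *m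
      (diag_mx D *m dopt_weights r (covmx z n w))^T) a b - L a b| <= B) ->
  (P [set w | B < `|(condcov_mx P (sigmaZ z n)
       (fun v => diag_mx D *m betaD z eps r beta n v) w - L) a b|]%R <= e%:E)%E.
Proof.
move=> mN PN H; have [_ aeV] := condcov_mx_betaD r beta eps_err n D a b.
apply: (le_trans _ PN); apply: probability_le_ae => //.
  exact: measurable_condcov_betaD_dev.
apply: filterS aeV => w h /=; rewrite condcov_mxB h => lt; apply: contrapT => nN.
by move: (lt_le_trans lt (H w nN)); rewrite ltxx.
Qed.

End DOptimalEvent.

(** * Limits of the normalized Gram matrix *)

Section GramLimits.
Context {R : realType} (p r : nat) (p_gt0 : (0 < p)%N) (r_gt0 : (0 < r)%N).
Context (mu : 'cV[R]_p) (sd : 'rV[R]_p) (rho : 'M[R]_p).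

Definition affine_coord (x : 'I_p -> R) (a : 'I_(1 + p)) : R :=
  if fintype.split a is inr l then x l else 1.

Lemma affine_coord_lshift x i : affine_coord x (lshift p i) = 1.
Proof. by rewrite /affine_coord (unsplitK (inl i)). Qed.

Lemma affine_coord_rshift x l : affine_coord x (rshift 1 l) = x l.
Proof. by rewrite /affine_coord (unsplitK (inr l)). Qed.

Definition coordE := (affine_coord_lshift, affine_coord_rshift).

Lemma design_coord n (Z : 'M[R]_(n, p)) i a : design Z i a = affine_coord (Z i) a.
Proof.
by rewrite /design mxE /affine_coord; case: (fintype.split a) => // ?; rewrite mxE.
Qed.

Lemma row_mx_coord (x : 'rV[R]_p) a :
  row_mx (const_mx 1) x ord0 a = affine_coord (x ord0) a.
Proof. by rewrite mxE /affine_coord; case: (fintype.split a) => // ?; rewrite mxE. Qed.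

Lemma invmx_right_inv q (G H : 'M[R]_q) : G *m H = 1%:M -> G \in unitmx /\ invmx G = H.
Proof.
move=> GH; have [uG _] := mulmx1_unit GH; split=> //.
by rewrite -[invmx G]mulmx1 -GH mulmxA mulVmx// mul1mx.
Qed.

Let k : R := (2 * p * r)%:R.

Let kE : k = 2 * p%:R * r%:R.
Proof. by rewrite /k !natrM. Qed.

(** In this block the standardized covariate [l] is, up to a bounded error,
    [sgb s * rho j l * sqrt (2 log n)]; division by [sqrt (log n)] leaves [sqrt 2] and removes the
    mean. *)
Definition normal_limit (j : 'I_p) (s : bool) : 'I_(1 + p) -> R :=
  affine_coord (fun l => sgb s * Num.sqrt 2 * rho j l * sd ord0 l).

(** Only covariate [j] itself, at its upper end, reaches the order of its normalization; every other
    covariate in the block is of smaller order. *)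
Definition lognormal_limit (j : 'I_p) (s : bool) : 'I_(1 + p) -> R :=
  affine_coord (fun l => if s && (l == j) then expR (mu l ord0) else 0).

(** The two ends carry opposite signs, which cancels the terms mixing intercept and slopes and
    doubles the others; with the square of [sqrt 2] this gives the factor 4. Summing
    [rho i j * rho j l] over [j] yields the matrix product. *)
Lemma gram_limit_normal (rho_sym : forall j l, rho j l = rho l j) :
  gram_limit r normal_limit = block_mx k%:M 0 0
    ((4 * r%:R) *: (diag_mx sd *m (rho *m rho) *m diag_mx sd)).
Proof.
apply/matrixP => a b; rewrite mxE.
have s2 : Num.sqrt 2 * Num.sqrt 2 = 2 :> R by rewrite -expr2 sqr_sqrtr.
case: (split_ordP a) => i ->; case: (split_ordP b) => l ->.
- rewrite block_mxEul mxE !ord1 /= ?eqxx mulr1n.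
  under eq_bigr do rewrite /normal_limit !coordE mulr1.
  by rewrite sumr_const card_ord kE -mulr_natr; ring.
- rewrite block_mxEur mxE big1 ?mulr0// => j _.
  by rewrite /normal_limit !coordE /sgb; ring.
- rewrite block_mxEdl mxE big1 ?mulr0// => j _.
  by rewrite /normal_limit !coordE /sgb; ring.
- rewrite block_mxEdr mxE mul_mx_diag mxE mul_diag_mx mxE mxE.
  rewrite mulr_sumr !mulr_sumr mulr_suml mulr_sumr; apply: eq_bigr => j _.
  rewrite /normal_limit !coordE /sgb (rho_sym i j).
  transitivity (r%:R * (2 * (Num.sqrt 2 * Num.sqrt 2) * (rho j i * rho j l * sd ord0 i * sd ord0 l))).
    by ring.
  by rewrite s2; ring.
Qed.

Lemma gram_limit_normal_inv (rho_sym : forall j l, rho j l = rho l j) :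
  diag_mx sd *m (rho *m rho) *m diag_mx sd \in unitmx ->
  gram_limit r normal_limit \in unitmx /\
  invmx (gram_limit r normal_limit) = (1 / (2 * k)) *:
    block_mx 2%:M 0 0 (p%:R *: invmx (diag_mx sd *m (rho *m rho) *m diag_mx sd)).
Proof.
move=> uQ; apply: invmx_right_inv; rewrite (gram_limit_normal rho_sym).
rewrite scale_block_mx mulmx_block !(mulmx0, mul0mx, addr0, add0r, scaler0).
rewrite -!scalemxAr -!scalemxAl mulmxV// !scalerA -scalar_mxM scale_scalar_mx.
have r0 : r%:R != 0 :> R by rewrite pnatr_eq0 -lt0n.
have p0 : p%:R != 0 :> R by rewrite pnatr_eq0 -lt0n.
rewrite (_ : 1 / (2 * k) * (k * 2) = 1); last by rewrite kE; field; rewrite r0 p0.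
rewrite (_ : 1 / (2 * k) * p%:R * (4 * r%:R) = 1); last by rewrite kE; field; rewrite r0 p0.
by rewrite scale1r -scalar_mx_block.
Qed.

Let w : 'cV[R]_p := \col_j expR (mu j ord0).
Let W2 : 'M[R]_p := diag_mx (\row_j expR (2 * mu j ord0)).

Lemma gram_limit_lognormal :
  gram_limit r lognormal_limit = block_mx k%:M (r%:R *: w^T) (r%:R *: w) (r%:R *: W2).
Proof.
apply/matrixP => a b; rewrite mxE.
case: (split_ordP a) => i ->; case: (split_ordP b) => l ->.
- rewrite block_mxEul mxE !ord1 /= ?eqxx mulr1n.
  under eq_bigr do rewrite /lognormal_limit !coordE mulr1.
  by rewrite sumr_const card_ord kE -mulr_natr; ring.
- rewrite block_mxEur !mxE (bigD1 l)//= big1 => [|j jl];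
    rewrite /lognormal_limit !coordE /=.
    by rewrite eqxx; ring.
  by rewrite eq_sym (negbTE jl); ring.
- rewrite block_mxEdl !mxE (bigD1 i)//= big1 => [|j ji];
    rewrite /lognormal_limit !coordE /=.
    by rewrite eqxx; ring.
  by rewrite eq_sym (negbTE ji); ring.
- rewrite block_mxEdr !mxE (bigD1 i)//= big1 => [|j ji];
    rewrite /lognormal_limit !coordE /=.
    rewrite eqxx (eq_sym l i); case: eqP => [->|_]; last by rewrite mulr0n; ring.
    by rewrite mulr1n (mulrDl 1 1) mul1r expRD; ring.
  by rewrite (eq_sym i) (negbTE ji); ring.
Qed.

(** Since [W2^-1 w = u] and [w^T u = p], the Schur complement of the slope block is
    [r * (2 * p - p) = k / 2], which explains the corner [2 / k]; the other blocks follow from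
    it. *)
Lemma gram_limit_lognormal_inv (u : 'cV[R]_p := \col_j expR (- mu j ord0))
    (Lambda : 'M[R]_p := diag_mx (\row_j expR (- (2 * mu j ord0)))) :
  gram_limit r lognormal_limit \in unitmx /\
  invmx (gram_limit r lognormal_limit) = (2 / k) *:
    block_mx 1%:M (- u^T) (- u) (p%:R *: Lambda + u *m u^T).
Proof.
have r0 : r%:R != 0 :> R by rewrite pnatr_eq0 -lt0n.
have p0 : p%:R != 0 :> R by rewrite pnatr_eq0 -lt0n.
have wu : w^T *m u = p%:R%:M.
  apply/matrixP => i j; rewrite !mxE !ord1 eqxx mulr1n.
  under eq_bigr do rewrite !mxE -expRD subrr expR0.
  by rewrite sumr_const card_ord.
have W2u : W2 *m u = w.
  apply/matrixP => i j; rewrite mul_diag_mx !mxE -expRD.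
  by congr expR; ring.
have wL : w^T *m Lambda = u^T.
  apply/matrixP => i j; rewrite mul_mx_diag !mxE -expRD.
  by congr expR; ring.
have W2L : W2 *m Lambda = 1%:M.
  apply/matrixP => i j; rewrite mul_diag_mx !mxE.
  case: eqP => [->|_]; last by rewrite !mulr0n mulr0.
  by rewrite !mulr1n -expRD subrr expR0.
apply: invmx_right_inv; rewrite gram_limit_lognormal -scalemxAr mulmx_block.
rewrite !mulmxDr !mulmxN -!scalemxAl -!scalemxAr !mulmxA wu W2u wL W2L.
rewrite !mulmx1 !mul_scalar_mx scale_block_mx [RHS](scalar_mx_block 1 p).
congr block_mx.
- apply/matrixP => i j; rewrite !mxE !ord1 /= ?eqxx !mulr1n kE; field.
  by rewrite r0 p0.
- apply/matrixP => i j; rewrite !mxE kE; field.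
  by rewrite r0 p0.
- by apply/matrixP => i j; rewrite !mxE subrr mulr0.
- apply/matrixP => i j; rewrite !mxE kE.
  by case: (i == j); rewrite ?mulr1n ?mulr0n; field; rewrite r0 p0.
Qed.

End GramLimits.

(** * Deviation of one normalized regressor from its limit *)

Section EntryBounds.
Context {R : realType}.
Implicit Types (m sd rho M s t x y eta : R).

(** Here [x] and [y] are the standardized covariates [l] and [j]. The numerator of the deviation is
    the mean plus [sd] times the residual plus [sd * rho] times the distance of [y] from its signed
    level, all three bounded. *)
Lemma normal_entry_bound m sd rho M s t x y (b : bool) :
  0 < s -> t = Num.sqrt 2 * s -> 0 <= sd -> `|rho| <= 1 ->
  `|sgb b * y - t| <= 1 -> `|x - rho * y| <= M ->
  `|(m + sd * x) / s - sgb b * Num.sqrt 2 * rho * sd| <= (`|m| + sd * (M + 1)) / s.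
Proof.
move=> s0 tE sd0 r1 hy hx.
have -> : (m + sd * x) / s - sgb b * Num.sqrt 2 * rho * sd =
    (m + sd * (x - rho * y) + sd * (rho * (y - sgb b * t))) / s.
  by rewrite tE; field; rewrite gt_eqF.
rewrite normrM normfV (gtr0_norm s0) ler_wpM2r ?invr_ge0 ?(ltW s0)//.
have hy' : `|y - sgb b * t| <= 1.
  case: b hy; rewrite /sgb ?mul1r// !mulN1r opprK => h.
  by rewrite -normrN opprD.
rewrite (le_trans (ler_normD _ _))// (le_trans (lerD (ler_normD _ _) (lexx _)))//.
rewrite -addrA lerD2l !normrM (ger0_norm sd0) mulrDr mulr1 lerD//.
  by rewrite ler_wpM2l.
by rewrite ler_piMr// mulr_ile1.
Qed.

Lemma norm_expR_sub1_le x : `|x| <= 2^-1 -> `|expR x - 1| <= 2 * `|x|.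
Proof.
move=> x2; have e1 := expR_ge1Dx x; have e2 := expR_ge1Dx (- x).
have p1 := expR_gt0 x; have p2 := expR_gt0 (- x).
have E : expR x * expR (- x) = 1 by rewrite -expRD subrr expR0.
have U : expR x * (1 - x) <= 1 by rewrite -[leRHS]E ler_wpM2l// ltW.
have x2' := x2; rewrite ler_norml in x2'; case/andP: x2' => xl xu.
have [x0|x0] := lerP 0 x.
  rewrite (ger0_norm x0) ger0_norm; last by rewrite subr_ge0 (le_trans _ e1)// lerDl.
  rewrite (ger0_norm x0) in x2; nra.
rewrite (ltr0_norm x0) ler0_norm; last by rewrite subr_le0; nra.
by lra.
Qed.

Lemma lognormal_entry_bound m sd t y del eta : 0 <= sd -> `|y - t| <= del ->
  sd * del <= 2^-1 -> expR m * (2 * (sd * del)) <= eta ->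
  `|expR (m + sd * y) / expR (sd * t) - expR m| <= eta.
Proof.
move=> sd0 yt h1 h2; have hx : `|sd * (y - t)| <= sd * del.
  by rewrite normrM (ger0_norm sd0) ler_wpM2l.
rewrite -expRN -expRD (_ : m + sd * y - sd * t = m + sd * (y - t)); last by ring.
rewrite expRD -[X in _ - X]mulr1 -mulrBr normrM (gtr0_norm (expR_gt0 _)).
apply: le_trans h2; rewrite ler_wpM2l ?expR_ge0//.
by rewrite (le_trans (norm_expR_sub1_le (le_trans hx h1)))// ler_wpM2l.
Qed.

(** The exponent is at most [m + q - gam * t], and [gam * t <= expR (gam * t)] turns its decay into
    an explicit lower bound on [t]. *)
Lemma lognormal_entry_bound0 m sd t x q gam eta : 0 < gam -> 0 < eta -> 0 < t ->
  sd * (x - t) <= q - gam * t -> expR (m + q) / (gam * eta) <= t ->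
  `|expR (m + sd * x) / expR (sd * t) - 0| <= eta.
Proof.
move=> g0 e0 t0 h ht; rewrite subr0 -expRN -expRD gtr0_norm ?expR_gt0//.
apply: (@le_trans _ _ (expR (m + q) * expR (- (gam * t)))).
  by rewrite -expRD ler_expR; lra.
rewrite ler_pdivrMr ?mulr_gt0// in ht.
rewrite expRN ler_pdivrMr ?expR_gt0// (le_trans ht)//.
rewrite (_ : t * (gam * eta) = eta * (gam * t)); last by ring.
rewrite ler_wpM2l ?(ltW e0)//.
by rewrite (le_trans _ (expR_ge1Dx _))// lerDr.
Qed.

End EntryBounds.

(** * Convergence of the conditional covariance matrix *)

Section AsymptoticCovariance.
Context {d : measure_display} {T : measurableType d} {R : realType}.
Context (P : probability T R) (p r : nat) (p_gt0 : (0 < p)%N) (r_gt0 : (0 < r)%N).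
Context (mu : 'cV[R]_p) (sd : 'rV[R]_p) (rho : 'M[R]_p).
Context (sd_ge0 : forall j, 0 <= sd ord0 j) (rho_corr : correlation_matrix rho).
Context (Sigma_full : diag_mx sd *m rho *m diag_mx sd \in unitmx).
Context (beta : 'cV[R]_(1 + p)) (sigma : R).
Context (z : nat -> {RV P >-> p.-tuple R}) (eps : nat -> {RV P >-> R}).
Context (z_indep : mutually_independent z) (z_id : identically_distributed z).
Context (eps_err : homoscedastic_errors z eps sigma).
Local Notation t := (@extreme_level R).
Let k : R := (2 * p * r)%:R.
Let sd0 j : 0 < sd ord0 j := sd_gt0 sd_ge0 Sigma_full j.

(** Off an event of probability [e], all normalized regressors are within [C1 / sqrt (log n)] of
    their limits, and the Lipschitz bound keeps this rate. [C1] depends on [e] through [M] and not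
    on [n], as stochastic boundedness demands. *)
Lemma covariance_OP_normal : mvnormal mu (diag_mx sd *m rho *m diag_mx sd) (z 0%N) ->
  OP_mx P (fun n w => condcov_mx P (sigmaZ z n)
      (fun v => diag_mx (row_mx (const_mx 1) (const_mx (Num.sqrt (ln n%:R)))) *m
                betaD z eps r beta n v) w -
      (sigma ^+ 2 / (2 * k)) *: block_mx 2%:M 0 0
         (p%:R *: invmx (diag_mx sd *m (rho *m rho) *m diag_mx sd)))
    (fun n => 1 / Num.sqrt (ln n%:R)).
Proof.
move=> [A [g [AE g_indep g_law zE]]] a b e e0.
have rho_sym := rho_symE rho_corr.
have inner := std_row_inner sd_ge0 Sigma_full AE.
have rle1 := corr_le1 sd_ge0 rho_corr Sigma_full AE.
pose S j (x : p.-tuple R) := (tnth x j - mu j ord0) / sd ord0 j.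
have mS j : measurable_fun setT (S j).
  apply: measurable_funM => //; apply: measurable_funB => //; exact: measurable_tnth.
have S_comb : {ae P, forall w, forall j, S j (z 0%N w) = comb g (std_row sd A j) w}.
  apply: aeW => w j; have /colP/(_ j) := zE w.
  rewrite !mxE /S => ->; rewrite addrAC subrr add0r comb_sum mulr_suml.
  by apply: eq_bigr => m _; rewrite mxE /std_row mulrAC.
have row_le1 := std_row_le1 sd_ge0 rho_corr Sigma_full AE.
have S_law := standardized_law z_id g_indep g_law inner (rho_diag rho_corr) mS S_comb.
have S_pair := standardized_pair z_id g_indep g_law inner (rho_diag rho_corr) rle1 row_le1 mS S_comb.
have S_thr : {ae P, forall w, forall i j c,
  ((mu j ord0 + sd ord0 j * c < tnth (z i w) j) = (c < S j (z i w))) *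
  ((tnth (z i w) j < mu j ord0 + sd ord0 j * c) = (S j (z i w) < c))}.
  apply: aeW => w i j c; have sj := sd0 j.
  split; rewrite /S ?ltr_pdivlMr ?ltr_pdivrMr// (mulrC c).
    by rewrite ltrBrDl.
  by rewrite ltrBlDl.
have [M M0 H] := dopt_event p_gt0 r_gt0 z_indep mS S_law S_pair S_thr e0.
have uQ : diag_mx sd *m (rho *m rho) *m diag_mx sd \in unitmx.
  have ur := rho_unit Sigma_full.
  have us : diag_mx sd \in unitmx by move: Sigma_full; rewrite unitmx_mul => /andP[].
  by rewrite !unitmx_mul ur us.
have [uG GE] := gram_limit_normal_inv p_gt0 r_gt0 rho_sym uQ.
have [C [e1 [C0 e10 HC]]] := dopt_cov_approx uG.
pose C1 := \sum_l (`|mu l ord0| + sd ord0 l * (M + 1)).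
have C1t l : 0 <= `|mu l ord0| + sd ord0 l * (M + 1).
  by rewrite addr_ge0// mulr_ge0// addr_ge0.
have C10 : 0 <= C1 by apply: sumr_ge0.
have C1l l : `|mu l ord0| + sd ord0 l * (M + 1) <= C1.
  by rewrite /C1 (bigD1 l)//= lerDl sumr_ge0.
exists (sigma ^+ 2 * (C * C1)).
(* Distance 1 from the level is enough: after division by [sqrt (log n)] it is of the order of the
   rate. *)
have H1 := H 1 ltr01.
near=> n.
pose s : R := Num.sqrt (ln n%:R).
have tE : t n = Num.sqrt 2 * s by rewrite /extreme_level sqrtrM.
have s2 : 0 < Num.sqrt 2 :> R by rewrite sqrtr_gt0.
(* This gives both [0 < s] and [C1 / s <= e1], the radius within which the perturbation bound
   applies. *)
have sge : Num.sqrt 2 * (C1 / e1 + 1) <= t n by near: n; exact: near_extreme_level_ge.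
have s0 : 0 < s.
  have : 0 < t n by rewrite (lt_le_trans _ sge)// mulr_gt0// ltr_wpDl// divr_ge0// ltW.
  by rewrite tE pmulr_rgt0.
have C1s : C1 / s <= e1.
  rewrite tE ler_pM2l// in sge; rewrite ler_pdivrMr// mulrC -ler_pdivrMr//.
  by apply: le_trans sge; rewrite lerDl.
have [N [mN PN HN]] : exists N, [/\ measurable N, (P N <= e%:E)%E & forall w, ~ N w ->
    exists lo hi, dopt_blocks r (covmx z n w) lo hi /\
      forall j s (i : 'I_n), i \in (if s then hi j else lo j) ->
        `|sgb s * S j (z i w) - t n| <= 1 /\
        forall l, `|S l (z i w) - rho j l * S j (z i w)| <= M] by near: n.
pose D : 'rV[R]_(1 + p) := row_mx (const_mx 1) (const_mx s).
set L := _ *: block_mx _ _ _ _.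
have LE : L = sigma ^+ 2 *: invmx (gram_limit r (normal_limit sd rho)).
  rewrite GE scalerA /L; congr (_ *: _).
  by rewrite mul1r.
have DE x : D ord0 x = affine_coord (fun=> s) x.
  by rewrite /D row_mx_coord /affine_coord; case: (fintype.split x) => // ?; rewrite mxE.
have Dgt x : 0 < D ord0 x by rewrite DE /affine_coord; case: (fintype.split x).
have dev w : ~ N w -> `|sigma ^+ 2 * ((diag_mx D *m dopt_weights r (covmx z n w)) *m
      (diag_mx D *m dopt_weights r (covmx z n w))^T) a b - L a b|
      <= sigma ^+ 2 * (C * (C1 / s)).
  move=> nN; have [lo [hi [bl hb]]] := HN w nN.
  rewrite LE [X in _ - X]mxE -mulrBr normrM (ger0_norm (sqr_ge0 _)) ler_wpM2l ?sqr_ge0//.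
  have ent j (q : bool) (i : 'I_n) x : i \in (if q then hi j else lo j) ->
      `|design (covmx z n w) i x / D ord0 x - normal_limit sd rho j q x| <= C1 / s.
    move=> /hb[h1 h2]; rewrite design_coord DE /normal_limit /affine_coord.
    case: (fintype.split x) => l.
      by rewrite divr1 subrr normr0 divr_ge0// ltW.
    have -> : covmx z n w i l = mu l ord0 + sd ord0 l * S l (z i w).
      by rewrite mxE /S mulrC divfK ?gt_eqF// addrC subrK.
    apply: (le_trans (normal_entry_bound _ s0 tE (ltW (sd0 l)) (rle1 j l) h1 (h2 l))).
    by rewrite ler_wpM2r// invr_ge0 ltW.
  apply: (HC n _ D lo hi) => //.
  - by rewrite divr_ge0// ltW.
  - by move=> j i x; exact: (ent j true).
  - by move=> j i x; exact: (ent j false).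
have := condcov_betaD_dev beta eps_err mN PN dev.
apply: le_trans; rewrite le_eqVlt; apply/orP; left; apply/eqP; congr (P _).
have ltE (x : R) : (sigma ^+ 2 * (C * C1) < `|x / (1 / s)|) =
    (sigma ^+ 2 * (C * (C1 / s)) < `|x|).
  rewrite mul1r invrK normrM (gtr0_norm s0).
  by rewrite (_ : sigma ^+ 2 * (C * (C1 / s)) = sigma ^+ 2 * (C * C1) / s) ?ltr_pdivrMr//; ring.
by apply/seteqP; split=> w /=; rewrite ltE.
Unshelve. all: by end_near. Qed.

Lemma covariance_oP_lognormal :
  (forall i, mvlognormal mu (diag_mx sd *m rho *m diag_mx sd) (z i)) ->
  oP1_mx P (fun n w => condcov_mx P (sigmaZ z n)
      (fun v => diag_mx (row_mx (const_mx 1)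
          (\row_j expR (sd ord0 j * Num.sqrt (2 * ln n%:R)))) *m
                betaD z eps r beta n v) w -
      (2 * sigma ^+ 2 / k) *: block_mx 1%:M (- (\col_j expR (- mu j ord0))^T)
         (- (\col_j expR (- mu j ord0)))
         (p%:R *: diag_mx (\row_j expR (- (2 * mu j ord0))) +
          (\col_j expR (- mu j ord0)) *m (\col_j expR (- mu j ord0))^T)).
Proof.
move=> hz a b eta eta0.
have [U [[A [g [AE g_indep g_law UE]]] zU]] := hz 0%N.
have inner := std_row_inner sd_ge0 Sigma_full AE.
have rle1 := corr_le1 sd_ge0 rho_corr Sigma_full AE.
have rlt1 := corr_lt1 sd_ge0 rho_corr Sigma_full AE.
pose S j (x : p.-tuple R) := (ln (tnth x j) - mu j ord0) / sd ord0 j.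
have mS j : measurable_fun setT (S j).
  apply: measurable_funM => //; apply: measurable_funB => //.
  by apply: (measurableT_comp (f := @ln R)) => //; exact: measurable_tnth.
have S_comb : {ae P, forall w, forall j, S j (z 0%N w) = comb g (std_row sd A j) w}.
  apply: filterS zU => w zw j; have /colP/(_ j) := UE w.
  rewrite /S zw expRK !mxE => ->; rewrite addrAC subrr add0r comb_sum mulr_suml.
  by apply: eq_bigr => m _; rewrite mxE /std_row mulrAC.
have row_le1 := std_row_le1 sd_ge0 rho_corr Sigma_full AE.
have S_law := standardized_law z_id g_indep g_law inner (rho_diag rho_corr) mS S_comb.
have S_pair := standardized_pair z_id g_indep g_law inner (rho_diag rho_corr) rle1 row_le1 mS S_comb.
have z_gt0 : {ae P, forall w, forall i j, 0 < tnth (z i w) j}.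
  apply/ae_foralln => i; have [V [_ zV]] := hz i.
  by apply: filterS zV => w zw j; rewrite zw expR_gt0.
have S_thr : {ae P, forall w, forall i j c,
  ((expR (mu j ord0 + sd ord0 j * c) < tnth (z i w) j) = (c < S j (z i w))) *
  ((tnth (z i w) j < expR (mu j ord0 + sd ord0 j * c)) = (S j (z i w) < c))}.
  apply: filterS z_gt0 => w zw i j c; have sj := sd0 j.
  split; rewrite /S ?ltr_pdivlMr ?ltr_pdivrMr// (mulrC c) -[tnth _ _ in LHS]lnK ?posrE//
    ltr_expR.
    by rewrite ltrBrDl.
  by rewrite ltrBlDl.
have [uG GE] := gram_limit_lognormal_inv p_gt0 r_gt0 mu.
have [C [e1 [C0 e10 HC]]] := dopt_cov_approx uG.
(* The accuracy asked of each regressor: within the perturbation radius, and such that the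
   covariance is within [eta]. The added 1 keeps [et] positive when [sigma ^+ 2 * C] is 0. *)
pose et := Num.min e1 (eta / (sigma ^+ 2 * C + 1)).
have sC0 : 0 <= sigma ^+ 2 * C by rewrite mulr_ge0// sqr_ge0.
have et0 : 0 < et by rewrite lt_min e10 divr_gt0// ltr_wpDl.
have et1 : et <= e1 by rewrite ge_min lexx.
have et2 : sigma ^+ 2 * (C * et) <= eta.
  rewrite mulrA; apply: (@le_trans _ _ ((sigma ^+ 2 * C + 1) * et)).
    by rewrite ler_wpM2r ?(ltW et0)// lerDl.
  by rewrite mulrC -ler_pdivlMr ?ltr_wpDl// ge_min lexx orbT.
set L := _ *: block_mx _ _ _ _.
have LE : L = sigma ^+ 2 *: invmx (gram_limit r (lognormal_limit mu)).
  by rewrite GE scalerA /L; congr (_ *: _); rewrite /k; ring.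
(* [Q] dominates [sd] and [expR mu * sd] at once for every covariate, so that one [del] controls
   both the exponent, which has to stay below one half, and the resulting error, which has to stay
   below [et]. *)
pose Q := 1 + \sum_l (1 + expR (mu l ord0)) * sd ord0 l.
have Qt l : 0 <= (1 + expR (mu l ord0)) * sd ord0 l.
  by rewrite mulr_ge0// addr_ge0// expR_ge0.
have Q1 : 1 <= Q by rewrite lerDl sumr_ge0.
have Ql l : (1 + expR (mu l ord0)) * sd ord0 l <= Q.
  by rewrite /Q (bigD1 l)//= addrCA lerDl addr_ge0// sumr_ge0.
have Q0 : 0 < Q by rewrite (lt_le_trans ltr01).
pose del := Num.min 1 et / (2 * Q).
have m0 : 0 < Num.min 1 et by rewrite lt_min ltr01.
have del0 : 0 < del by rewrite divr_gt0// mulr_gt0.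
have Qdel : Q * del = Num.min 1 et / 2 by rewrite /del; field; rewrite gt_eqF.
have del1 : del <= 1.
  have : del <= Q * del by rewrite ler_peMl// ltW.
  have : Num.min 1 et <= 1 by rewrite ge_min lexx.
  by rewrite Qdel; lra.
have sdel l : sd ord0 l * del <= 2^-1 /\ expR (mu l ord0) * (2 * (sd ord0 l * del)) <= et.
  have := ler_wpM2r (ltW del0) (Ql l); rewrite Qdel mulrDl mul1r mulrDl => h.
  have p1 : 0 <= sd ord0 l * del by rewrite mulr_ge0// ltW.
  have p2 : 0 <= expR (mu l ord0) * sd ord0 l * del by rewrite -mulrA mulr_ge0 ?expR_ge0.
  have le1 : Num.min 1 et <= 1 by rewrite ge_min lexx.
  have le2 : Num.min 1 et <= et by rewrite ge_min lexx orbT.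
  split; first by lra.
  rewrite (_ : _ * (2 * _) = 2 * (expR (mu l ord0) * sd ord0 l * del)); last by ring.
  by lra.
(* The rate at which the exponent of a vanishing entry decreases in [t n]. For [l != j] it is the
   gap below perfect correlation. For [l = j] at the lower end the true rate is [2 * sd], and [sd]
   is enough. *)
pose gam (j l : 'I_p) := sd ord0 l * (if l == j then 1 else 1 - `|rho j l|).
have gam0 j l : 0 < gam j l.
  rewrite mulr_gt0//; case: eqP => // /eqP lj; rewrite subr_gt0.
  exact: rlt1.
apply/fine_cvgP; split.
  apply: nearW => n; apply: fin_num_measure.
  exact: (@measurable_condcov_betaD_dev _ _ _ P p r z eps beta sigma eps_err).
apply/cvgrPdist_le => e e0.
have [M M0 H] := dopt_event p_gt0 r_gt0 z_indep mS S_law S_pair S_thr e0.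
have Hd := H del del0.
(* [M] bounds the residual and 1 bounds [del]; [B] next dominates the thresholds of
   [lognormal_entry_bound0] over all pairs [j], [l]. *)
pose q l := sd ord0 l * (M + 1).
pose B := \sum_j \sum_l expR (mu l ord0 + q l) / (gam j l * et).
have Bt j l : 0 <= expR (mu l ord0 + q l) / (gam j l * et).
  by rewrite divr_ge0 ?expR_ge0// mulr_ge0 ?ltW.
have Bjl j l : expR (mu l ord0 + q l) / (gam j l * et) <= B.
  rewrite /B (bigD1 j)//= (bigD1 l)//= -addrA lerDl addr_ge0//; last first.
    by apply: sumr_ge0 => ? _; apply: sumr_ge0.
  by apply: sumr_ge0.
near=> n.
have tB : B <= t n by near: n; exact: near_extreme_level_ge.
have t1 : 1 <= t n by near: n; exact: near_extreme_level_ge.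
have t0 : 0 < t n by rewrite (lt_le_trans ltr01).
have [N [mN PN HN]] : exists N, [/\ measurable N, (P N <= e%:E)%E & forall w, ~ N w ->
    exists lo hi, dopt_blocks r (covmx z n w) lo hi /\
      forall j s (i : 'I_n), i \in (if s then hi j else lo j) ->
        `|sgb s * S j (z i w) - t n| <= del /\
        forall l, `|S l (z i w) - rho j l * S j (z i w)| <= M] by near: n.
have [N2 [mN2 PN2 HN2]] := z_gt0.
have mNN : measurable (N `|` N2) by exact: measurableU.
have PNN : (P (N `|` N2) <= e%:E)%E.
  apply: (@le_trans _ _ (P N + P N2)%E); first exact: measureU2.
  by rewrite PN2 adde0.
pose D : 'rV[R]_(1 + p) := row_mx (const_mx 1) (\row_j expR (sd ord0 j * t n)).
have DE x : D ord0 x = affine_coord (fun l => expR (sd ord0 l * t n)) x.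
  by rewrite /D row_mx_coord /affine_coord; case: (fintype.split x) => // ?; rewrite mxE.
have Dgt x : 0 < D ord0 x.
  by rewrite DE /affine_coord; case: (fintype.split x) => // ?; exact: expR_gt0.
have dev w : ~ (N `|` N2) w -> `|sigma ^+ 2 * ((diag_mx D *m dopt_weights r (covmx z n w)) *m
      (diag_mx D *m dopt_weights r (covmx z n w))^T) a b - L a b| <= eta.
  move=> nNN; have nN : ~ N w by move=> h; apply: nNN; left.
  have zp i j : 0 < tnth (z i w) j.
    have h : (fun w => forall i j, 0 < tnth (z i w) j) w.
      by apply: contrapT => h; apply: nNN; right; exact: HN2.
    exact: h.
  have [lo [hi [bl hb]]] := HN w nN.
  apply: le_trans et2.
  rewrite LE [X in _ - X]mxE -mulrBr normrM (ger0_norm (sqr_ge0 _)) ler_wpM2l ?sqr_ge0//.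
  have ent j (s : bool) (i : 'I_n) x : i \in (if s then hi j else lo j) ->
      `|design (covmx z n w) i x / D ord0 x - lognormal_limit mu j s x| <= et.
    move=> /hb[h1 h2]; rewrite design_coord DE /lognormal_limit /affine_coord.
    case: (fintype.split x) => l.
      by rewrite divr1 subrr normr0 ltW.
    have -> : covmx z n w i l = expR (mu l ord0 + sd ord0 l * S l (z i w)).
      rewrite mxE /S (mulrC (sd _ _)) divfK ?gt_eqF// addrC subrK lnK// posrE.
      exact: zp.
    have zero : sd ord0 l * (S l (z i w) - t n) <= q l - gam j l * t n ->
        `|expR (mu l ord0 + sd ord0 l * S l (z i w)) / expR (sd ord0 l * t n) - 0| <= et.
      by move=> hh; apply: (lognormal_entry_bound0 (gam0 j l) et0 t0 hh (le_trans (Bjl j l) tB)).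
    (* Three cases: another covariate, which vanishes because [|rho j l| < 1]; the covariate of the
       block at its upper end, where the limit is [expR mu]; the same at its lower end, where it
       vanishes. *)
    have [lj|lj] := eqVneq l j; rewrite ?andbT ?andbF; last first.
      apply: zero; rewrite /q /gam (negbTE lj) -mulrA -mulrBr ler_wpM2l//.
      have /ler_normlP[_ hS] := h2 l.
      have hj : `|S j (z i w)| <= t n + 1.
        have -> : `|S j (z i w)| = `|sgb s * S j (z i w)|.
          by rewrite /sgb; case: (s); rewrite ?mul1r// mulN1r normrN.
        rewrite -[sgb s * _](subrK (t n)) (le_trans (ler_normD _ _))//.
        by rewrite (gtr0_norm t0) addrC lerD2l (le_trans h1).
      have hr : rho j l * S j (z i w) <= `|rho j l| * t n + 1.
        rewrite (le_trans (ler_norm _))// normrM.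
        rewrite (le_trans (ler_wpM2l (normr_ge0 _) hj))// mulrDr mulr1 lerD2l.
        exact: rle1.
      by rewrite mulrBl mul1r; lra.
    move: h1; rewrite -lj; case: (s) => h1.
      rewrite /sgb mul1r in h1; have [d1 d2] := sdel l.
      exact: lognormal_entry_bound (ltW (sd0 l)) h1 d1 d2.
    apply: zero; rewrite /q /gam lj eqxx -lj mulr1 -mulrBr ler_wpM2l//.
    rewrite /sgb mulN1r in h1; have /ler_normlP[hS _] := h1.
    by rewrite opprB opprK in hS; lra.
  apply: (HC n _ D lo hi) => //.
  - exact: ltW.
  - by move=> j i x; exact: (ent j true).
  - by move=> j i x; exact: (ent j false).
have PA := condcov_betaD_dev beta eps_err mNN PNN dev.
rewrite sub0r normrN ger0_norm ?fine_ge0//=.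
rewrite -lee_fin fineK; first exact: PA.
apply: fin_num_measure; exact: (@measurable_condcov_betaD_dev _ _ _ P p r z eps beta sigma eps_err).
Unshelve. all: by end_near. Qed.

End AsymptoticCovariance.

Theorem theorem6 (d : measure_display) (T : measurableType d) (R : realType)
  (P : probability T R) (p r : nat) (p_gt0 : (0 < p)%N) (r_gt0 : (0 < r)%N)
  (mu : 'cV[R]_p) (sd : 'rV[R]_p) (rho : 'M[R]_p)
  (sd_ge0 : forall j, 0 <= sd ord0 j)
  (rho_corr : correlation_matrix rho)
  (Sigma_full : diag_mx sd *m rho *m diag_mx sd \in unitmx)
  (beta : 'cV[R]_(1 + p)) (sigma : R) (sigma_gt0 : 0 < sigma)
  (z : nat -> {RV P >-> p.-tuple R}) (eps : nat -> {RV P >-> R})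
  (z_indep : mutually_independent z) (z_id : identically_distributed z)
  (eps_err : homoscedastic_errors z eps sigma) :
  let Phi := diag_mx sd in
  let Sigma := Phi *m rho *m Phi in
  let k : R := (2 * p * r)%:R in
  ((forall i, mvnormal mu Sigma (z i)) ->
    let A (n : nat) : 'M[R]_(1 + p) :=
      diag_mx (row_mx (const_mx 1) (const_mx (Num.sqrt (ln n%:R)))) in
    let L : 'M[R]_(1 + p) := (sigma ^+ 2 / (2 * k)) *:
      block_mx 2%:M 0
               0    (p%:R *: invmx (Phi *m (rho *m rho) *m Phi)) in
    OP_mx P
      (fun n w => condcov_mx P (sigmaZ z n)
                    (fun v => A n *m betaD z eps r beta n v) w - L)
      (fun n => 1 / Num.sqrt (ln n%:R)))
  /\
  ((forall i, mvlognormal mu Sigma (z i)) ->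
    let A (n : nat) : 'M[R]_(1 + p) :=
      diag_mx (row_mx (const_mx 1)
        (\row_j expR (sd ord0 j * Num.sqrt (2 * ln n%:R)))) in
    let u : 'cV[R]_p := \col_j expR (- mu j ord0) in
    let Lambda : 'M[R]_p := diag_mx (\row_j expR (- (2 * mu j ord0))) in
    let L : 'M[R]_(1 + p) := (2 * sigma ^+ 2 / k) *:
      block_mx 1%:M  (- u^T)
               (- u) (p%:R *: Lambda + u *m u^T) in
    oP1_mx P
      (fun n w => condcov_mx P (sigmaZ z n)
                    (fun v => A n *m betaD z eps r beta n v) w - L)).
Proof.
move=> Phi Sigma k; split=> hz A L.
  exact: (covariance_OP_normal p_gt0 r_gt0 sd_ge0 rho_corr Sigma_full beta
    z_indep z_id eps_err (hz 0%N)).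
move=> Lambda L'.
exact: (covariance_oP_lognormal p_gt0 r_gt0 sd_ge0 rho_corr Sigma_full beta
  z_indep z_id eps_err hz).
Qed.
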